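(* Let $k\ge 0$ be an integer and let $A_k,B_k$ be constants such that $$\xi_k(s)=e^{A_k+B_ks}\prod_{\rho_k}\left(1-\frac{s}{\rho_k}\right)e^{\frac{s}{\rho_k}}$$ for all $s\in\mathbb{C}$, the product being over all zeros $\rho_k$ of $\xi_k$ (counted with multiplicity). Then $$e^{A_k}=\xi_k(0)=\frac{(-1)^k(2k-1)!!}{(4\sqrt{\pi})^k}$$ and $$B_k=-\frac{2k(k-1)}{2k-1}\log 2-\frac{1}{2(2k-1)}\log 4\pi+\frac{\gamma}{2(2k-1)}-1,$$ where $\gamma$ is the Euler constant.
   Context: Let $\zeta$ be the Riemann zeta function, $\chi(s)=2^s\pi^{s-1}\sin(\pi s/2)\Gamma(1-s)$ (so $\zeta(s)=\chi(s)\zeta(1-s)$), and $$\omega(s)=\frac{\chi'}{\chi}(s)=\log 2\pi-\frac{\Gamma'}{\Gamma}(s)+\frac{\pi}{2}\tan\frac{\pi s}{2}.$$ The meromorphic functions $Z_k$ are defined recursively by $Z_0(s)=\zeta(s)$ and $Z_{k+1}(s)=Z_k'(s)-\frac12\omega(s)Z_k(s)$ for $k\ge 0$. For $k\ge 0$ define $$\xi_k(s)=\pi^{-\frac{s}{2}}\,s(s-1)\,\frac{Z_k(s)}{\Gamma\left(\frac{s}{2}\right)^{k-1}\Gamma\left(\frac{1-s}{2}\right)^k},$$ which is an entire function (after filling in removable singularities), and which admits a Hadamard factorization of the form in the claim. Here $(2k-1)!!=\prod_{l=1}^k(2l-1)$, with $(-1)!!=1$. *)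

(* Defs.v *)
From Stdlib Require Import Reals List ZArith.
From Coquelicot Require Import Coquelicot.

Open Scope R_scope.

Definition Cexp (z : C) : C :=
  (exp (Re z) * cos (Im z), exp (Re z) * sin (Im z)).

Definition Csin (z : C) : C :=
  ((Cexp (Ci * z) - Cexp (- (Ci * z))) / (2 * Ci))%C.

(* [x ^ s] for [0 < x], with the real logarithm of [x]. *)
Definition Rpow_C (x : R) (s : C) : C := Cexp (s * ln x)%C.

Definition Cpow_Z (z : C) (n : Z) : C :=
  match n with
  | Z0 => 1%C
  | Zpos p => Cpow z (Pos.to_nat p)
  | Zneg p => (/ Cpow z (Pos.to_nat p))%C
  end.

Definition analytic_at (f : C -> C) (z : C) : Prop :=
  exists (a : nat -> C) (r : posreal), forall h : C, Cmod h < r ->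
    @is_pseries C_AbsRing C_NormedModule a h (f (z + h)%C).

Definition zero_of_order (f : C -> C) (rho : C) (m : nat) : Prop :=
  exists g : C -> C, analytic_at g rho /\ g rho <> 0%C /\
    locally rho (fun z => f z = (Cpow (z - rho) m * g z)%C).

(* The multiset of zeros of [f]: a zero [rho] of order [m] is represented by
   the [m] pairs [(rho, 0)], ..., [(rho, m - 1)]. *)
Definition zeros_with_mult (f : C -> C) (p : C * nat) : Prop :=
  exists m : nat, zero_of_order f (fst p) m /\ (snd p < m)%nat.

Definition Cprod {I : Type} (f : I -> C) (l : list I) : C :=
  fold_right (fun i p => (f i * p)%C) 1%C l.

(* The family [f] restricted to [P] has the (unconditional) product [v]: the
   finite subproducts converge to [v] along the finite subsets of [P] directed
   by inclusion.  No enumeration of [P] is chosen, and [P] may be finite. *)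
Definition has_prod {I : Type} (P : I -> Prop) (f : I -> C) (v : C) : Prop :=
  forall eps : posreal, exists l0 : list I, List.Forall P l0 /\
    forall l : list I, NoDup l -> List.Forall P l -> incl l0 l ->
      Cmod (Cprod f l - v) < eps.

(* Euler's constant, lim (1 + 1/2 + ... + 1/n - log n); the index is shifted
   by one. *)
Definition euler_gamma : R :=
  real (Lim_seq (fun n =>
    sum_n (fun j => / INR (S j)) n - ln (INR (S n)))).

Definition CLim_seq (u : nat -> C) : C :=
  (real (Lim_seq (fun n => Re (u n))), real (Lim_seq (fun n => Im (u n)))).

(* Euler's limit
     Gamma(s) = lim n! n^s / (s (s + 1) ... (s + n)),
   valid for all complex [s] outside 0, -1, -2, ...; the value at these poles
   is irrelevant. *)
Definition CGamma (s : C) : C :=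
  CLim_seq (fun n =>
    (INR (fact n) * Rpow_C (INR n) s
     / Cprod (fun j : nat => s + INR j) (seq 0 (S n)))%C).

(* The analytic continuation to [C \ {1}] of the Dirichlet series; it is
   determined uniquely outside [1], and its value at [1] is unconstrained. *)
Definition is_riemann_zeta (zeta : C -> C) : Prop :=
  (forall s : C, 1 < Re s ->
     @is_series C_AbsRing C_NormedModule
       (fun n => Rpow_C (INR (S n)) (- s)) (zeta s)) /\
  (forall s : C, s <> 1%C -> analytic_at zeta s).

Definition chi (s : C) : C :=
  (Rpow_C 2 s * Rpow_C PI (s - 1) * Csin (PI * s / 2) * CGamma (1 - s))%C.

Definition omega (s : C) : C := (C_derive chi s / chi s)%C.

(* Meromorphic functions are total functions here, with irrelevant values on a
   closed discrete set (the integers, for [omega] and [Zf]) containing the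
   poles.  [C_derive] at a point outside that set only depends on the values
   outside it. *)
Fixpoint Zf (zeta : C -> C) (k : nat) (s : C) : C :=
  match k with
  | O => zeta s
  | S k' => (C_derive (Zf zeta k') s - / 2 * omega s * Zf zeta k' s)%C
  end.

Definition xi_formula (zeta : C -> C) (k : nat) (s : C) : C :=
  (Rpow_C PI (- (s / 2)) * (s * (s - 1))
   * (Zf zeta k s
      / (Cpow_Z (CGamma (s / 2)) (Z.of_nat k - 1)
         * Cpow (CGamma ((1 - s) / 2)) k)))%C.

(* [C_lim f s], when the limit of [f] at [s] exists, is its limit over punctured
   neighbourhoods of [s]; so this fills in the removable singularities. *)
Definition xi (zeta : C -> C) (k : nat) (s : C) : C :=
  C_lim (xi_formula zeta k) s.

(* (2k - 1)!! *)
Fixpoint odd_dfact (k : nat) : nat :=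
  match k with
  | O => 1%nat
  | S l => (odd_dfact l * (2 * S l - 1))%nat
  end.

(* Main.v *)
(** Comparing the factorization at [0] and to first order at [0] gives
[e^A = xi_k(0)] and [B = xi_k'(0) / xi_k(0)], because the canonical product is
[1 + O(s^2)]: its unconditional convergence at one small point forces
[sum 1/|rho|^2] to converge.  Near [0] write [Z_k(s) = s^(-k) W_k(s)]; then
[W_{k+1} = s W_k' - k W_k - (s omega) W_k / 2], where [s omega(s)] is holomorphic
with value [1] and derivative [log(2 pi) + gamma] at [0].  Hence
[W_{k+1}(0) = -(k + 1/2) W_k(0)], and the logarithmic derivatives [r_k] of [W_k]
at [0] satisfy [(2k+1) r_{k+1} = (2k-1) r_k + log(2 pi) + gamma].  The initial
values [zeta(0) = -1/2], [zeta'(0) = -log(2 pi)/2] come from the identity theorem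
along a segment from [2+i] to [0], applied to [(1 - 2^(1-s)) zeta(s)] and
[1/2 + 1/2 sum_m ((2m+1)^(-s) - 2 (2m+2)^(-s) + (2m+3)^(-s))], whose derivative at
[0] is a Wallis product. *)
Require Import Defs.
From Stdlib Require Import Reals List ZArith Lra Lia ssreflect.
From Coquelicot Require Import Coquelicot.
Open Scope R_scope.

(** * Complex differentiation *)

(** Holomorphy is never deduced from a single complex derivative: the basic functions come with an
    explicit chain of all their derivatives, bounded on a disc, and smoothness or a Taylor expansion
    is read off from the chain. For this reason [Gamma] is rebuilt from Euler's limit as the
    exponential of a series around argument 1; a disc of radius 3/4 there contains 3/2, from which
    [Gamma ((1 - s) / 2)] near [s = 0] is reached by one shift. In the series for
    [(1 - 2^(1-s)) zeta(s)] each alternating term is averaged with its neighbour. The resulting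
    second differences are absolutely summable for [Re s > -1], so 0 is an interior point; the plain
    alternating series stops at [Re s > 0]. The segment starts off the real axis because it must
    avoid the pole at 1. Of the canonical product only the values are known, with no growth
    information. As [xi_k(0)] is nonzero, so is the product near 0, hence finite products avoiding
    finitely many zeros stay close to 1. Sorting factors by the direction of their deviation from 1
    turns this into absolute summability. *)

Definition ccont (q : C -> C) (z : C) : Prop :=
  forall eps, 0 < eps -> exists d, 0 < d /\
    forall w, Cmod (w - z) < d -> Cmod (q w - q z) < eps.

(* Caratheodory's form of the complex derivative: the difference quotient
   extends continuously to [z]. *)
Definition CD (f : C -> C) (z l : C) : Prop :=
  exists (q : C -> C) (d : R), 0 < d /\ ccont q z /\ q z = l /\
    forall w, Cmod (w - z) < d -> f w = (f z + q w * (w - z))%C.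

Lemma Cmod_minus_sym (a b : C) : Cmod (a - b) = Cmod (b - a).
Proof. by rewrite -Cmod_opp; f_equal; ring. Qed.

Lemma Cmod_triangle_sub (a b : C) : Cmod a <= Cmod b + Cmod (a - b).
Proof.
  apply: Rle_trans (Cmod_triangle b (a - b)); apply: Req_le; f_equal; ring.
Qed.

Lemma Cmod_self_minus (z : C) : Cmod (z - z) = 0.
Proof. by rewrite -Cmod_0; f_equal; ring. Qed.

Lemma Csub_eq0 (a b : C) : (a - b)%C = 0%C -> a = b.
Proof. by move=> E; rewrite -(Cplus_0_l b) -E; ring. Qed.

Lemma RtoC_neq0 (x : R) : x <> 0 -> RtoC x <> 0%C.
Proof. by move=> H [E]. Qed.

Lemma lt_Rmin_l (x a b : R) : x < Rmin a b -> x < a.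
Proof. by have := Rmin_l a b; lra. Qed.

Lemma lt_Rmin_r (x a b : R) : x < Rmin a b -> x < b.
Proof. by have := Rmin_r a b; lra. Qed.

Lemma inv_INR_S_bounds (n : nat) : 0 < / INR (S n) <= 1.
Proof.
  have H : 1 <= INR (S n) by rewrite S_INR; have := pos_INR n; lra.
  split; first by apply: Rinv_0_lt_compat; lra.
  rewrite -Rinv_1; apply: Rinv_le_contravar; lra.
Qed.

Lemma INR_fact_ge1 (n : nat) : 1 <= INR (fact n).
Proof. by apply: (le_INR 1); have := lt_O_fact n; lia. Qed.

Lemma two_neq0_C : RtoC 2 <> 0%C.
Proof. by move=> [E]; lra. Qed.

Lemma INR_fact_S_C (n : nat) : RtoC (INR (fact (S n))) = (INR (S n) * INR (fact n))%C.
Proof. by rewrite -RtoC_mult -mult_INR. Qed.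

Lemma ccont_const (c z : C) : ccont (fun _ => c) z.
Proof. by move=> eps He; exists 1; split; [lra|move=> w _; rewrite Cmod_self_minus]. Qed.

Lemma ccont_id (z : C) : ccont (fun w => w) z.
Proof. by move=> eps He; exists eps; split. Qed.

Lemma ccont_ext_loc (f g : C -> C) (z : C) (d : R) : 0 < d ->
  (forall w, Cmod (w - z) < d -> f w = g w) -> ccont f z -> ccont g z.
Proof.
  move=> Hd Hfg Hf eps He; have [d1 [Hd1 H]] := Hf eps He.
  exists (Rmin d d1); split; first exact: Rmin_pos.
  move=> w Hw; rewrite -!Hfg ?Cmod_self_minus //.
  - by apply: H; apply: lt_Rmin_r Hw.
  - by apply: lt_Rmin_l Hw.
Qed.

Lemma ccont_plus (f g : C -> C) (z : C) :
  ccont f z -> ccont g z -> ccont (fun w => f w + g w)%C z.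
Proof.
  move=> Hf Hg eps He.
  have [d1 [Hd1 H1]] := Hf (eps / 2) ltac:(lra).
  have [d2 [Hd2 H2]] := Hg (eps / 2) ltac:(lra).
  exists (Rmin d1 d2); split; first exact: Rmin_pos.
  move=> w Hw.
  have Hw1 := H1 w (lt_Rmin_l _ _ _ Hw).
  have Hw2 := H2 w (lt_Rmin_r _ _ _ Hw).
  replace (f w + g w - (f z + g z))%C with ((f w - f z) + (g w - g z))%C by ring.
  apply: Rle_lt_trans (Cmod_triangle _ _) _; lra.
Qed.

Lemma ccont_mult (f g : C -> C) (z : C) :
  ccont f z -> ccont g z -> ccont (fun w => f w * g w)%C z.
Proof.
  move=> Hf Hg eps He.
  set F := Cmod (f z); set G := Cmod (g z).
  have HF : 0 <= F := Cmod_ge_0 _; have HG : 0 <= G := Cmod_ge_0 _.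
  set e := Rmin 1 (eps / (2 + F + G)).
  have He0 : 0 < eps / (2 + F + G) by apply: Rdiv_lt_0_compat; lra.
  have Hepos : 0 < e by apply: Rmin_pos; lra.
  have [d1 [Hd1 H1]] := Hf e Hepos.
  have [d2 [Hd2 H2]] := Hg e Hepos.
  exists (Rmin d1 d2); split; first exact: Rmin_pos.
  move=> w Hw.
  have Hw1 := H1 w (lt_Rmin_l _ _ _ Hw).
  have Hw2 := H2 w (lt_Rmin_r _ _ _ Hw).
  replace (f w * g w - f z * g z)%C with
    ((f w - f z) * (g w - g z) + ((f w - f z) * g z + f z * (g w - g z)))%C by ring.
  apply: Rle_lt_trans (Cmod_triangle _ _) _.
  apply: Rle_lt_trans (Rplus_le_compat_l _ _ _ (Cmod_triangle _ _)) _.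
  rewrite !Cmod_mult -/F -/G.
  have e1 : e <= 1 := Rmin_l _ _.
  have e2 : e * (2 + F + G) <= eps.
    have : e <= eps / (2 + F + G) := Rmin_r _ _.
    move=> /(Rmult_le_compat_r (2 + F + G)) H; apply: Rle_trans (H _) _; first lra.
    by apply: Req_le; field; lra.
  move: (Cmod_ge_0 (f w - f z)) (Cmod_ge_0 (g w - g z)) => P1 P2.
  nra.
Qed.

Lemma ccont_opp (f : C -> C) (z : C) : ccont f z -> ccont (fun w => - f w)%C z.
Proof.
  move=> Hf; have H := ccont_mult _ _ z (ccont_const (-(1))%C z) Hf.
  apply: (ccont_ext_loc _ _ z 1 Rlt_0_1 _ H) => w _ /=; ring.
Qed.

Lemma ccont_comp (f g : C -> C) (z : C) :
  ccont f z -> ccont g (f z) -> ccont (fun w => g (f w)) z.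
Proof.
  move=> Hf Hg eps He.
  have [d [Hd H]] := Hg eps He; have [d' [Hd' H']] := Hf d Hd.
  by exists d'; split=> // w Hw; apply: H; apply: H'.
Qed.

Lemma ccont_neq0 (f : C -> C) (z : C) : ccont f z -> f z <> 0%C ->
  exists d, 0 < d /\ forall w, Cmod (w - z) < d -> Cmod (f z) / 2 < Cmod (f w).
Proof.
  move=> Hf /Cmod_gt_0 Hz.
  have [d [Hd H]] := Hf (Cmod (f z) / 2) ltac:(lra).
  exists d; split=> // w Hw; have := H w Hw; rewrite Cmod_minus_sym.
  have := Cmod_triangle_sub (f z) (f w); lra.
Qed.

Lemma Cmod_pos_neq0 (z : C) : 0 < Cmod z -> z <> 0%C.
Proof. by move/Cmod_gt_0. Qed.

Lemma ccont_inv (f : C -> C) (z : C) : ccont f z -> f z <> 0%C ->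
  ccont (fun w => / f w)%C z.
Proof.
  move=> Hf Hz eps He; have Hm := proj1 (Cmod_gt_0 _) Hz.
  have [d [Hd H]] := ccont_neq0 f z Hf Hz.
  set m := Cmod (f z) in Hm H *.
  have [d' [Hd' H']] := Hf (eps * m * m / 2) ltac:(do 2 (apply: Rmult_lt_0_compat; try lra); apply: Rmult_lt_0_compat; lra).
  exists (Rmin d d'); split; first exact: Rmin_pos.
  move=> w Hw.
  have Hw1 := H w (lt_Rmin_l _ _ _ Hw).
  have Hw2 := H' w (lt_Rmin_r _ _ _ Hw).
  have Hfw : f w <> 0%C by apply: Cmod_pos_neq0; lra.
  replace (/ f w - / f z)%C with ((f z - f w) * / (f w * f z))%C by (field; split; auto).
  rewrite Cmod_mult Cmod_inv; last by apply: Cmult_neq_0.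
  rewrite Cmod_mult -/m Cmod_minus_sym.
  have Hp : 0 < Cmod (f w) * m by nra.
  apply: (Rmult_lt_reg_r (Cmod (f w) * m)) => //.
  rewrite Rmult_assoc Rinv_l; last lra.
  rewrite Rmult_1_r; apply: Rlt_le_trans Hw2 _.
  have : eps * m * (m / 2) <= eps * m * Cmod (f w) by apply: Rmult_le_compat_l; nra.
  lra.
Qed.

Lemma CD_ccont (f : C -> C) (z l : C) : CD f z l -> ccont f z.
Proof.
  move=> [q [d [Hd [Hq [Hl H]]]]].
  apply: (ccont_ext_loc (fun w => f z + q w * (w + - z))%C _ z d Hd) => [w Hw|].
    by rewrite (H w Hw).
  apply: ccont_plus; first exact: ccont_const.
  apply: ccont_mult => //; apply: ccont_plus; [exact: ccont_id|exact: ccont_const].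
Qed.

Lemma CD_ext_loc (f g : C -> C) (z l : C) (d : R) : 0 < d ->
  (forall w, Cmod (w - z) < d -> f w = g w) -> CD f z l -> CD g z l.
Proof.
  move=> Hd Hfg [q [d1 [Hd1 [Hq [Hl H]]]]].
  exists q, (Rmin d d1); split; first exact: Rmin_pos.
  split=> //; split=> // w Hw.
  rewrite -!Hfg ?Cmod_self_minus //.
  - by apply: H; apply: lt_Rmin_r Hw.
  - by apply: lt_Rmin_l Hw.
Qed.

Lemma CD_ext (f g : C -> C) (z l : C) :
  (forall w, f w = g w) -> CD f z l -> CD g z l.
Proof. by move=> H; apply: (CD_ext_loc _ _ _ _ 1 Rlt_0_1) => w _. Qed.

Lemma CD_const (c z : C) : CD (fun _ => c) z 0%C.
Proof.
  exists (fun _ => 0%C), 1; split; first lra.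
  split; first exact: ccont_const.
  by split=> // w _; ring.
Qed.

Lemma CD_id (z : C) : CD (fun w => w) z 1%C.
Proof.
  exists (fun _ => 1%C), 1; split; first lra.
  split; first exact: ccont_const.
  by split=> // w _; ring.
Qed.

Lemma CD_plus (f g : C -> C) (z a b : C) : CD f z a -> CD g z b ->
  CD (fun w => f w + g w)%C z (a + b)%C.
Proof.
  move=> [q [d [Hd [Hq [Hl H]]]]] [q' [d' [Hd' [Hq' [Hl' H']]]]].
  exists (fun w => q w + q' w)%C, (Rmin d d'); split; first exact: Rmin_pos.
  split; first exact: ccont_plus.
  split; first by rewrite Hl Hl'.
  move=> w Hw.
  rewrite (H w (lt_Rmin_l _ _ _ Hw)).
  rewrite (H' w (lt_Rmin_r _ _ _ Hw)); ring.
Qed.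

Lemma CD_mult (f g : C -> C) (z a b : C) : CD f z a -> CD g z b ->
  CD (fun w => f w * g w)%C z (a * g z + f z * b)%C.
Proof.
  move=> Hf Hg; have Cg := CD_ccont _ _ _ Hg.
  move: Hf Hg => [q [d [Hd [Hq [Hl H]]]]] [q' [d' [Hd' [Hq' [Hl' H']]]]].
  exists (fun w => q w * g w + f z * q' w)%C, (Rmin d d'); split; first exact: Rmin_pos.
  split; first by apply: ccont_plus; apply: ccont_mult => //; apply: ccont_const.
  split; first by rewrite Hl Hl'.
  move=> w Hw.
  rewrite (H w (lt_Rmin_l _ _ _ Hw)).
  have Eg := H' w (lt_Rmin_r _ _ _ Hw).
  transitivity (f z * g w + q w * g w * (w - z))%C; first ring.
  rewrite {1}Eg; ring.
Qed.

Lemma CD_eq (f : C -> C) (z a b : C) : a = b -> CD f z a -> CD f z b.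
Proof. by move=> ->. Qed.

Lemma CD_scal (c : C) (f : C -> C) (z a : C) : CD f z a ->
  CD (fun w => c * f w)%C z (c * a)%C.
Proof.
  move=> Hf; apply: CD_eq (CD_mult _ _ _ _ _ (CD_const c z) Hf) => /=; ring.
Qed.

Lemma CD_opp (f : C -> C) (z a : C) : CD f z a -> CD (fun w => - f w)%C z (- a)%C.
Proof.
  move=> Hf; apply: (CD_ext (fun w => (-(1)) * f w)%C) => [w|]; first ring.
  apply: CD_eq (CD_scal (-(1))%C _ _ _ Hf); ring.
Qed.

Lemma CD_minus (f g : C -> C) (z a b : C) : CD f z a -> CD g z b ->
  CD (fun w => f w - g w)%C z (a - b)%C.
Proof. by move=> Hf Hg; apply: CD_plus => //; apply: CD_opp. Qed.

Lemma CD_comp (f g : C -> C) (z a b : C) : CD f z a -> CD g (f z) b ->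
  CD (fun w => g (f w)) z (b * a)%C.
Proof.
  move=> Hf Hg; have Cf := CD_ccont _ _ _ Hf.
  move: Hf Hg => [q [d [Hd [Hq [Hl H]]]]] [q' [d' [Hd' [Hq' [Hl' H']]]]].
  have [d2 [Hd2 H2]] := Cf d' Hd'.
  exists (fun w => q' (f w) * q w)%C, (Rmin d d2); split; first exact: Rmin_pos.
  split; first by apply: ccont_mult => //; apply: (ccont_comp f).
  split; first by rewrite Hl Hl'.
  move=> w Hw.
  have Hw1 := lt_Rmin_l _ _ _ Hw.
  have Hw2 := lt_Rmin_r _ _ _ Hw.
  rewrite (H' (f w) (H2 w Hw2)) {2}(H w Hw1); ring.
Qed.

Lemma CD_inv (f : C -> C) (z a : C) : CD f z a -> f z <> 0%C ->
  CD (fun w => / f w)%C z (- a * / f z * / f z)%C.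
Proof.
  move=> Hf Hz; have Cf := CD_ccont _ _ _ Hf.
  move: Hf => [q [d [Hd [Hq [Hl H]]]]].
  have [d2 [Hd2 H2]] := ccont_neq0 f z Cf Hz.
  exists (fun w => - q w * / f w * / f z)%C, (Rmin d d2); split; first exact: Rmin_pos.
  split.
    apply: ccont_mult; last exact: ccont_const.
    apply: ccont_mult; [exact: ccont_opp|exact: ccont_inv].
  split; first by rewrite Hl.
  move=> w Hw.
  have Hw1 := lt_Rmin_l _ _ _ Hw.
  have Hw2 := H2 w (lt_Rmin_r _ _ _ Hw).
  have Hz' := proj1 (Cmod_gt_0 _) Hz.
  have Hfw : f w <> 0%C by apply: Cmod_pos_neq0; lra.
  have E : (q w * (w - z) = f w - f z)%C by rewrite (H w Hw1); ring.
  transitivity (/ f z - (q w * (w - z)) * / f w * / f z)%C; last ring.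
  rewrite E; field; split; auto.
Qed.

Lemma CD_div (f g : C -> C) (z a b : C) : CD f z a -> CD g z b -> g z <> 0%C ->
  CD (fun w => f w / g w)%C z ((a * g z - f z * b) / (g z * g z))%C.
Proof.
  move=> Hf Hg Hz; apply: CD_eq (CD_mult _ _ _ _ _ Hf (CD_inv _ _ _ Hg Hz)).
  field; auto.
Qed.

Lemma CD_pow (f : C -> C) (z a : C) (n : nat) : CD f z a ->
  CD (fun w => Cpow (f w) n) z (INR n * Cpow (f z) (pred n) * a)%C.
Proof.
  move=> Hf; elim: n => [|n IH] /=.
    apply: CD_eq (CD_const 1%C z); rewrite /=; ring.
  apply: CD_eq (CD_mult _ _ _ _ _ Hf IH).
  rewrite -/(INR (S n)) S_INR RtoC_plus; case: n {IH} => [|n] /=; first ring.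
  rewrite -/(INR (S n)) S_INR RtoC_plus; ring.
Qed.

(** Since [f] and [h] are compared only off [z], this serves both for difference quotients and for
    filling removable singularities. *)
Lemma ccont_C_lim (f h : C -> C) (z : C) (d : R) : 0 < d ->
  (forall w, w <> z -> Cmod (w - z) < d -> f w = h w) -> ccont h z ->
  C_lim f z = h z.
Proof.
  move=> Hd Hfh Hh.
  apply: is_C_lim_unique => P [eps HP].
  have [d' [Hd' H']] := Hh eps (cond_pos eps).
  (* Balls of [C] are squares: one of half-side [m] lies within modulus [sqrt 2 * m]. *)
  have Hm : 0 < Rmin d d' / sqrt 2.
    by apply: Rdiv_lt_0_compat; [exact: Rmin_pos|exact: Rlt_sqrt2_0].
  exists (mkposreal _ Hm) => w Hw Hne.
  have Hw' : Cmod (w - z) < Rmin d d'.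
    have := C_NormedModule_mixin_compat2 z w _ Hw.
    rewrite /minus /plus /opp /= => H0; apply: Rlt_le_trans H0 _.
    apply: Req_le; field; exact: sqrt2_neq_0.
  apply: HP; apply: C_NormedModule_mixin_compat1.
  rewrite Hfh //; last by apply: lt_Rmin_l Hw'.
  apply: H'; exact: lt_Rmin_r Hw'.
Qed.

Lemma CD_derive (f : C -> C) (z l : C) : CD f z l -> C_derive f z = l.
Proof.
  move=> [q [d [Hd [Hq [<- H]]]]].
  apply: (ccont_C_lim _ _ _ d Hd) => // w Hne Hw; rewrite (H w Hw); field.
  by move=> E; apply: Hne; apply: Csub_eq0.
Qed.

Lemma CD_unique (f : C -> C) (z a b : C) : CD f z a -> CD f z b -> a = b.
Proof. by move=> /CD_derive <- /CD_derive. Qed.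

Definition RD (f : R -> C) (t : R) (l : C) : Prop :=
  is_derive (fun t => Re (f t)) t (Re l) /\ is_derive (fun t => Im (f t)) t (Im l).

(** A complex-valued path has no mean value theorem, so the real one is applied to its projection
    [h] on the direction of the total increment [D]. There [h b - h a] equals [|D|^2] while [h'] is
    at most [|D| * M], and one factor [|D|] is divided out. *)
Lemma MVI_R (f f' : R -> C) (a b M : R) : a <= b ->
  (forall t, a <= t <= b -> RD f t (f' t) /\ Cmod (f' t) <= M) ->
  Cmod (f b - f a) <= M * (b - a).
Proof.
  move=> Hab H.
  set D := (f b - f a)%C.
  pose h t := Re D * Re (f t) + Im D * Im (f t).
  pose h' t := Re D * Re (f' t) + Im D * Im (f' t).
  have Hh : forall t, a <= t <= b -> is_derive h t (h' t).
    move=> t Ht; have [[H1 H2] _] := H t Ht.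
    by apply: is_derive_plus; apply: is_derive_scal.
  have [c [Hc E]] : exists c, a <= c <= b /\ h b - h a = h' c * (b - a).
    have [||c [Hc E]] := MVT_gen h a b h'.
    - by move=> x; rewrite Rmin_left // Rmax_right // => Hx; apply: Hh; lra.
    - move=> x; rewrite Rmin_left // Rmax_right // => Hx.
      apply: derivable_continuous_pt; exists (h' x).
      by apply/is_derive_Reals; apply: Hh.
    - by exists c; split; [rewrite Rmin_left // Rmax_right // in Hc|].
  have Eh : h b - h a = Cmod D ^ 2.
    rewrite Cmod2_alt /h /D /Re /Im /=; ring.
  have Bh : h' c <= Cmod D * M.
    have [_ HM] := H c Hc.
    apply: Rle_trans (Rmult_le_compat_l _ _ _ (Cmod_ge_0 D) HM).
    have := re_le_Cmod (Cconj D * f' c); rewrite Cmod_mult Cmod_conj => Hre.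
    apply: Rle_trans Hre; apply: Rle_trans (Rle_abs _); apply: Req_le.
    rewrite /h' /Re /Im /=; ring.
  have [E0|Hpos] : Cmod D = 0 \/ 0 < Cmod D by have := Cmod_ge_0 D; lra.
    rewrite E0; have [_ HM] := H c Hc; have := Cmod_ge_0 (f' c).
    move=> ?; apply: Rmult_le_pos; lra.
  apply: (Rmult_le_reg_l (Cmod D)) => //.
  have : Cmod D ^ 2 <= Cmod D * M * (b - a).
    by rewrite -Eh E; apply: Rmult_le_compat_r => //; lra.
  lra.
Qed.

Lemma CD_path (f : C -> C) (x v l : C) (t : R) : CD f (x + t * v)%C l ->
  RD (fun t : R => f (x + t * v)%C) t (l * v)%C.
Proof.
  move=> [q [d [Hd [Hq [Hl H]]]]].
  have key : forall eps, 0 < eps -> exists delta : posreal, forall h : R, h <> 0 ->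
    Rabs h < delta -> Cmod ((f (x + (t + h)%R * v) - f (x + t * v)) / h - l * v)%C < eps.
    move=> eps He.
    set V := Cmod v; have HV : 0 <= V := Cmod_ge_0 _.
    (* The added 1 keeps the denominator positive when [v = 0]. *)
    have [d1 [Hd1 H1]] := Hq (eps / (1 + V)) ltac:(apply: Rdiv_lt_0_compat; lra).
    have Hm : 0 < Rmin d d1 / (1 + V) by apply: Rdiv_lt_0_compat; [exact: Rmin_pos|lra].
    exists (mkposreal _ Hm) => h Hh0 /= Hh.
    have E : (x + (t + h)%R * v - (x + t * v) = h * v)%C by rewrite RtoC_plus; ring.
    have Hw : Cmod (x + (t + h)%R * v - (x + t * v)) < Rmin d d1.
      rewrite E Cmod_mult Cmod_R -/V.
      apply: (Rle_lt_trans _ (Rabs h * (1 + V))).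
        by apply: Rmult_le_compat_l; [exact: Rabs_pos|lra].
      move/(Rmult_lt_compat_r (1 + V)): Hh => Hh; apply: Rlt_le_trans (Hh _) _; first lra.
      by apply: Req_le; field; lra.
    rewrite (H _ (lt_Rmin_l _ _ _ Hw)) E -Hl.
    replace ((f (x + t * v) + q (x + (t + h)%R * v) * (h * v) - f (x + t * v)) / h -
      q (x + t * v) * v)%C with ((q (x + (t + h)%R * v) - q (x + t * v)) * v)%C.
      2: by field; apply: RtoC_neq0.
    rewrite Cmod_mult -/V.
    have := H1 _ (lt_Rmin_r _ _ _ Hw).
    set K := Cmod _ => HK; have HK0 : 0 <= K := Cmod_ge_0 _.
    apply: (Rle_lt_trans _ (K * (1 + V))); first by apply: Rmult_le_compat_l; lra.
    move/(Rmult_lt_compat_r (1 + V)): HK => HK; apply: Rlt_le_trans (HK _) _; first lra.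
    by apply: Req_le; field; lra.
  split; apply/is_derive_Reals => eps He; have [delta Hdl] := key eps He;
    exists delta => h Hh0 Hh; have := Hdl h Hh0 Hh => HC.
  - apply: Rle_lt_trans HC; apply: Rle_trans (re_le_Cmod _); apply: Req_le; f_equal.
    by rewrite /Re /Im /=; field.
  - apply: Rle_lt_trans HC; have := Rmax_Cmod ((f (x + (t + h)%R * v) - f (x + t * v)) / h - l * v)%C.
    move=> HR; apply: Rle_trans HR; apply: Rle_trans (Rmax_r _ _); apply: Req_le; f_equal.
    by rewrite /Re /Im /=; field.
Qed.

Lemma MVI (f f' : C -> C) (x y : C) (M : R) :
  (forall t : R, 0 <= t <= 1 ->
     CD f (x + t * (y - x))%C (f' (x + t * (y - x))%C) /\
     Cmod (f' (x + t * (y - x))%C) <= M) ->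
  Cmod (f y - f x) <= M * Cmod (y - x).
Proof.
  move=> H.
  have := MVI_R (fun t : R => f (x + t * (y - x))%C)
    (fun t : R => f' (x + t * (y - x))%C * (y - x))%C 0 1 (M * Cmod (y - x)) Rle_0_1.
  rewrite Rminus_0_r Rmult_1_r.
  replace (x + 1 * (y - x))%C with y by ring.
  replace (x + 0 * (y - x))%C with x by ring.
  apply=> t Ht; have [H1 H2] := H t Ht; split; first exact: CD_path.
  rewrite Cmod_mult; apply: Rmult_le_compat_r => //; exact: Cmod_ge_0.
Qed.

Lemma ball_segment (c x y : C) (r : R) : Cmod (x - c) < r -> Cmod (y - c) < r ->
  forall t : R, 0 <= t <= 1 -> Cmod (x + t * (y - x) - c) < r.
Proof.
  move=> Hx Hy t Ht.
  replace (x + t * (y - x) - c)%C with ((1 - t)%R * (x - c) + t * (y - c))%C.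
    2: by rewrite RtoC_minus; ring.
  apply: Rle_lt_trans (Cmod_triangle _ _) _.
  rewrite !Cmod_mult !Cmod_R !Rabs_pos_eq; try lra.
  have H0 := Cmod_ge_0 (x - c); have H1 := Cmod_ge_0 (y - c).
  have [->|Ht0] : t = 0 \/ 0 < t by lra.
    lra.
  have : t * Cmod (y - c) < t * r by apply: Rmult_lt_compat_l.
  have : (1 - t) * Cmod (x - c) <= (1 - t) * r by apply: Rmult_le_compat_l; lra.
  lra.
Qed.

Lemma MVI_ball (f f' : C -> C) (c x y : C) (r M : R) :
  Cmod (x - c) < r -> Cmod (y - c) < r ->
  (forall z, Cmod (z - c) < r -> CD f z (f' z) /\ Cmod (f' z) <= M) ->
  Cmod (f y - f x) <= M * Cmod (y - x).
Proof. by move=> Hx Hy H; apply: MVI => t Ht; apply: H; apply: ball_segment. Qed.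

(** * Smooth functions and series *)

Lemma CD_of_small_o (f : C -> C) (z l : C) :
  (forall eps, 0 < eps -> exists d, 0 < d /\ forall w, Cmod (w - z) < d ->
     Cmod (f w - f z - l * (w - z)) <= eps * Cmod (w - z)) ->
  CD f z l.
Proof.
  move=> H.
  pose q w := match Req_EM_T (Cmod (w - z)) 0 with
    left _ => l | right _ => ((f w - f z) / (w - z))%C end.
  have qz : q z = l.
    by rewrite /q; case: (Req_EM_T _ _) => // E; rewrite Cmod_self_minus in E.
  exists q, 1; split; first lra.
  split; [|split=> // w _].
  - move=> eps He; have [d [Hd Hw]] := H (eps / 2) ltac:(lra).
    exists d; split=> // w Hwd; rewrite qz /q.
    case: (Req_EM_T _ _) => [E|E]; first by rewrite Cmod_self_minus.
    have Hm : 0 < Cmod (w - z) by have := Cmod_ge_0 (w - z); lra.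
    have Hwz := Cmod_pos_neq0 _ Hm.
    replace ((f w - f z) / (w - z) - l)%C with ((f w - f z - l * (w - z)) / (w - z))%C
      by (field; auto).
    rewrite Cmod_div //; apply: (Rle_lt_trans _ (eps / 2)); last lra.
    apply: (Rmult_le_reg_r (Cmod (w - z))) => //.
    rewrite /Rdiv Rmult_assoc Rinv_l; last lra.
    rewrite Rmult_1_r; exact: Hw.
  - rewrite /q; case: (Req_EM_T _ _) => [E|E].
      have := Cmod_eq_0 _ E => E'.
      have -> : w = z by rewrite -(Cplus_0_r z) -E'; ring.
      ring.
    field => E'; apply: E; rewrite E'; exact: Cmod_0.
Qed.

(** The entry point for derivatives that no calculus rule provides: the exponential, sums of series
    and the canonical product at 0 all come with a quadratic remainder. *)
Lemma CD_of_quadratic (f : C -> C) (z l : C) (K d : R) : 0 < d ->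
  (forall w, Cmod (w - z) < d ->
     Cmod (f w - f z - l * (w - z)) <= K * Cmod (w - z) ^ 2) ->
  CD f z l.
Proof.
  move=> Hd H; apply: CD_of_small_o => eps He.
  have HK : 0 < Rabs K + 1 by have := Rabs_pos K; lra.
  exists (Rmin d (eps / (Rabs K + 1))); split.
    by apply: Rmin_pos => //; apply: Rdiv_lt_0_compat.
  move=> w Hw; apply: Rle_trans (H w _) _; first by apply: lt_Rmin_l Hw.
  have Hw2 := lt_Rmin_r _ _ _ Hw.
  have Hm := Cmod_ge_0 (w - z).
  have : Cmod (w - z) * (Rabs K + 1) <= eps.
    apply: (Rmult_le_reg_r (/ (Rabs K + 1))); first exact: Rinv_0_lt_compat.
    rewrite Rmult_assoc Rinv_r; lra.
  have := Rle_abs K; have := Rabs_pos K; move: (Rabs K) => k *.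
  have : K * Cmod (w - z) <= eps by nra.
  nra.
Qed.

(** The order is counted explicitly because [Z_k] takes [k] derivatives of zeta. Closure under the
    algebraic operations and composition then replaces Cauchy's formula, and [C_derive] supplies a
    canonical function for the recursion. *)
Fixpoint Cn (c : C) (r : R) (n : nat) (f : C -> C) : Prop :=
  match n with
  | O => True
  | S m => (forall z, Cmod (z - c) < r -> CD f z (C_derive f z)) /\
           Cn c r m (C_derive f)
  end.

Lemma ball_open (c z : C) (r : R) : Cmod (z - c) < r ->
  exists d, 0 < d /\ forall w, Cmod (w - z) < d -> Cmod (w - c) < r.
Proof.
  move=> Hz; exists (r - Cmod (z - c)); split; first lra.
  move=> w Hw; replace (w - c)%C with ((w - z) + (z - c))%C by ring.
  apply: Rle_lt_trans (Cmod_triangle _ _) _; lra.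
Qed.

Lemma CD_ext_ball (c z l : C) (r : R) (f g : C -> C) :
  (forall w, Cmod (w - c) < r -> f w = g w) -> Cmod (z - c) < r ->
  CD f z l -> CD g z l.
Proof.
  move=> H Hz; have [d [Hd Hw]] := ball_open c z r Hz.
  by apply: (CD_ext_loc _ _ _ _ d Hd) => w /Hw; apply: H.
Qed.

Lemma Cn_ext (c : C) (r : R) (n : nat) : forall f g : C -> C,
  (forall w, Cmod (w - c) < r -> f w = g w) -> Cn c r n f -> Cn c r n g.
Proof.
  elim: n => [|n IH] // f g H [H1 H2].
  have E : forall z, Cmod (z - c) < r -> C_derive f z = C_derive g z.
    move=> z Hz; symmetry; apply: CD_derive.
    by apply: (CD_ext_ball c _ _ r f) => //; apply: H1.
  split; last exact: IH H2.
  by move=> z Hz; rewrite -E //; apply: (CD_ext_ball c _ _ r f) => //; apply: H1.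
Qed.

Lemma Cn_intro (c : C) (r : R) (n : nat) (f f' : C -> C) :
  (forall z, Cmod (z - c) < r -> CD f z (f' z)) -> Cn c r n f' -> Cn c r (S n) f.
Proof.
  move=> H Hn; have E : forall z, Cmod (z - c) < r -> f' z = C_derive f z.
    by move=> z Hz; rewrite (CD_derive _ _ _ (H z Hz)).
  split; last by apply: Cn_ext Hn.
  by move=> z Hz; rewrite -E //; apply: H.
Qed.

Lemma Cn_pred (c : C) (r : R) (n : nat) : forall f : C -> C, Cn c r (S n) f -> Cn c r n f.
Proof.
  elim: n => [|n IH] // f [H1 H2]; split=> //; exact: IH.
Qed.

Lemma Cn_subball (c c' : C) (r r' : R) (n : nat) : forall f : C -> C,
  (forall z, Cmod (z - c') < r' -> Cmod (z - c) < r) ->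
  Cn c r n f -> Cn c' r' n f.
Proof.
  by elim: n => [|n IH] // f H [H1 H2]; split; [move=> z /H; apply: H1|apply: IH].
Qed.

Lemma Cn_const (c : C) (r : R) (n : nat) : forall a : C, Cn c r n (fun _ => a).
Proof.
  elim: n => [|n IH] a //; apply: (Cn_intro _ _ _ _ (fun _ => 0%C)); last exact: IH.
  by move=> z _; apply: CD_const.
Qed.

Lemma Cn_id (c : C) (r : R) (n : nat) : Cn c r n (fun z => z).
Proof.
  case: n => [|n] //; apply: (Cn_intro _ _ _ _ (fun _ => 1%C)); last exact: Cn_const.
  by move=> z _; apply: CD_id.
Qed.

Lemma Cn_plus (c : C) (r : R) (n : nat) : forall f g : C -> C,
  Cn c r n f -> Cn c r n g -> Cn c r n (fun z => f z + g z)%C.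
Proof.
  elim: n => [|n IH] // f g [H1 H2] [H3 H4].
  apply: (Cn_intro _ _ _ _ (fun z => C_derive f z + C_derive g z)%C); last exact: IH.
  by move=> z Hz; apply: CD_plus; auto.
Qed.

Lemma Cn_mult (c : C) (r : R) (n : nat) : forall f g : C -> C,
  Cn c r n f -> Cn c r n g -> Cn c r n (fun z => f z * g z)%C.
Proof.
  elim: n => [|n IH] // f g Hf Hg.
  have Hf' := Cn_pred _ _ _ _ Hf; have Hg' := Cn_pred _ _ _ _ Hg.
  move: Hf Hg => [H1 H2] [H3 H4].
  apply: (Cn_intro _ _ _ _ (fun z => C_derive f z * g z + f z * C_derive g z)%C).
    by move=> z Hz; apply: CD_mult; auto.
  by apply: Cn_plus; apply: IH.
Qed.

(** The derivative of [/ f] is written with [/ f] itself, so the induction on the order closes. *)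
Lemma Cn_inv (c : C) (r : R) (n : nat) : forall f : C -> C,
  (forall z, Cmod (z - c) < r -> f z <> 0%C) ->
  Cn c r n f -> Cn c r n (fun z => / f z)%C.
Proof.
  elim: n => [|n IH] // f H0 Hf.
  have Hf' := Cn_pred _ _ _ _ Hf; move: Hf => [H1 H2].
  apply: (Cn_intro _ _ _ _ (fun z => ((- (1)) * C_derive f z) * / f z * / f z)%C).
    move=> z Hz; apply: CD_eq (CD_inv _ _ _ (H1 z Hz) (H0 z Hz)); ring.
  apply: Cn_mult; last exact: IH.
  apply: Cn_mult; last exact: IH.
  by apply: Cn_mult => //; apply: Cn_const.
Qed.

Lemma Cn_comp (c c' : C) (r r' : R) (n : nat) : forall f g : C -> C,
  (forall z, Cmod (z - c) < r -> Cmod (f z - c') < r') ->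
  Cn c r n f -> Cn c' r' n g -> Cn c r n (fun z => g (f z)).
Proof.
  elim: n => [|n IH] // f g H Hf Hg.
  have Hf' := Cn_pred _ _ _ _ Hf; move: Hf Hg => [H1 H2] [H3 H4].
  apply: (Cn_intro _ _ _ _ (fun z => C_derive g (f z) * C_derive f z)%C).
    by move=> z Hz; apply: CD_comp; [apply: H1|apply: H3; apply: H].
  by apply: Cn_mult => //; apply: IH.
Qed.

Definition smooth (c : C) (r : R) (f : C -> C) : Prop := forall n, Cn c r n f.

Lemma smooth_CD (c z : C) (r : R) (f : C -> C) : smooth c r f ->
  Cmod (z - c) < r -> CD f z (C_derive f z).
Proof. by move=> H Hz; case: (H 1%nat) => H1 _; apply: H1. Qed.

Lemma smooth_derive (c : C) (r : R) (f : C -> C) :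
  smooth c r f -> smooth c r (C_derive f).
Proof. by move=> H n; case: (H (S n)). Qed.

Lemma smooth_ext (c : C) (r : R) (f g : C -> C) :
  (forall w, Cmod (w - c) < r -> f w = g w) -> smooth c r f -> smooth c r g.
Proof. by move=> E H n; apply: Cn_ext (H n). Qed.

Lemma smooth_const (c a : C) (r : R) : smooth c r (fun _ => a).
Proof. by move=> n; apply: Cn_const. Qed.

Lemma smooth_id (c : C) (r : R) : smooth c r (fun z => z).
Proof. by move=> n; apply: Cn_id. Qed.

Lemma smooth_plus (c : C) (r : R) (f g : C -> C) :
  smooth c r f -> smooth c r g -> smooth c r (fun z => f z + g z)%C.
Proof. by move=> Hf Hg n; apply: Cn_plus. Qed.

Lemma smooth_mult (c : C) (r : R) (f g : C -> C) :
  smooth c r f -> smooth c r g -> smooth c r (fun z => f z * g z)%C.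
Proof. by move=> Hf Hg n; apply: Cn_mult. Qed.

Lemma smooth_scal (c a : C) (r : R) (f : C -> C) :
  smooth c r f -> smooth c r (fun z => a * f z)%C.
Proof. by move=> H; apply: smooth_mult => //; apply: smooth_const. Qed.

Lemma smooth_minus (c : C) (r : R) (f g : C -> C) :
  smooth c r f -> smooth c r g -> smooth c r (fun z => f z - g z)%C.
Proof.
  move=> Hf Hg; apply: smooth_plus => //.
  apply: (smooth_ext _ _ (fun z => (- (1)) * g z)%C) => [w _|]; first ring.
  exact: smooth_scal.
Qed.

Lemma smooth_inv (c : C) (r : R) (f : C -> C) :
  (forall z, Cmod (z - c) < r -> f z <> 0%C) ->
  smooth c r f -> smooth c r (fun z => / f z)%C.
Proof. by move=> H0 Hf n; apply: Cn_inv. Qed.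

Lemma smooth_comp (c c' : C) (r r' : R) (f g : C -> C) :
  (forall z, Cmod (z - c) < r -> Cmod (f z - c') < r') ->
  smooth c r f -> smooth c' r' g -> smooth c r (fun z => g (f z)).
Proof. by move=> H Hf Hg n; apply: (Cn_comp c c' r r'). Qed.

Lemma smooth_subball (c c' : C) (r r' : R) (f : C -> C) :
  (forall z, Cmod (z - c') < r' -> Cmod (z - c) < r) ->
  smooth c r f -> smooth c' r' f.
Proof. by move=> H Hf n; apply: (Cn_subball c c' r r'). Qed.

(** Induction on the order, for all [j] at once: the derivative of a member of the chain is the next
    member. *)
Lemma smooth_dseq (c : C) (r : R) (F : nat -> C -> C) :
  (forall j z, Cmod (z - c) < r -> CD (F j) z (F (S j) z)) ->
  forall j, smooth c r (F j).
Proof.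
  move=> H j n; elim: n j => [|n IH] j //.
  by apply: (Cn_intro _ _ _ _ (F (S j))) => // z; apply: H.
Qed.

(** * Absolutely convergent complex series *)

Definition cseries (a : nat -> C) : C :=
  (Series (fun n => Re (a n)), Series (fun n => Im (a n))).

Definition cabs (a : nat -> C) : Prop := ex_series (fun n => Cmod (a n)).

Lemma im_le_Cmod (c : C) : Rabs (Im c) <= Cmod c.
Proof. exact: Rle_trans (Rmax_r _ _) (Rmax_Cmod c). Qed.

Lemma ex_series_le_R (a b : nat -> R) :
  (forall n, Rabs (a n) <= b n) -> ex_series b -> ex_series a.
Proof. by move=> H; apply: (@ex_series_le R_AbsRing R_CompleteNormedModule). Qed.

Lemma ex_series_scal_R (c : R) (a : nat -> R) :
  ex_series a -> ex_series (fun n => c * a n).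
Proof. exact: (ex_series_scal (V := R_NormedModule)). Qed.

Lemma cabs_le (a : nat -> C) (M : nat -> R) :
  (forall n, Cmod (a n) <= M n) -> ex_series M -> cabs a.
Proof.
  move=> H; apply: ex_series_le_R => n; rewrite Rabs_pos_eq //; exact: Cmod_ge_0.
Qed.

Lemma cabs_Re (a : nat -> C) : cabs a -> ex_series (fun n => Re (a n)).
Proof. by apply: ex_series_le_R => n; apply: re_le_Cmod. Qed.

Lemma cabs_Im (a : nat -> C) : cabs a -> ex_series (fun n => Im (a n)).
Proof. by apply: ex_series_le_R => n; apply: im_le_Cmod. Qed.

Lemma cseries_plus (a b : nat -> C) : cabs a -> cabs b ->
  cseries (fun n => a n + b n)%C = (cseries a + cseries b)%C.
Proof.
  move=> Ha Hb; rewrite /cseries /Cplus /=; f_equal.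
  - by rewrite -Series_plus //; apply: cabs_Re.
  - by rewrite -Series_plus //; apply: cabs_Im.
Qed.

Lemma cabs_scal (k : C) (a : nat -> C) : cabs a -> cabs (fun n => k * a n)%C.
Proof.
  move=> Ha; apply: (cabs_le _ (fun n => Cmod k * Cmod (a n))).
    by move=> n; rewrite Cmod_mult; lra.
  exact: ex_series_scal_R.
Qed.

Lemma cseries_scal (k : C) (a : nat -> C) : cabs a ->
  cseries (fun n => k * a n)%C = (k * cseries a)%C.
Proof.
  move=> Ha; have HR := cabs_Re _ Ha; have HI := cabs_Im _ Ha.
  rewrite /cseries /Cmult /=; f_equal.
  - rewrite -!Series_scal_l -Series_minus //.
    + exact: ex_series_scal_R.
    + exact: ex_series_scal_R.
  - rewrite -!Series_scal_l -Series_plus //.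
    + exact: ex_series_scal_R.
    + exact: ex_series_scal_R.
Qed.

Lemma cabs_plus (a b : nat -> C) : cabs a -> cabs b -> cabs (fun n => a n + b n)%C.
Proof.
  move=> Ha Hb; apply: (cabs_le _ (fun n => Cmod (a n) + Cmod (b n))).
    by move=> n; apply: Cmod_triangle.
  exact: (ex_series_plus (V := R_NormedModule)).
Qed.

Lemma cseries_ext (a b : nat -> C) : (forall n, a n = b n) -> cseries a = cseries b.
Proof. by move=> H; rewrite /cseries; f_equal; apply: Series_ext => n; rewrite H. Qed.

Lemma cseries_0 (a : nat -> C) : (forall n, a n = 0%C) -> cseries a = 0%C.
Proof.
  move=> H; have S0 : Series (fun _ => 0) = 0.
    transitivity (Series (fun _ => 0 * 0)); first by apply: Series_ext => n; ring.
    by rewrite (Series_scal_l 0 (fun _ => 0)); ring.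
  by rewrite (cseries_ext _ (fun _ => 0%C)) // /cseries S0.
Qed.

(** With [S] the sum, [|S|^2] is the real part of the series of [conj S * a n]; this reduces the
    triangle inequality to real series. The case [S = 0] is separate because [|S|] is divided
    out. *)
Lemma Cmod_cseries_le (a : nat -> C) (M : nat -> R) :
  (forall n, Cmod (a n) <= M n) -> ex_series M -> Cmod (cseries a) <= Series M.
Proof.
  move=> H HM; have Ha := cabs_le _ _ H HM.
  set S := cseries a.
  have E : Cmod S ^ 2 = Re (cseries (fun n => Cconj S * a n)%C).
    by rewrite cseries_scal // Cmod2_alt -/S /=; ring.
  have Hk := cabs_scal (Cconj S) _ Ha.
  have HM' : ex_series (fun n => Cmod S * M n).
    exact: ex_series_scal_R.
  have B : Re (cseries (fun n => Cconj S * a n)%C) <= Cmod S * Series M.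
    rewrite -Series_scal_l /cseries [Re _]/=.
    apply: Rle_trans (Rle_abs _) _.
    apply: Rle_trans (Series_Rabs _ _) _.
      by apply: ex_series_le_R Hk => n; rewrite Rabs_Rabsolu; exact: (re_le_Cmod (Cconj S * a n)).
    apply: Series_le => // n; split; first exact: Rabs_pos.
    apply: Rle_trans (re_le_Cmod (Cconj S * a n)) _; rewrite Cmod_mult Cmod_conj.
    by apply: Rmult_le_compat_l; [exact: Cmod_ge_0|].
  have [E0|Hpos] : Cmod S = 0 \/ 0 < Cmod S by have := Cmod_ge_0 S; lra.
    rewrite E0 -(Rmult_0_l (Series M)) -Series_scal_l; apply: Series_le => // n.
    have := Rle_trans _ _ _ (Cmod_ge_0 _) (H n); lra.
  apply: (Rmult_le_reg_l (Cmod S)) => //; lra.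
Qed.

(** The mean value inequality twice: for [f1] it bounds [f1 w - f1 x], which is the derivative of
    [f] minus its tangent at [x]. Losing the factor 1/2 is harmless. *)
Lemma taylor2 (f f1 f2 : C -> C) (c x y : C) (r M : R) :
  Cmod (x - c) < r -> Cmod (y - c) < r ->
  (forall z, Cmod (z - c) < r ->
     CD f z (f1 z) /\ CD f1 z (f2 z) /\ Cmod (f2 z) <= M) ->
  Cmod (f y - f x - f1 x * (y - x)) <= M * Cmod (y - x) ^ 2.
Proof.
  move=> Hx Hy H.
  have Hb := ball_segment c x y r Hx Hy.
  have := MVI (fun w => f w - f1 x * (w - x))%C (fun w => f1 w - f1 x)%C x y
    (M * Cmod (y - x)).
  replace (f y - f1 x * (y - x) - (f x - f1 x * (x - x)))%C with
    (f y - f x - f1 x * (y - x))%C by ring.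
  move=> HH; apply: Rle_trans (HH _) _; last by rewrite /=; lra.
  move=> t Ht; have Hz := Hb t Ht; have [D1 [D2 B2]] := H _ Hz; split.
    apply: CD_minus => //.
    apply: CD_eq (CD_scal _ _ _ _ (CD_minus _ _ _ _ _ (CD_id _) (CD_const x _))); ring.
  have := MVI_ball f1 f2 c x _ r M Hx Hz (fun z Hz => conj (proj1 (proj2 (H z Hz)))
    (proj2 (proj2 (H z Hz)))).
  move=> B; apply: Rle_trans B _.
  have HM : 0 <= M := Rle_trans _ _ _ (Cmod_ge_0 _) B2.
  apply: Rmult_le_compat_l => //.
  replace (x + t * (y - x) - x)%C with (t * (y - x))%C by ring.
  rewrite Cmod_mult Cmod_R Rabs_pos_eq; last lra.
  have := Cmod_ge_0 (y - x); nra.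
Qed.

(** Termwise differentiation without uniform limits: the majorant of the second derivatives bounds
    the summed Taylor remainders by [Series M * |w - z|^2]. *)
Lemma CD_cseries (F0 F1 F2 : nat -> C -> C) (M : nat -> R) (c : C) (r : R) :
  (forall n z, Cmod (z - c) < r ->
     CD (F0 n) z (F1 n z) /\ CD (F1 n) z (F2 n z) /\ Cmod (F2 n z) <= M n) ->
  ex_series M ->
  (forall z, Cmod (z - c) < r -> cabs (fun n => F0 n z)) ->
  (forall z, Cmod (z - c) < r -> cabs (fun n => F1 n z)) ->
  forall z, Cmod (z - c) < r ->
    CD (fun z => cseries (fun n => F0 n z)) z (cseries (fun n => F1 n z)).
Proof.
  move=> H HM H0 H1 z Hz.
  have [d [Hd Hw]] := ball_open c z r Hz.
  apply: (CD_of_quadratic _ _ _ (Series M) d Hd) => w /Hw Hwc.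
  have E : (cseries (fun n => F0 n w) - cseries (fun n => F0 n z) -
     cseries (fun n => F1 n z) * (w - z))%C =
     cseries (fun n => F0 n w + ((- (1)) * F0 n z + (- (w - z)) * F1 n z))%C.
    have A1 := cabs_scal (- (1))%C _ (H0 z Hz).
    have A2 := cabs_scal (- (w - z))%C _ (H1 z Hz).
    rewrite cseries_plus; [|exact: H0|exact: cabs_plus].
    rewrite cseries_plus // !cseries_scal; auto; ring.
  rewrite E Rmult_comm -Series_scal_l; apply: Cmod_cseries_le.
    move=> n; rewrite Rmult_comm.
    have := taylor2 (F0 n) (F1 n) (F2 n) c z w r (M n) Hz Hwc (H n).
    move=> B; apply: Rle_trans B; apply: Req_le; f_equal; ring.
  exact: ex_series_scal_R.
Qed.

Lemma cseries_dseq (F : nat -> nat -> C -> C) (M : nat -> nat -> R) (c : C) (r : R) :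
  (forall j n z, Cmod (z - c) < r -> CD (F j n) z (F (S j) n z)) ->
  (forall j n z, Cmod (z - c) < r -> Cmod (F j n z) <= M j n) ->
  (forall j, ex_series (M j)) ->
  forall j z, Cmod (z - c) < r ->
    CD (fun z => cseries (fun n => F j n z)) z (cseries (fun n => F (S j) n z)).
Proof.
  move=> HD HB HM j.
  apply: (CD_cseries _ _ (F (S (S j))) (M (S (S j))) c r).
  - by move=> n z Hz; split; [apply: HD|split; [apply: HD|apply: HB]].
  - exact: HM.
  - by move=> z Hz; apply: (cabs_le _ (M j)) => // n; apply: HB.
  - by move=> z Hz; apply: (cabs_le _ (M (S j))) => // n; apply: HB.
Qed.

(** * The complex exponential and power series *)

Lemma Cexp_0 : Cexp 0%C = 1%C.
Proof. by rewrite /Cexp /= exp_0 cos_0 sin_0; apply: injective_projections => /=; ring. Qed.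

Lemma Cexp_plus (a b : C) : Cexp (a + b)%C = (Cexp a * Cexp b)%C.
Proof.
  rewrite /Cexp /Re /Im /= exp_plus cos_plus sin_plus.
  apply: injective_projections => /=; ring.
Qed.

Lemma Cmod_Cexp (z : C) : Cmod (Cexp z) = exp (Re z).
Proof.
  rewrite /Cmod /Cexp /=.
  rewrite -[RHS](sqrt_Rsqr (exp (Re z))); last by apply: Rlt_le; apply: exp_pos.
  f_equal; rewrite /Rsqr; have := sin2_cos2 (Im z); rewrite /Rsqr; nra.
Qed.

Lemma Cexp_neq0 (z : C) : Cexp z <> 0%C.
Proof. by apply: Cmod_pos_neq0; rewrite Cmod_Cexp; apply: exp_pos. Qed.

Lemma Cexp_opp (z : C) : Cexp (- z)%C = (/ Cexp z)%C.
Proof.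
  have H := Cexp_plus (- z) z; have E : (- z + z = 0)%C by ring.
  rewrite E Cexp_0 in H.
  have Hz := Cexp_neq0 z; rewrite -(Cmult_1_l (/ Cexp z)) H; field; auto.
Qed.

Lemma Cexp_R (x : R) : Cexp x = exp x.
Proof. rewrite /Cexp /= cos_0 sin_0; apply: injective_projections => /=; ring. Qed.

Lemma RD_Cexp (h : C) (t : R) : RD (fun t : R => Cexp (t * h)%C) t (h * Cexp (t * h))%C.
Proof.
  rewrite /RD /Cexp /Re /Im /=; split; auto_derive => //; rewrite /Rminus; ring.
Qed.

Lemma Cexp_le (z : C) : Cmod z <= 1 -> Cmod (Cexp z) <= 3.
Proof.
  move=> H; rewrite Cmod_Cexp; apply: Rle_trans exp_le_3.
  have : Re z <= 1 by apply: Rle_trans (Rle_abs _) (Rle_trans _ _ _ (re_le_Cmod z) H).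
  case/Rle_lt_or_eq => [H1| ->]; [apply: Rlt_le; exact: exp_increasing|lra].
Qed.

Lemma Cmod_scal_R (t : R) (h : C) : 0 <= t -> Cmod (t * h) = t * Cmod h.
Proof. by move=> Ht; rewrite Cmod_mult Cmod_R Rabs_pos_eq. Qed.

(** Mean value inequality along the ray [t * h], where 3 bounds [e], the maximum of the exponential
    on the unit disc. *)
Lemma Cexp_bound1 (h : C) : Cmod h <= 1 -> Cmod (Cexp h - 1) <= 3 * Cmod h.
Proof.
  move=> H; have H0 := Cmod_ge_0 h.
  have := MVI_R (fun t : R => Cexp (t * h)%C) (fun t : R => h * Cexp (t * h))%C 0 1
    (3 * Cmod h) Rle_0_1.
  rewrite Rminus_0_r Rmult_1_r Cmult_1_l Cmult_0_l Cexp_0; apply=> t Ht.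
  split; first exact: RD_Cexp.
  rewrite Cmod_mult; have : Cmod (Cexp (t * h)) <= 3.
    by apply: Cexp_le; rewrite Cmod_scal_R; nra.
  nra.
Qed.

Lemma Cexp_bound2 (h : C) : Cmod h <= 1 -> Cmod (Cexp h - 1 - h) <= 3 * Cmod h ^ 2.
Proof.
  move=> H; have H0 := Cmod_ge_0 h.
  have := MVI_R (fun t : R => Cexp (t * h) - t * h)%C (fun t : R => h * (Cexp (t * h) - 1))%C 0 1
    (3 * Cmod h ^ 2) Rle_0_1.
  rewrite Rminus_0_r Rmult_1_r !Cmult_1_l !Cmult_0_l Cexp_0.
  replace (Cexp h - h - (1 - 0))%C with (Cexp h - 1 - h)%C by ring.
  apply=> t Ht; split.
    have [H1 H2] := RD_Cexp h t; move: H1 H2; rewrite /RD /Cexp /Re /Im /= => H1 H2.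
    split; auto_derive => //; rewrite /Rminus; ring.
  rewrite Cmod_mult; have : Cmod (Cexp (t * h) - 1) <= 3 * (t * Cmod h).
    rewrite -Cmod_scal_R; last lra.
    by apply: Cexp_bound1; rewrite Cmod_scal_R; nra.
  nra.
Qed.

Lemma CD_Cexp (z : C) : CD Cexp z (Cexp z).
Proof.
  apply: (CD_of_quadratic _ _ _ (3 * Cmod (Cexp z)) 1 Rlt_0_1) => w Hw.
  replace (Cexp w) with (Cexp z * Cexp (w - z))%C by (rewrite -Cexp_plus; f_equal; ring).
  replace (Cexp z * Cexp (w - z) - Cexp z - Cexp z * (w - z))%C with
    (Cexp z * (Cexp (w - z) - 1 - (w - z)))%C by ring.
  rewrite Cmod_mult; have := Cexp_bound2 (w - z) (Rlt_le _ _ Hw).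
  have := Cmod_ge_0 (Cexp z); nra.
Qed.

Lemma CD_Cexp_comp (f : C -> C) (z a : C) : CD f z a ->
  CD (fun w => Cexp (f w)) z (Cexp (f z) * a)%C.
Proof. by move=> H; apply: CD_comp => //; apply: CD_Cexp. Qed.

Lemma ccont_smooth (c z : C) (r : R) (f : C -> C) : smooth c r f ->
  Cmod (z - c) < r -> ccont f z.
Proof. by move=> H Hz; apply: CD_ccont (smooth_CD c z r f H Hz). Qed.

(** * Partial sums and limits of complex sequences *)

Definition csum (a : nat -> C) (n : nat) : C := @sum_n C_AbelianMonoid a n.

Lemma csum_0 (a : nat -> C) : csum a 0 = a 0%nat.
Proof. exact: (@sum_O C_AbelianMonoid). Qed.

Lemma csum_S (a : nat -> C) (n : nat) : csum a (S n) = (csum a n + a (S n))%C.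
Proof. exact: (@sum_Sn C_AbelianMonoid). Qed.

Lemma csum_ext (a b : nat -> C) (n : nat) : (forall k, (k <= n)%nat -> a k = b k) ->
  csum a n = csum b n.
Proof.
  elim: n => [|n IH] H; first by rewrite !csum_0 H.
  by rewrite !csum_S IH ?H //; move=> k Hk; apply: H; lia.
Qed.

Lemma csum_scal (x : C) (a : nat -> C) (n : nat) :
  csum (fun k => x * a k)%C n = (x * csum a n)%C.
Proof. by elim: n => [|n IH]; rewrite ?csum_0 // !csum_S IH; ring. Qed.

Lemma Re_csum (a : nat -> C) (n : nat) : Re (csum a n) = sum_n (fun k => Re (a k)) n.
Proof. by elim: n => [|n IH]; rewrite ?csum_0 ?sum_O // csum_S sum_Sn -IH. Qed.

Lemma Im_csum (a : nat -> C) (n : nat) : Im (csum a n) = sum_n (fun k => Im (a k)) n.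
Proof. by elim: n => [|n IH]; rewrite ?csum_0 ?sum_O // csum_S sum_Sn -IH. Qed.

Definition Cis_series (a : nat -> C) (l : C) : Prop :=
  is_series (fun n => Re (a n)) (Re l) /\ is_series (fun n => Im (a n)) (Im l).

Lemma is_series_C (a : nat -> C) (l : C) :
  @is_series C_AbsRing C_NormedModule a l <-> Cis_series a l.
Proof.
  have E1 : forall n, Re (@sum_n (NormedModule.AbelianMonoid C_AbsRing C_NormedModule) a n) =
    sum_n (fun k => Re (a k)) n by exact: Re_csum.
  have E2 : forall n, Im (@sum_n (NormedModule.AbelianMonoid C_AbsRing C_NormedModule) a n) =
    sum_n (fun k => Im (a k)) n by exact: Im_csum.
  split.
  - move=> H; split=> P [eps HP].
    + have [N HN] := H (fun z => P (Re z)) ltac:(by exists eps => z [Hz _]; apply: HP).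
      by exists N => n Hn; rewrite -E1; apply: HN.
    + have [N HN] := H (fun z => P (Im z)) ltac:(by exists eps => z [_ Hz]; apply: HP).
      by exists N => n Hn; rewrite -E2; apply: HN.
  - move=> [H1 H2] P [eps HP].
    have [N1 HN1] := H1 (fun x => ball (Re l) eps x) ltac:(by exists eps).
    have [N2 HN2] := H2 (fun x => ball (Im l) eps x) ltac:(by exists eps).
    exists (max N1 N2) => n Hn; apply: HP; split.
    + by have := HN1 n ltac:(lia); rewrite -E1.
    + by have := HN2 n ltac:(lia); rewrite -E2.
Qed.

Lemma Cis_series_unique (a : nat -> C) (l : C) : Cis_series a l -> cseries a = l.
Proof.
  by move=> [H1 H2]; apply: injective_projections; apply: is_series_unique.
Qed.

Lemma Cis_series_cabs (a : nat -> C) : cabs a -> Cis_series a (cseries a).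
Proof.
  by move=> H; split; apply: Series_correct; [apply: cabs_Re|apply: cabs_Im].
Qed.

Lemma Cis_series_ext (a b : nat -> C) (l : C) : (forall n, a n = b n) ->
  Cis_series a l -> Cis_series b l.
Proof.
  move=> H [H1 H2]; split.
  - by apply: is_series_ext H1 => n; rewrite H.
  - by apply: is_series_ext H2 => n; rewrite H.
Qed.

Definition Clim (u : nat -> C) (l : C) : Prop :=
  forall eps, 0 < eps -> exists N, forall n, (N <= n)%nat -> Cmod (u n - l) < eps.

Lemma Clim_components (u : nat -> C) (l : C) : Clim u l <->
  is_lim_seq (fun n => Re (u n)) (Re l) /\ is_lim_seq (fun n => Im (u n)) (Im l).
Proof.
  split.
  - move=> H; split; apply/is_lim_seq_spec => eps; have [N HN] := H eps (cond_pos eps);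
      exists N => n Hn; apply: Rle_lt_trans (HN n Hn).
    + apply: Rle_trans (re_le_Cmod _); apply: Req_le; f_equal.
    + apply: Rle_trans (im_le_Cmod _); apply: Req_le; f_equal.
  - move=> [/is_lim_seq_spec H1 /is_lim_seq_spec H2] eps He.
    have He2 : 0 < eps / 2 by lra.
    have [N1 HN1] := H1 (mkposreal _ He2); have [N2 HN2] := H2 (mkposreal _ He2).
    exists (max N1 N2) => n Hn.
    have h1 := HN1 n ltac:(lia); have h2 := HN2 n ltac:(lia).
    rewrite /= in h1 h2.
    have E : (u n - l)%C = (RtoC (Re (u n) - Re l) + RtoC (Im (u n) - Im l) * Ci)%C.
      by apply: injective_projections; rewrite /Re /Im /=; ring.
    rewrite E; apply: Rle_lt_trans (Cmod_triangle _ _) _.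
    rewrite Cmod_mult !Cmod_R Cmod_Ci; lra.
Qed.

Lemma Clim_unique (u : nat -> C) (l l' : C) : Clim u l -> Clim u l' -> l = l'.
Proof.
  move=> /Clim_components [H1 H2] /Clim_components [H3 H4].
  apply: injective_projections.
  - by have := is_lim_seq_unique _ _ H1; rewrite (is_lim_seq_unique _ _ H3) => [[]].
  - by have := is_lim_seq_unique _ _ H2; rewrite (is_lim_seq_unique _ _ H4) => [[]].
Qed.

Lemma CLim_seq_unique (u : nat -> C) (l : C) : Clim u l -> CLim_seq u = l.
Proof.
  move=> /Clim_components [H1 H2]; apply: injective_projections => /=.
  - by rewrite (is_lim_seq_unique _ _ H1).
  - by rewrite (is_lim_seq_unique _ _ H2).
Qed.

Lemma Clim_ext (u v : nat -> C) (l : C) : (forall n, u n = v n) -> Clim u l -> Clim v l.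
Proof. by move=> H Hu eps /Hu [N HN]; exists N => n /HN; rewrite H. Qed.

Lemma Clim_ext_loc (u v : nat -> C) (l : C) (N0 : nat) :
  (forall n, (N0 <= n)%nat -> u n = v n) -> Clim u l -> Clim v l.
Proof.
  move=> H Hu eps /Hu [N HN]; exists (max N N0) => n Hn.
  by rewrite -H; [apply: HN; lia|lia].
Qed.

Lemma Clim_const (c : C) : Clim (fun _ => c) c.
Proof. by move=> eps He; exists 0%nat => n _; rewrite Cmod_self_minus. Qed.

Lemma Clim_subseq (u : nat -> C) (l : C) (phi : nat -> nat) :
  (forall n, (n <= phi n)%nat) -> Clim u l -> Clim (fun n => u (phi n)) l.
Proof.
  move=> Hphi Hu eps /Hu [N HN]; exists N => n Hn; apply: HN; have := Hphi n; lia.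
Qed.

Lemma Clim_ccont (g : C -> C) (u : nat -> C) (l : C) : ccont g l -> Clim u l ->
  Clim (fun n => g (u n)) (g l).
Proof.
  move=> Hg Hu eps /Hg [d [Hd H]]; have [N HN] := Hu d Hd.
  by exists N => n /HN /H.
Qed.

Lemma Clim_plus (u v : nat -> C) (a b : C) : Clim u a -> Clim v b ->
  Clim (fun n => u n + v n)%C (a + b)%C.
Proof.
  move=> /Clim_components [H1 H2] /Clim_components [H3 H4].
  by apply/Clim_components; split; apply: is_lim_seq_plus'.
Qed.

Lemma Clim_mult (u v : nat -> C) (a b : C) : Clim u a -> Clim v b ->
  Clim (fun n => u n * v n)%C (a * b)%C.
Proof.
  move=> /Clim_components [H1 H2] /Clim_components [H3 H4].
  apply/Clim_components; split.
  - by apply: is_lim_seq_minus'; apply: is_lim_seq_mult'.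
  - by apply: is_lim_seq_plus'; apply: is_lim_seq_mult'.
Qed.

Lemma Clim_R (u : nat -> R) (l : R) : is_lim_seq u l -> Clim (fun n => RtoC (u n)) l.
Proof. by move=> H; apply/Clim_components; split=> //; apply: is_lim_seq_const. Qed.

Lemma Cis_series_Clim (a : nat -> C) (l : C) : Cis_series a l <-> Clim (csum a) l.
Proof.
  split.
  - move=> [H1 H2]; apply/Clim_components; split.
    + by apply: (is_lim_seq_ext (sum_n (fun k => Re (a k)))) => // n; rewrite Re_csum.
    + by apply: (is_lim_seq_ext (sum_n (fun k => Im (a k)))) => // n; rewrite Im_csum.
  - move=> /Clim_components [H1 H2]; split.
    + change (is_lim_seq (sum_n (fun k => Re (a k))) (Re l)).
      by apply: is_lim_seq_ext H1 => n; rewrite Re_csum.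
    + change (is_lim_seq (sum_n (fun k => Im (a k))) (Im l)).
      by apply: is_lim_seq_ext H2 => n; rewrite Im_csum.
Qed.

Lemma Clim_of_bound (u : nat -> C) (l : C) (e : nat -> R) :
  (forall n, Cmod (u n - l) <= e n) -> is_lim_seq e 0 -> Clim u l.
Proof.
  move=> H /is_lim_seq_spec He eps Heps; have [N HN] := He (mkposreal _ Heps).
  exists N => n Hn; apply: Rle_lt_trans (H n) _; have := HN n Hn; rewrite /= Rminus_0_r.
  by move=> HH; apply: Rle_lt_trans (Rle_abs _) HH.
Qed.

(** * Power series and analytic functions *)

Definition pser (a : nat -> C) (h : C) (n : nat) : C := (Cpow h n * a n)%C.

Lemma is_pseries_C (a : nat -> C) (h l : C) :
  @is_pseries C_AbsRing C_NormedModule a h l <-> Cis_series (pser a h) l.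
Proof.
  rewrite -is_series_C /is_pseries.
  have E : forall n, @scal C_AbsRing C_NormedModule (@pow_n C_AbsRing h n) (a n) = pser a h n.
    have Ep : forall n, @pow_n C_AbsRing h n = Cpow h n by elim=> [|n IH] //=; rewrite IH.
    by move=> n; rewrite Ep.
  by split=> H; apply: is_series_ext H => n; rewrite E.
Qed.

Lemma pser_bound (a : nat -> C) (h l : C) : Cis_series (pser a h) l ->
  exists K, forall n, Cmod (a n) * Cmod h ^ n <= K.
Proof.
  move=> [H1 H2].
  have B : forall u : nat -> R, ex_series u -> exists K, forall n, Rabs (u n) <= K.
    move=> u /ex_series_lim_0 Hu.
    have [K HK] := @filterlim_bounded R_AbsRing R_NormedModule u (ex_intro _ 0 Hu).
    by exists K.
  have [K1 HK1] := B _ (ex_intro _ _ H1).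
  have [K2 HK2] := B _ (ex_intro _ _ H2).
  exists (K1 + K2) => n.
  rewrite -Cmod_pow -Cmod_mult Cmult_comm -/(pser a h n).
  have : Cmod (pser a h n) <= Rabs (Re (pser a h n)) + Rabs (Im (pser a h n)).
    have E : pser a h n = (RtoC (Re (pser a h n)) + RtoC (Im (pser a h n)) * Ci)%C.
      by apply: injective_projections => /=; ring.
    rewrite {1}E; apply: Rle_trans (Cmod_triangle _ _) _.
    rewrite Cmod_mult !Cmod_R Cmod_Ci; lra.
  have := HK1 n; have := HK2 n; lra.
Qed.

Lemma pser_cabs (a : nat -> C) (h : C) (rho K : R) :
  (forall n, Cmod (a n) * rho ^ n <= K) -> Cmod h < rho -> cabs (pser a h).
Proof.
  move=> HK Hh; have H0 := Cmod_ge_0 h; have Hrho : 0 < rho by lra.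
  apply: (cabs_le _ (fun n => K * (Cmod h / rho) ^ n)).
    move=> n; rewrite /pser Cmod_mult Cmod_pow.
    have -> : (Cmod h / rho) ^ n = Cmod h ^ n * / rho ^ n.
      by rewrite /Rdiv Rpow_mult_distr pow_inv.
    have Hp : 0 < rho ^ n by apply: pow_lt.
    have Hq : 0 <= Cmod h ^ n by apply: pow_le.
    apply: (Rmult_le_reg_r (rho ^ n)) => //.
    have -> : K * (Cmod h ^ n * / rho ^ n) * rho ^ n = K * Cmod h ^ n by field; lra.
    have := HK n; have := Cmod_ge_0 (a n); nra.
  apply: ex_series_scal_R; apply: ex_series_geom.
  rewrite Rabs_pos_eq; last by apply: Rdiv_le_0_compat.
  apply: (Rmult_lt_reg_r rho) => //; rewrite /Rdiv Rmult_assoc Rinv_l; lra.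
Qed.

Lemma pser_disc_bound (a : nat -> C) (g : C -> C) (r rho : R) : 0 <= rho < r ->
  (forall h, Cmod h < r -> Cis_series (pser a h) (g h)) ->
  exists K, forall n, Cmod (a n) * rho ^ n <= K.
Proof.
  move=> Hrho H.
  have E : Cmod rho = rho by rewrite Cmod_R Rabs_pos_eq; lra.
  have := pser_bound a rho (g rho) (H (RtoC rho) ltac:(rewrite E; lra)).
  by rewrite E.
Qed.

Lemma pser_disc_cabs (a : nat -> C) (g : C -> C) (r : R) (h : C) :
  (forall h, Cmod h < r -> Cis_series (pser a h) (g h)) -> Cmod h < r ->
  cabs (pser a h).
Proof.
  move=> H Hh; have H0 := Cmod_ge_0 h.
  have [K HK] := pser_disc_bound a g r ((Cmod h + r) / 2) ltac:(lra) H.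
  by apply: (pser_cabs _ _ _ _ HK); lra.
Qed.

(** Real and imaginary parts are combinations of four real Cauchy products, each justified by
    absolute convergence. *)
Lemma Cauchy_product (u v : nat -> C) : cabs u -> cabs v ->
  Cis_series (fun n => csum (fun k => u k * v (n - k)%nat)%C n) (cseries u * cseries v)%C.
Proof.
  move=> Hu Hv.
  have AR : forall w, cabs w -> ex_series (fun n => Rabs (Re (w n))).
    by move=> w; apply: ex_series_le_R => n; rewrite Rabs_Rabsolu; apply: re_le_Cmod.
  have AI : forall w, cabs w -> ex_series (fun n => Rabs (Im (w n))).
    by move=> w; apply: ex_series_le_R => n; rewrite Rabs_Rabsolu; apply: im_le_Cmod.
  have SR : forall w, cabs w -> is_series (fun n => Re (w n)) (Re (cseries w)).
    by move=> w Hw; apply: Series_correct; apply: cabs_Re.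
  have SI : forall w, cabs w -> is_series (fun n => Im (w n)) (Im (cseries w)).
    by move=> w Hw; apply: Series_correct; apply: cabs_Im.
  have RR := is_series_mult _ _ _ _ (SR _ Hu) (SR _ Hv) (AR _ Hu) (AR _ Hv).
  have II := is_series_mult _ _ _ _ (SI _ Hu) (SI _ Hv) (AI _ Hu) (AI _ Hv).
  have RI := is_series_mult _ _ _ _ (SR _ Hu) (SI _ Hv) (AR _ Hu) (AI _ Hv).
  have IR := is_series_mult _ _ _ _ (SI _ Hu) (SR _ Hv) (AI _ Hu) (AR _ Hv).
  split.
  - apply: is_series_ext (is_series_minus _ _ _ _ RR II) => n.
    rewrite Re_csum sum_n_Reals /minus /plus /opp /= -[_ + - _]/(_ - _) -minus_sum.
    by apply: sum_eq => k _.
  - apply: is_series_ext (is_series_plus _ _ _ _ RI IR) => n.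
    rewrite Im_csum sum_n_Reals /plus /= -plus_sum.
    by apply: sum_eq => k _.
Qed.

Lemma analytic_at_C (f : C -> C) (z : C) : analytic_at f z <->
  exists (a : nat -> C) (r : R), 0 < r /\ forall h, Cmod h < r ->
    Cis_series (pser a h) (f (z + h)%C).
Proof.
  split=> [[a [r H]]|[a [r [Hr H]]]].
    by exists a, r; split; [exact: cond_pos|move=> h Hh; apply/is_pseries_C; apply: H].
  by exists a, (mkposreal r Hr) => h Hh; apply/is_pseries_C; apply: H.
Qed.

Lemma analytic_at_mult (f g : C -> C) (z : C) :
  analytic_at f z -> analytic_at g z -> analytic_at (fun w => f w * g w)%C z.
Proof.
  move=> /analytic_at_C [a [r [Hr H]]] /analytic_at_C [b [r' [Hr' H']]].
  apply/analytic_at_C.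
  exists (fun n => csum (fun k => a k * b (n - k)%nat)%C n), (Rmin r r').
  split; first exact: Rmin_pos.
  move=> h Hh.
  have h1 := lt_Rmin_l _ _ _ Hh.
  have h2 := lt_Rmin_r _ _ _ Hh.
  have A1 := pser_disc_cabs a _ r h H h1.
  have A2 := pser_disc_cabs b _ r' h H' h2.
  have P := Cauchy_product _ _ A1 A2.
  rewrite (Cis_series_unique _ _ (H h h1)) (Cis_series_unique _ _ (H' h h2)) in P.
  apply: Cis_series_ext P => n; rewrite {3}/pser -csum_scal; apply: csum_ext => k Hk.
  rewrite /pser; replace n with (k + (n - k))%nat at 3 by lia.
  rewrite Cpow_add_r; ring.
Qed.

Lemma analytic_at_minus (f g : C -> C) (z : C) :
  analytic_at f z -> analytic_at g z -> analytic_at (fun w => f w - g w)%C z.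
Proof.
  move=> /analytic_at_C [a [r [Hr H]]] /analytic_at_C [b [r' [Hr' H']]].
  apply/analytic_at_C.
  exists (fun n => a n - b n)%C, (Rmin r r').
  split; first exact: Rmin_pos.
  move=> h Hh.
  have [R1 I1] := H h (lt_Rmin_l _ _ _ Hh).
  have [R2 I2] := H' h (lt_Rmin_r _ _ _ Hh).
  split.
  - apply: is_series_ext (is_series_minus _ _ _ _ R1 R2) => n.
    rewrite /pser /minus /plus /opp /Re /Im /=; ring.
  - apply: is_series_ext (is_series_minus _ _ _ _ I1 I2) => n.
    rewrite /pser /minus /plus /opp /Re /Im /=; ring.
Qed.

Lemma is_lim_seq_arith_geom (x : R) : 0 <= x < 1 ->
  is_lim_seq (fun n => INR (S n) * x ^ S n) 0.
Proof.
  move=> Hx.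
  set q := sqrt x.
  have Hq0 : 0 <= q := sqrt_pos x.
  have Hqq : q * q = x by apply: sqrt_sqrt; lra.
  have Hq1 : q < 1 by nra.
  (* One factor [q ^ n] of [x ^ n = q ^ n * q ^ n] absorbs [n] by a Bernoulli-type inequality; the
     other one still tends to 0. *)
  have Bern : forall n, INR n * (1 - q) * q ^ n <= 1.
    move=> n; have Hp : 0 <= q ^ n by apply: pow_le.
    have : q ^ n * (1 + INR n * (1 - q)) <= 1.
      elim: n {Hp} => [|n IH]; first by rewrite /=; lra.
      rewrite S_INR; have Hp : 0 <= q ^ n by apply: pow_le.
      have Hn := pos_INR n.
      have -> : q ^ S n * (1 + (INR n + 1) * (1 - q)) =
        q * (q ^ n * (1 + INR n * (1 - q))) + q ^ n * (q * (1 - q)) by rewrite /=; ring.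
      have Hp1 : q ^ n <= 1 by rewrite -(pow1 n); apply: pow_incr; lra.
      have : q ^ n * (q * (1 - q)) <= 1 * (1 - q).
        have : q * (1 - q) <= 1 - q by nra.
        have : 0 <= q * (1 - q) by nra.
        nra.
      nra.
    lra.
  apply: (is_lim_seq_le_le (fun _ => 0) _ (fun n => / (1 - q) * q ^ S n)).
  - move=> n; split.
      by apply: Rmult_le_pos; [exact: pos_INR|apply: pow_le; lra].
    rewrite -Hqq Rpow_mult_distr -Rmult_assoc.
    apply: Rmult_le_compat_r; first by apply: pow_le.
    apply: (Rmult_le_reg_r (1 - q)); first lra.
    rewrite Rinv_l; last lra.
    have := Bern (S n); lra.
  - exact: is_lim_seq_const.
  - rewrite -(Rmult_0_r (/ (1 - q))).
    apply: (is_lim_seq_scal_l _ _ 0).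
    apply/(is_lim_seq_incr_1 (fun n => q ^ n)); apply: is_lim_seq_geom.
    by rewrite Rabs_pos_eq.
Qed.

Lemma Cpow_0_S (n : nat) (z : C) : Cpow (z - z) (S n) = 0%C.
Proof. by rewrite /=; ring. Qed.

Lemma INR_fact_neq0_C (n : nat) : RtoC (INR (fact n)) <> 0%C.
Proof. apply: RtoC_neq0; exact: INR_fact_neq_0. Qed.

(** When the Taylor polynomial is differentiated with respect to its centre, consecutive terms
    cancel and only the top one survives. *)
Lemma CD_taylor_poly (F : nat -> C -> C) (z z1 : C) :
  (forall j, CD (F j) z (F (S j) z)) -> forall N,
  CD (fun w => csum (fun j => F j w * Cpow (z1 - w) j / INR (fact j))%C N) z
     (F (S N) z * Cpow (z1 - z) N / INR (fact N))%C.
Proof.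
  move=> H; elim=> [|N IH].
    apply: (CD_ext (F 0%nat)) => [w|]; first by rewrite csum_0 /=; field; exact: RtoC_neq0.
    apply: CD_eq (H 0%nat); rewrite /=; field; exact: RtoC_neq0.
  apply: (CD_ext (fun w => csum (fun j => F j w * Cpow (z1 - w) j / INR (fact j))%C N +
     F (S N) w * Cpow (z1 - w) (S N) * / INR (fact (S N)))%C) => [w|].
    by rewrite csum_S.
  have D1 : CD (fun w => z1 - w)%C z (0 - 1)%C by apply: CD_minus; [exact: CD_const|exact: CD_id].
  apply: CD_eq (CD_plus _ _ _ _ _ IH (CD_mult _ _ _ _ _
    (CD_mult _ _ _ _ _ (H (S N)) (CD_pow _ _ _ (S N) D1)) (CD_const (/ INR (fact (S N)))%C z))).
  have E := INR_fact_S_C N.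
  have E1 := INR_fact_neq0_C N.
  have E2 : RtoC (INR (S N)) <> 0%C by apply: RtoC_neq0; apply: not_0_INR.
  rewrite E /=; field; split; auto.
Qed.

(** The Taylor polynomial evaluated at [z1 = z0 + h] is followed as its centre moves: at centre [z1]
    it is [F 0 z1], at centre [z0] it is the partial sum. The mean value inequality between the two,
    with [CD_taylor_poly] and the assumed Cauchy-type bounds, leaves an error
    [M * (N + 1) * x ^ (N + 1)] with [x = |h| / rad < 1]. *)
Lemma taylor_series (F : nat -> C -> C) (z0 : C) (rho rad M : R) :
  0 < rad ->
  (forall j z, Cmod (z - z0) < rho -> CD (F j) z (F (S j) z)) ->
  (forall j z, Cmod (z - z0) < rho -> Cmod (F j z) <= M * INR (fact j) / rad ^ j) ->
  forall h, Cmod h < rho -> Cmod h < rad ->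
  Cis_series (pser (fun j => F j z0 / INR (fact j))%C h) (F 0%nat (z0 + h)%C).
Proof.
  move=> Hrad HD HB h h1 h2.
  have h0 := Cmod_ge_0 h.
  set x := Cmod h / rad.
  have Hx : 0 <= x < 1.
    split; first exact: Rdiv_le_0_compat.
    apply: (Rmult_lt_reg_r rad) => //; rewrite /x /Rdiv Rmult_assoc Rinv_l; lra.
  apply/Cis_series_Clim; apply: (Clim_of_bound _ _ (fun n => M * (INR (S n) * x ^ S n))); last first.
    rewrite -(Rmult_0_r M); apply: (is_lim_seq_scal_l _ _ 0); exact: is_lim_seq_arith_geom.
  move=> N.
  set z1 := (z0 + h)%C.
  have hz0 : Cmod (z0 - z0) < rho by rewrite Cmod_self_minus; lra.
  have hz1 : Cmod (z1 - z0) < rho.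
    by replace (z1 - z0)%C with h by (rewrite /z1; ring).
  have T1 : csum (fun j => F j z1 * Cpow (z1 - z1) j / INR (fact j))%C N = F 0%nat z1.
    elim: N => [|N IH]; first by rewrite csum_0 /=; field; exact: RtoC_neq0.
    rewrite csum_S IH Cpow_0_S; field; exact: INR_fact_neq0_C.
  have T0 : csum (fun j => F j z0 * Cpow (z1 - z0) j / INR (fact j))%C N =
     csum (pser (fun j => F j z0 / INR (fact j))%C h) N.
    apply: csum_ext => k _; rewrite /pser.
    replace (z1 - z0)%C with h by (rewrite /z1; ring).
    field; exact: INR_fact_neq0_C.
  rewrite Cmod_minus_sym -T0 -T1.
  have hz : forall t : R, 0 <= t <= 1 -> Cmod (z0 + t * (z1 - z0) - z0) < rho.
    exact: ball_segment.
  apply: (Rle_trans _ (M * INR (S N) * Cmod h ^ N / rad ^ S N * Cmod (z1 - z0))).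
  - apply: (MVI (fun w => csum (fun j => F j w * Cpow (z1 - w) j / INR (fact j))%C N)
      (fun z => F (S N) z * Cpow (z1 - z) N / INR (fact N))%C) => t Ht; split.
      by apply: CD_taylor_poly => j; apply: HD; apply: hz.
    rewrite Cmod_div; last exact: INR_fact_neq0_C.
    rewrite Cmod_mult Cmod_pow Cmod_R (Rabs_pos_eq (INR _)); last exact: pos_INR.
    have Hle : Cmod (z1 - (z0 + t * (z1 - z0))) <= Cmod h.
      replace (z1 - (z0 + t * (z1 - z0)))%C with ((1 - t)%R * h)%C.
        2: by rewrite RtoC_minus /z1; ring.
      rewrite Cmod_scal_R; nra.
    have B := HB (S N) _ (hz t Ht).
    have Hf : 0 < INR (fact N) := INR_fact_lt_0 N.
    apply: (Rmult_le_reg_r (INR (fact N))) => //.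
    rewrite {1}/Rdiv Rmult_assoc Rinv_l ?Rmult_1_r; last lra.
    have -> : M * INR (S N) * Cmod h ^ N / rad ^ S N * INR (fact N) =
      (M * INR (fact (S N)) / rad ^ S N) * Cmod h ^ N.
      have -> : INR (fact (S N)) = INR (S N) * INR (fact N) by rewrite -mult_INR.
      field; apply: pow_nonzero; lra.
    apply: Rmult_le_compat => //; try exact: Cmod_ge_0.
    + apply: pow_le; exact: Cmod_ge_0.
    + apply: pow_incr; split=> //; exact: Cmod_ge_0.
  - replace (z1 - z0)%C with h by (rewrite /z1; ring).
    rewrite /x /Rdiv Rpow_mult_distr pow_inv /=; apply: Req_le; field.
    split; last lra; apply: pow_nonzero; lra.
Qed.

Lemma analytic_at_taylor (F : nat -> C -> C) (z0 : C) (rho rad M : R) :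
  0 < rho -> 0 < rad ->
  (forall j z, Cmod (z - z0) < rho -> CD (F j) z (F (S j) z)) ->
  (forall j z, Cmod (z - z0) < rho -> Cmod (F j z) <= M * INR (fact j) / rad ^ j) ->
  analytic_at (F 0%nat) z0.
Proof.
  move=> Hrho Hrad HD HB; apply/analytic_at_C.
  exists (fun j => F j z0 / INR (fact j))%C, (Rmin rho rad).
  split; first exact: Rmin_pos.
  move=> h Hh; apply: (taylor_series F z0 rho rad M) => //.
  - exact: lt_Rmin_l Hh.
  - exact: lt_Rmin_r Hh.
Qed.

Lemma cseries_shift (u : nat -> C) (m : nat) : (forall k, (k < m)%nat -> u k = 0%C) ->
  cseries u = cseries (fun k => u (m + k)%nat).
Proof.
  move=> H; rewrite /cseries; f_equal.
  - by apply: Series_incr_n_aux => k Hk; rewrite H.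
  - by apply: Series_incr_n_aux => k Hk; rewrite H.
Qed.

Lemma cseries_first (u : nat -> C) : cabs u ->
  cseries u = (u 0%nat + cseries (fun k => u (S k)))%C.
Proof.
  move=> H; rewrite /cseries (Series_incr_1 _ (cabs_Re _ H)) (Series_incr_1 _ (cabs_Im _ H)).
  by [].
Qed.

(** Strong induction on [m]: if the earlier coefficients vanish, [h ^ m] factors out of the series
    and [a m] is [- h] times a tail that stays bounded as [h] tends to 0 along the ray. *)
Lemma pser_zero_on_ray (a : nat -> C) (g : C -> C) (r tau0 : R) (v : C) :
  0 < r -> 0 < tau0 -> v <> 0%C ->
  (forall h, Cmod h < r -> Cis_series (pser a h) (g h)) ->
  (forall tau : R, 0 < tau < tau0 -> g (tau * v)%C = 0%C) ->
  forall m, a m = 0%C.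
Proof.
  move=> Hr Ht0 Hv H Hg.
  elim/lt_wf_ind => m IH.
  have HV := proj1 (Cmod_gt_0 _) Hv.
  have [K HK] := pser_disc_bound a g r (r / 2) ltac:(lra) H.
  set rho := r / 2 in HK.
  have Hrho : 0 < rho by rewrite /rho; lra.
  (* The 2 is the sum of the geometric series of ratio 1/2 dominating the tail once
     [|h| < rho / 2]. *)
  pose K' := K / rho ^ (S m) * 2.
  have key : forall tau, 0 < tau < tau0 -> tau * Cmod v < rho / 2 ->
    Cmod (a m) <= tau * Cmod v * K'.
    move=> tau Ht Hs; set h := (tau * v)%C.
    have Eh : Cmod h = tau * Cmod v by apply: Cmod_scal_R; lra.
    have Hh0 : h <> 0%C by apply: Cmod_pos_neq0; rewrite Eh; nra.
    have Hhr : Cmod h < r by rewrite Eh; rewrite /rho in Hs; lra.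
    have Hab : cabs (pser a h) := pser_disc_cabs a g r h H Hhr.
    have Hs0 : cseries (pser a h) = 0%C.
      by rewrite (Cis_series_unique _ _ (H h Hhr)) /h Hg.
    have Hb : forall k, Cmod (Cpow h k * a (S m + k)%nat) <= K / rho ^ (S m) * (/ 2) ^ k.
      move=> k; rewrite Cmod_mult Cmod_pow.
      have Hp : 0 < rho ^ (S m + k) by apply: pow_lt.
      have := HK (S m + k)%nat => HKk.
      have Hpk : Cmod h ^ k <= (rho * / 2) ^ k.
        apply: pow_incr; rewrite Eh; split; [nra|lra].
      rewrite Rpow_mult_distr in Hpk.
      apply: Rle_trans (Rmult_le_compat_r _ _ _ (Cmod_ge_0 _) Hpk) _.
      have Hr1 : 0 < rho ^ S m by apply: pow_lt.
      have H2 : 0 < (/ 2) ^ k by apply: pow_lt; lra.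
      rewrite pow_add in HKk.
      have : Cmod (a (S m + k)%nat) * rho ^ k <= K / rho ^ S m.
        apply: (Rmult_le_reg_r (rho ^ S m)) => //.
        rewrite /Rdiv Rmult_assoc (Rmult_assoc K) Rinv_l; lra.
      move=> Hx; have := Rmult_le_compat_r _ _ _ (Rlt_le _ _ H2) Hx; lra.
    have Hgeo : ex_series (fun k => K / rho ^ (S m) * (/ 2) ^ k).
      apply: ex_series_scal_R; apply: ex_series_geom.
      rewrite Rabs_pos_eq; lra.
    have HT := Cmod_cseries_le _ _ Hb Hgeo.
    have Ab := cabs_le _ _ Hb Hgeo.
    rewrite Series_scal_l Series_geom in HT; last by rewrite Rabs_pos_eq; lra.
    have Hsh : cseries (pser a h) =
      (Cpow h m * (a m + h * cseries (fun k => Cpow h k * a (S m + k)%nat)))%C.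
      rewrite (cseries_shift _ m); last by move=> k Hk; rewrite /pser IH //; ring.
      rewrite cseries_first; last first.
        exact: (proj1 (ex_series_incr_n (fun n => Cmod (pser a h n)) m) Hab).
      have -> : cseries (fun k => pser a h (m + S k)%nat) =
        cseries (fun k => (Cpow h m * h) * (Cpow h k * a (S m + k)%nat))%C.
        apply: cseries_ext => k; rewrite /pser Cpow_add_r.
        replace (m + S k)%nat with (S m + k)%nat by lia.
        rewrite /=; ring.
      rewrite cseries_scal // Nat.add_0_r /pser; ring.
    have Ea : a m = (- (h * cseries (fun k => Cpow h k * a (S m + k)%nat)))%C.
      have Hhm := Cpow_nz h m Hh0.
      rewrite Hs0 in Hsh.
      apply: Csub_eq0.
      transitivity (/ Cpow h m * (Cpow h m * (a m + h * cseries (fun k => Cpow h k * a (S m + k)%nat))))%C.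
        by field.
      by rewrite -Hsh; ring.
    rewrite Ea Cmod_opp Cmod_mult Eh.
    apply: Rmult_le_compat_l; first nra.
    apply: Rle_trans HT _; rewrite /K'; apply: Req_le; field.
    apply: pow_nonzero; lra.
  apply: Cmod_eq_0; apply: Rle_antisym; last exact: Cmod_ge_0.
  apply: Rnot_lt_le => Hpos.
  have HK' : 0 < Rabs K' + 1 by have := Rabs_pos K'; lra.
  (* The first two entries make [key] applicable, the third makes its bound at most half of [|a m|];
     [Rabs K' + 1] is a positive majorant of [K']. *)
  pose tau := Rmin (tau0 / 2) (Rmin (rho / 4 / Cmod v) (Cmod (a m) / 2 / Cmod v / (Rabs K' + 1))).
  have Htau : 0 < tau.
    apply: Rmin_pos; first lra.
    by apply: Rmin_pos; repeat apply: Rdiv_lt_0_compat => //; lra.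
  have T1 : tau <= tau0 / 2 := Rmin_l _ _.
  have T2 : tau <= rho / 4 / Cmod v := Rle_trans _ _ _ (Rmin_r _ _) (Rmin_l _ _).
  have T3 : tau <= Cmod (a m) / 2 / Cmod v / (Rabs K' + 1) :=
    Rle_trans _ _ _ (Rmin_r _ _) (Rmin_r _ _).
  have T2' : tau * Cmod v <= rho / 4.
    apply: Rle_trans (Rmult_le_compat_r _ _ _ (Rlt_le _ _ HV) T2) _.
    by apply: Req_le; field; lra.
  have T3' : tau * Cmod v * (Rabs K' + 1) <= Cmod (a m) / 2.
    rewrite Rmult_assoc.
    apply: Rle_trans (Rmult_le_compat_r _ _ _ _ T3) _; first nra.
    by apply: Req_le; field; lra.
  have := key tau ltac:(lra) ltac:(lra).
  have := Rle_abs K'; have : 0 < tau * Cmod v by nra.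
  nra.
Qed.

(** * The identity theorem and the Wallis product *)

Definition vanishes_near (f : C -> C) (z : C) : Prop :=
  exists d, 0 < d /\ forall w, Cmod (w - z) < d -> f w = 0%C.

(** Let [T] be the supremum of the parameters up to which [f] vanishes near every point of the
    segment. If [T > 0], the power series at [T] vanishes along the ray pointing back, hence
    identically; so [f] vanishes on a whole disc around that point, and [T < 1] would let the
    property continue beyond [T]. *)
Lemma identity_theorem_segment (f : C -> C) (p v : C) : v <> 0%C ->
  (forall t : R, 0 <= t <= 1 -> analytic_at f (p + t * v)%C) ->
  vanishes_near f p -> vanishes_near f (p + v)%C.
Proof.
  move=> Hv Han H0.
  have HV := proj1 (Cmod_gt_0 _) Hv.
  pose E t := 0 <= t <= 1 /\ forall u : R, 0 <= u <= t -> vanishes_near f (p + u * v)%C.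
  have P0 : vanishes_near f (p + 0%R * v)%C by replace (p + 0%R * v)%C with p by ring.
  have E0 : E 0 by split; [lra|move=> u Hu; replace u with 0 by lra].
  have [T [HT1 HT2]] : {T | is_lub E T}.
    apply: completeness; last by exists 0.
    by exists 1 => t [Ht _]; lra.
  have T0 : 0 <= T by apply: HT1.
  have T1 : T <= 1 by apply: HT2 => t [Ht _]; lra.
  have below : forall u, 0 <= u < T -> vanishes_near f (p + u * v)%C.
    move=> u Hu; apply: Classical_Prop.NNPP => Hn.
    suff : T <= u by lra.
    apply: HT2 => t [Ht1 Ht2]; apply: Rnot_lt_le => Hut; apply: Hn; apply: Ht2; lra.
  have atT : vanishes_near f (p + T * v)%C.
    case: T0 => [Tpos|T00]; last by rewrite -T00.
    have [a [r [Hr Ha]]] := proj1 (analytic_at_C _ _) (Han T ltac:(lra)).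
    have Hnv : (- v)%C <> 0%C by move=> Ev; apply: Hv; replace v with (- - v)%C by ring; rewrite Ev; ring.
    have Hz := pser_zero_on_ray a _ r T (- v)%C Hr Tpos Hnv Ha.
    have {Hz}Ha0 : forall m, a m = 0%C.
      apply: Hz => tau Htau.
      have [d [Hd Hw]] := below (T - tau) ltac:(lra).
      apply: Hw; replace (p + T * v + tau * - v - (p + (T - tau)%R * v))%C with (RtoC 0).
        by rewrite Cmod_0.
      by rewrite RtoC_minus; ring.
    exists r; split=> // w Hw.
    have := Cis_series_unique _ _ (Ha _ Hw).
    replace (p + T * v + (w - (p + T * v)))%C with w by ring.
    by move=> <-; apply: cseries_0 => n; rewrite /pser Ha0; ring.
  case: T1 => [T1|T1]; last first.
    by rewrite T1 Cmult_1_l in atT.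
  exfalso; have [d [Hd Hw]] := atT.
  pose eta := Rmin ((1 - T) / 2) (d / 2 / Cmod v).
  have Heta : 0 < eta.
    by apply: Rmin_pos; first lra; apply: Rdiv_lt_0_compat; lra.
  have e1 : eta <= (1 - T) / 2 := Rmin_l _ _.
  have e2 : eta * Cmod v <= d / 2.
    have : eta <= d / 2 / Cmod v := Rmin_r _ _.
    move=> /(Rmult_le_compat_r (Cmod v)) H; apply: Rle_trans (H (Rlt_le _ _ HV)) _.
    by apply: Req_le; field; lra.
  suff : T + eta <= T by lra.
  apply: HT1; split; first lra.
  move=> u Hu; case: (Rlt_le_dec u T) => HuT; first by apply: below; lra.
  have Hdu : Cmod (p + u * v - (p + T * v)) < d.
    replace (p + u * v - (p + T * v))%C with ((u - T)%R * v)%C by (rewrite RtoC_minus; ring).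
    rewrite Cmod_scal_R; last lra.
    apply: (Rle_lt_trans _ (eta * Cmod v)); last lra.
    by apply: Rmult_le_compat_r; lra.
  have [d' [Hd' Hw']] := ball_open (p + T * v)%C _ d Hdu.
  by exists d'; split=> // w /Hw'; apply: Hw.
Qed.

Lemma is_lim_inv_INR_S : is_lim_seq (fun n => / INR (S n)) 0.
Proof.
  apply/(is_lim_seq_incr_1 (fun n => / INR n)).
  replace (Finite 0) with (Rbar_inv p_infty) by reflexivity.
  by apply: is_lim_seq_inv; [exact: is_lim_seq_INR|].
Qed.

Fixpoint wallis (n : nat) : R :=
  match n with
  | O => 1
  | S m => wallis m * ((2 * INR m + 2) ^ 2 / ((2 * INR m + 1) * (2 * INR m + 3)))
  end.

Lemma wallis_pos (n : nat) : 0 < wallis n.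
Proof.
  elim: n => [|n IH] /=; first lra.
  have := pos_INR n => H; apply: Rmult_lt_0_compat => //.
  apply: Rdiv_lt_0_compat; nra.
Qed.

(** Wallis integrals: the recursion for [I n], the integral of [sin ^ n] over a quarter period,
    gives [wallis n * I (2n) = PI / 2 * I (2n + 1)]. Monotonicity of [I] then places
    [I (2n + 1) / I (2n)] between [(2n + 1) / (2n + 2)] and 1. *)
Lemma wallis_lim : is_lim_seq wallis (PI / 2).
Proof.
  pose I n := RInt (fun x => sin x ^ n) 0 (PI / 2).
  have HPI := PI_RGT_0.
  have ex : forall n, ex_RInt (fun x => sin x ^ n) 0 (PI / 2).
    move=> n; apply: ex_RInt_continuous => x _.
    apply: ex_derive_continuous; auto_derive => //.
  have sin01 : forall x, 0 <= x <= PI / 2 -> 0 <= sin x <= 1.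
    move=> x Hx; split; first by apply: sin_ge_0; lra.
    by have := SIN_bound x; lra.
  have rec : forall n, INR (n + 2) * I (n + 2)%nat = INR (n + 1) * I n.
    move=> n.
    (* This is the derivative of [cos x * sin x ^ (n + 1)], which vanishes at both ends. *)
    pose f x := INR (n + 1) * sin x ^ n - INR (n + 2) * sin x ^ (n + 2).
    have Hf : is_RInt f 0 (PI / 2) (cos (PI / 2) * sin (PI / 2) ^ (n + 1) - cos 0 * sin 0 ^ (n + 1)).
      apply: (is_RInt_derive (fun x => cos x * sin x ^ (n + 1))).
        move=> x _; rewrite /f; auto_derive => //.
        have -> : (Nat.pred (n + 1) = n)%nat by lia.
        rewrite !plus_INR !pow_add /=.
        have := sin2_cos2 x; rewrite /Rsqr => E.
        transitivity ((INR n + 1) * sin x ^ n * (cos x * cos x) - sin x * sin x * sin x ^ n); first ring.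
        have -> : cos x * cos x = 1 - sin x * sin x by lra.
        ring.
      move=> x _; rewrite /f; apply: ex_derive_continuous; auto_derive => //.
    have Hf' : is_RInt f 0 (PI / 2) (INR (n + 1) * I n - INR (n + 2) * I (n + 2)%nat).
      apply: (is_RInt_minus (V := R_NormedModule)).
      - by apply: (is_RInt_scal (V := R_NormedModule)); apply: (RInt_correct (V := R_CompleteNormedModule)).
      - by apply: (is_RInt_scal (V := R_NormedModule)); apply: (RInt_correct (V := R_CompleteNormedModule)).
    have := is_RInt_unique _ _ _ _ Hf; rewrite (is_RInt_unique _ _ _ _ Hf').
    rewrite cos_PI2 sin_0 pow_i; [lra|lia].
  have I0 : I 0%nat = PI / 2.
    rewrite /I /= RInt_const /scal /= /mult /=; ring.
  have I1 : I 1%nat = 1.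
    rewrite /I; apply: is_RInt_unique.
    replace 1 with (- cos (PI / 2) - - cos 0); last by rewrite cos_PI2 cos_0; ring.
    apply: (is_RInt_derive (fun x => - cos x)) => x _.
      by auto_derive => //; ring.
    by apply: ex_derive_continuous; auto_derive.
  have decr : forall n, I (S n) <= I n.
    move=> n; apply: RInt_le => //; first lra.
    move=> x Hx; have H := sin01 x ltac:(lra).
    rewrite /=; have : 0 <= sin x ^ n by apply: pow_le; lra.
    nra.
  have rec2 : forall n, I (n + 2)%nat = (INR n + 1) / (INR n + 2) * I n.
    move=> n; have := rec n; rewrite !plus_INR /= => E; have := pos_INR n => Hn.
    apply: (Rmult_eq_reg_l (INR n + 2)); last lra.
    transitivity ((INR n + 1) * I n); [lra|field; lra].
  have pos : forall n, 0 < I (2 * n)%nat.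
    elim=> [|n IH]; first by rewrite I0; lra.
    replace (2 * S n)%nat with (2 * n + 2)%nat by lia.
    rewrite rec2; have := pos_INR (2 * n) => Hn; apply: Rmult_lt_0_compat => //.
    by apply: Rdiv_lt_0_compat; lra.
  have W : forall n, wallis n * I (2 * n)%nat = PI / 2 * I (2 * n + 1)%nat.
    elim=> [|n IH]; first by rewrite /= I0 I1; ring.
    replace (2 * S n)%nat with (2 * n + 2)%nat by lia.
    replace (2 * n + 2 + 1)%nat with (2 * n + 1 + 2)%nat by lia.
    rewrite !rec2 plus_INR mult_INR [wallis _]/=; have := pos_INR n => Hn.
    rewrite [INR 2]/= [INR 1]/=.
    have -> : PI / 2 * ((2 * INR n + 1 + 1) / (2 * INR n + 1 + 2) * I (2 * n + 1)%nat) =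
      (2 * INR n + 1 + 1) / (2 * INR n + 1 + 2) * (PI / 2 * I (2 * n + 1)%nat) by ring.
    rewrite -IH; field; lra.
  apply: (is_lim_seq_le_le (fun n => PI / 2 * (1 - / (INR n + 1))) _ (fun _ => PI / 2)).
  - move=> n; have Hp := pos n; have Hn := pos_INR n.
    have D1 := decr (2 * n)%nat; have D2 := decr (2 * n + 1)%nat.
    replace (S (2 * n))%nat with (2 * n + 1)%nat in D1 by lia.
    replace (S (2 * n + 1))%nat with (2 * n + 2)%nat in D2 by lia.
    rewrite rec2 mult_INR /= in D2.
    split; apply: (Rmult_le_reg_r (I (2 * n)%nat)) => //; rewrite W.
    + rewrite Rmult_assoc; apply: Rmult_le_compat_l; first lra.
      apply: Rle_trans D2; apply: Rmult_le_compat_r; first lra.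
      apply: (Rmult_le_reg_r (2 * (INR n + 1))); first lra.
      have -> : (1 - / (INR n + 1)) * (2 * (INR n + 1)) = 2 * INR n by field; lra.
      have -> : ((1 + 1) * INR n + 1) / ((1 + 1) * INR n + 2) * (2 * (INR n + 1)) = 2 * INR n + 1
        by field; lra.
      lra.
    + by apply: Rmult_le_compat_l; lra.
  - replace (Finite (PI / 2)) with (Finite (PI / 2 * (1 - 0))) by (f_equal; ring).
    apply: is_lim_seq_mult'; first exact: is_lim_seq_const.
    apply: is_lim_seq_minus'; first exact: is_lim_seq_const.
    apply: is_lim_seq_ext is_lim_inv_INR_S => n; by rewrite S_INR.
  - exact: is_lim_seq_const.
Qed.

(** * Zeta at 0 *)

Lemma RD_comp_CD (F : C -> C) (u : R -> R) (t du : R) (l : C) :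
  is_derive u t du -> CD F (u t) l -> RD (fun t => F (RtoC (u t))) t (l * du)%C.
Proof.
  move=> Hu HF.
  have [H1 H2] : RD (fun t : R => F (0 + t * 1)%C) (u t) (l * 1)%C.
    by apply: CD_path; replace (0 + u t * 1)%C with (RtoC (u t)) by ring.
  have E : forall x : R, F (0 + x * 1)%C = F (RtoC x) by move=> x; f_equal; ring.
  split.
  - have := is_derive_comp (fun t => Re (F (0 + RtoC t * 1)%C)) u t _ _ H1 Hu.
    move=> H; apply: is_derive_ext (_ : is_derive _ t _) => [x|].
      by rewrite -(E (u x)).
    replace (Re (l * du)) with (@scal _ R_NormedModule du (Re (l * 1))); first exact: H.
    rewrite /scal /= /mult /Re /=; ring.
  - have := is_derive_comp (fun t => Im (F (0 + RtoC t * 1)%C)) u t _ _ H2 Hu.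
    move=> H; apply: is_derive_ext (_ : is_derive _ t _) => [x|].
      by rewrite -(E (u x)).
    replace (Im (l * du)) with (@scal _ R_NormedModule du (Im (l * 1))); first exact: H.
    rewrite /scal /= /mult /Im /=; ring.
Qed.

(* [Lterm j s (- ln x)] is the [j]-th derivative of [x ^ (- s)] in [s]. *)
Definition Lterm (j : nat) (s z : C) : C := (Cpow z j * Cexp (s * z))%C.

(** [Lterm1] and [Lterm2] are derivatives in [z], whereas a derivative in [s] just raises [j]. They
    are needed because the eta terms are second differences in [x], with [z = - ln x]. Where [pred]
    is cut off at 0, a coefficient [INR] vanishes. *)
Definition Lterm1 (j : nat) (s z : C) : C :=
  ((INR j * Cpow z (pred j) + s * Cpow z j) * Cexp (s * z))%C.

Definition Lterm2 (j : nat) (s z : C) : C :=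
  ((INR j * (INR (pred j) * Cpow z (pred (pred j))) + 2 * s * (INR j * Cpow z (pred j))
    + s * s * Cpow z j) * Cexp (s * z))%C.

Lemma CD_scal_id (a z : C) : CD (fun w => a * w)%C z a.
Proof. apply: CD_eq (CD_scal a _ _ _ (CD_id z)); ring. Qed.

Lemma CD_Lterm (j : nat) (s z : C) : CD (Lterm j s) z (Lterm1 j s z).
Proof.
  apply: CD_eq (CD_mult _ _ _ _ _ (CD_pow _ _ _ j (CD_id z)) (CD_Cexp_comp _ _ _ (CD_scal_id s z))).
  rewrite /Lterm1; ring.
Qed.

Lemma CD_Lterm1 (j : nat) (s z : C) : CD (Lterm1 j s) z (Lterm2 j s z).
Proof.
  apply: CD_eq (CD_mult _ _ _ _ _
    (CD_plus _ _ _ _ _ (CD_scal (INR j) _ _ _ (CD_pow _ _ _ (pred j) (CD_id z)))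
      (CD_scal s _ _ _ (CD_pow _ _ _ j (CD_id z))))
    (CD_Cexp_comp _ _ _ (CD_scal_id s z))).
  rewrite /Lterm2; ring.
Qed.

Lemma CD_Lterm_s (j : nat) (s z : C) : CD (fun s => Lterm j s z) s (Lterm (S j) s z).
Proof.
  have H : CD (fun s => s * z)%C s z.
    by apply: CD_eq (CD_mult _ _ _ _ _ (CD_id s) (CD_const z s)) => /=; ring.
  apply: CD_eq (CD_scal (Cpow z j) _ _ _ (CD_Cexp_comp _ _ _ H)).
  rewrite /Lterm /=; ring.
Qed.

Lemma Cexp_neg_ln (x : R) : 0 < x -> Cexp (RtoC (- ln x)) = RtoC (/ x).
Proof. by move=> Hx; rewrite Cexp_R exp_Ropp exp_ln. Qed.

(** The expression is the increment over [[x, x + 1]] of [t -> phi (t + 1) - phi t], so the mean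
    value inequality is applied first to this function and then to [phi1]. *)
Lemma second_difference (phi : R -> C) (phi1 phi2 : R -> C) (x K : R) :
  (forall y, x <= y <= x + 2 -> RD phi y (phi1 y) /\ RD phi1 y (phi2 y) /\ Cmod (phi2 y) <= K) ->
  Cmod (phi x - 2 * phi (x + 1)%R + phi (x + 2)%R) <= K.
Proof.
  move=> H.
  have RD_shift : forall (f : R -> C) y l, RD f (y + 1) l -> RD (fun t => f (t + 1)) y l.
    move=> f y l [H1 H2].
    have D : is_derive (fun t => t + 1) y 1 by auto_derive => //; ring.
    split.
    - have := is_derive_comp (fun t => Re (f t)) (fun t => t + 1) y _ _ H1 D.
      by rewrite /scal /= /mult /= Rmult_1_l.
    - have := is_derive_comp (fun t => Im (f t)) (fun t => t + 1) y _ _ H2 D.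
      by rewrite /scal /= /mult /= Rmult_1_l.
  have RD_minus : forall (f g : R -> C) y a b, RD f y a -> RD g y b ->
    RD (fun t => f t - g t)%C y (a - b)%C.
    move=> f g y a b [H1 H2] [H3 H4]; split.
    - exact: (is_derive_minus (V := R_NormedModule) _ _ _ _ _ H1 H3).
    - exact: (is_derive_minus (V := R_NormedModule) _ _ _ _ _ H2 H4).
  have := MVI_R (fun t => phi (t + 1)%R - phi t)%C (fun t => phi1 (t + 1)%R - phi1 t)%C x (x + 1) K.
  replace (x + 1 + 1) with (x + 2) by ring.
  replace (x + 1 - x) with 1 by ring.
  rewrite Rmult_1_r.
  replace (phi (x + 2)%R - phi (x + 1)%R - (phi (x + 1)%R - phi x))%C
    with (phi x - 2 * phi (x + 1)%R + phi (x + 2)%R)%C by ring.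
  apply; first lra.
  move=> t Ht; split.
    apply: RD_minus; last by have [] := H t ltac:(lra).
    by apply: RD_shift; have [] := H (t + 1) ltac:(lra).
  have := MVI_R phi1 phi2 t (t + 1) K; replace (t + 1 - t) with 1 by ring.
  rewrite Rmult_1_r; apply; first lra.
  move=> y Hy; by have [_ []] := H y ltac:(lra).
Qed.

Lemma pow_le_fact_exp (x : R) (n : nat) : 0 <= x -> x ^ n <= INR (fact n) * exp x.
Proof.
  move=> Hx.
  have H := is_exp_Reals x.
  have Hs : is_lim_seq (sum_n (fun k => / INR (fact k) * x ^ k)) (exp x).
    have := proj1 (is_pseries_R _ _ _) H; exact.
  have Hf := INR_fact_lt_0 n.
  have pos : forall k, 0 <= / INR (fact k) * x ^ k.
    move=> k; apply: Rmult_le_pos; last exact: pow_le.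
    by apply: Rlt_le; apply: Rinv_0_lt_compat; apply: INR_fact_lt_0.
  have : / INR (fact n) * x ^ n <= exp x.
    apply: (Rle_trans _ (sum_n (fun k => / INR (fact k) * x ^ k) n)).
      case: n Hf => [|n] Hf; first by rewrite sum_O; lra.
      rewrite sum_Sn /plus /=.
      suff : 0 <= sum_n (fun k => / INR (fact k) * x ^ k) n by move=> HH; have := pos (S n); rewrite /=; lra.
      elim: n {Hf} => [|n IH]; first by rewrite sum_O.
      by rewrite sum_Sn /plus /=; have := pos (S n); rewrite /=; lra.
    apply: (is_lim_seq_incr_compare _ _ Hs) => k.
    rewrite sum_Sn /plus /=; have := pos (S k); rewrite /=; lra.
  move=> HH; apply: (Rmult_le_reg_l (/ INR (fact n))); first exact: Rinv_0_lt_compat.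
  by rewrite -Rmult_assoc Rinv_l; lra.
Qed.

(** A majorant of [L ^ j] in the form of a Cauchy estimate of radius 1/4, from [y ^ j <= j! * exp y]
    at [y = L / 4]. With [L = ln x] it costs a factor [x ^ (1/4)]. *)
Definition Lbound (j : nat) (L : R) : R := INR (fact j) / (/ 4) ^ j * exp (L / 4).

Lemma pow_le_Lbound (j : nat) (L : R) : 0 <= L -> L ^ j <= Lbound j L.
Proof.
  move=> HL; rewrite /Lbound.
  have := pow_le_fact_exp (L / 4) j ltac:(lra).
  rewrite {1}/Rdiv Rpow_mult_distr => H.
  have Hp : 0 < (/ 4) ^ j by apply: pow_lt; lra.
  apply: (Rmult_le_reg_r ((/ 4) ^ j)) => //.
  apply: Rle_trans H _; apply: Req_le; field; lra.
Qed.

Lemma INR_S_mul_Lbound (j : nat) (L : R) : INR (S j) * Lbound j L <= Lbound (S j) L.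
Proof.
  have Hp : 0 < (/ 4) ^ j by apply: pow_lt; lra.
  have -> : Lbound (S j) L = 4 * (INR (S j) * Lbound j L).
    rewrite /Lbound; have -> : INR (fact (S j)) = INR (S j) * INR (fact j) by rewrite -mult_INR.
    by rewrite [(/ 4) ^ S j]/=; field; lra.
  suff : 0 <= INR (S j) * Lbound j L by lra.
  apply: Rmult_le_pos; first exact: pos_INR.
  apply: Rmult_le_pos; last by apply: Rlt_le; apply: exp_pos.
  by apply: Rlt_le; apply: Rdiv_lt_0_compat => //; apply: INR_fact_lt_0.
Qed.

Lemma pow_pred_le_Lbound (j : nat) (L : R) : 0 <= L -> INR j * L ^ pred j <= Lbound j L.
Proof.
  case: j => [|j] HL.
    rewrite /= Rmult_0_l; apply: Rle_trans (pow_le_Lbound 0 L HL) => /=; lra.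
  apply: Rle_trans (INR_S_mul_Lbound j L).
  by apply: Rmult_le_compat_l; [exact: pos_INR|exact: pow_le_Lbound].
Qed.

Lemma pow_pred2_le_Lbound (j : nat) (L : R) : 0 <= L ->
  INR j * (INR (pred j) * L ^ pred (pred j)) <= Lbound j L.
Proof.
  case: j => [|j] HL.
    rewrite /= Rmult_0_l; apply: Rle_trans (pow_le_Lbound 0 L HL) => /=; lra.
  apply: Rle_trans (INR_S_mul_Lbound j L).
  by apply: Rmult_le_compat_l; [exact: pos_INR|exact: pow_pred_le_Lbound].
Qed.

Lemma exp_le_compat (x y : R) : x <= y -> exp x <= exp y.
Proof. by case=> [H| ->]; [apply: Rlt_le; exact: exp_increasing|lra]. Qed.

Definition xpow (j : nat) (s : C) (x : R) : C := Lterm j s (RtoC (- ln x)).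

Definition xpow2 (j : nat) (s : C) (x : R) : C :=
  let z := RtoC (- ln x) in
  ((Lterm2 j s z + Lterm1 j s z) * (Cexp z * Cexp z))%C.

(** Count of powers of [x]: two derivatives give -2, [x ^ (- s)] at most 1/4 and the logarithms at
    most 1/4 by [Lbound], in total -3/2, which is summable. The polynomial factor is at most
    [B ^ 2 + 3 * B + 2]. *)
Lemma Cmod_xpow2_le (j : nat) (s : C) (x B : R) : 1 <= x -> - / 4 <= Re s -> Cmod s <= B ->
  Cmod (xpow2 j s x) <=
  INR (fact j) / (/ 4) ^ j * ((B + 2) ^ 2 * exp (- (3 / 2) * ln x)).
Proof.
  move=> Hx Hs HB.
  set L := ln x.
  have HL : 0 <= L.
    by rewrite -ln_1; apply: ln_le; lra.
  have Ez : Cmod (RtoC (- L)) = L by rewrite Cmod_R Rabs_Ropp Rabs_pos_eq.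
  have b0 := pow_le_Lbound j L HL.
  have b1 := pow_pred_le_Lbound j L HL.
  have b2 := pow_pred2_le_Lbound j L HL.
  have Hs0 := Cmod_ge_0 s.
  have nn : forall n : nat, Cmod (INR n) = INR n.
    by move=> n; rewrite Cmod_R Rabs_pos_eq //; exact: pos_INR.
  have p0 : 0 <= L ^ j by apply: pow_le.
  have p1 : 0 <= INR j * L ^ pred j by apply: Rmult_le_pos; [exact: pos_INR|exact: pow_le].
  set K := Lbound j L in b0 b1 b2.
  have HC : Cmod (RtoC (INR j) * (INR (pred j) * Cpow (- L)%R (pred (pred j))) +
      2 * s * (INR j * Cpow (- L)%R (pred j)) + s * s * Cpow (- L)%R j +
      (INR j * Cpow (- L)%R (pred j) + s * Cpow (- L)%R j))%C <= K * (B + 2) ^ 2.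
    have T2 : Cmod (RtoC (INR j) * (INR (pred j) * Cpow (- L)%R (pred (pred j))))%C <= K.
      by rewrite !Cmod_mult Cmod_pow Ez !nn.
    have T1 : Cmod (RtoC (INR j) * Cpow (- L)%R (pred j))%C <= K.
      by rewrite !Cmod_mult Cmod_pow Ez !nn.
    have T0 : Cmod (Cpow (- L)%R j) <= K by rewrite Cmod_pow Ez.
    have K0 : 0 <= K by lra.
    have T1' : Cmod (2 * s * (INR j * Cpow (- L)%R (pred j)))%C <= 2 * B * K.
      rewrite Cmod_mult Cmod_scal_R; last lra.
      apply: Rmult_le_compat => //; [|exact: Cmod_ge_0|lra]; lra.
    have T0' : Cmod (s * s * Cpow (- L)%R j)%C <= B * B * K.
      rewrite !(Cmod_mult (s * s)) Cmod_mult.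
      apply: Rmult_le_compat => //; [|exact: Cmod_ge_0|]; nra.
    have T0'' : Cmod (s * Cpow (- L)%R j)%C <= B * K.
      by rewrite Cmod_mult; apply: Rmult_le_compat => //; exact: Cmod_ge_0.
    apply: Rle_trans (Cmod_triangle _ _) _.
    apply: (Rle_trans _ ((K + 2 * B * K + B * B * K) + (K + B * K))).
      apply: Rplus_le_compat.
        apply: Rle_trans (Cmod_triangle _ _) _; apply: Rplus_le_compat => //.
        by apply: Rle_trans (Cmod_triangle _ _) _; apply: Rplus_le_compat.
      by apply: Rle_trans (Cmod_triangle _ _) _; apply: Rplus_le_compat.
    nra.
  have -> : xpow2 j s x = ((RtoC (INR j) * (INR (pred j) * Cpow (- L)%R (pred (pred j))) +
      2 * s * (INR j * Cpow (- L)%R (pred j)) + s * s * Cpow (- L)%R j +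
      (INR j * Cpow (- L)%R (pred j) + s * Cpow (- L)%R j)) *
      (Cexp (s * (- L)%R) * (Cexp (- L)%R * Cexp (- L)%R)))%C.
    by rewrite /xpow2 /Lterm2 /Lterm1 -/L; ring.
  rewrite Cmod_mult -!Cexp_plus Cmod_Cexp.
  have HE : exp (Re (s * (- L)%R + ((- L)%R + (- L)%R))) <= exp (- (L / 4) + - (3 / 2) * L).
    have Hle : Re (s * (- L)%R + ((- L)%R + (- L)%R)) <= - (L / 4) + - (3 / 2) * L.
      move: Hs; rewrite /Re /=; nra.
    by case: Hle => [H| ->]; [apply: Rlt_le; exact: exp_increasing|lra].
  rewrite exp_plus in HE.
  apply: Rle_trans (Rmult_le_compat _ _ _ _ (Cmod_ge_0 _) (Rlt_le _ _ (exp_pos _)) HC HE) _.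
  apply: Req_le; rewrite /K /Lbound exp_Ropp.
  have := exp_pos (L / 4); have Hp : 0 < (/ 4) ^ j by apply: pow_lt; lra.
  move=> He; field; split; lra.
Qed.

Lemma RD_xpow (j : nat) (s : C) (x : R) : 0 < x ->
  RD (xpow j s) x (- (Lterm1 j s (- ln x)%R * Cexp (- ln x)%R))%C.
Proof.
  move=> Hx.
  have D : is_derive (fun x => - ln x) x (- / x) by auto_derive => //; field; lra.
  have := RD_comp_CD (Lterm j s) _ x _ _ D (CD_Lterm j s _).
  rewrite (RtoC_opp (/ x)) Cexp_neg_ln //.
  set a := (_ * - _)%C; set b := (- _)%C.
  by have -> : a = b by rewrite /a /b; ring.
Qed.

Lemma RD_xpow1 (j : nat) (s : C) (x : R) : 0 < x ->
  RD (fun x => - (Lterm1 j s (- ln x)%R * Cexp (- ln x)%R))%C x (xpow2 j s x).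
Proof.
  move=> Hx.
  have D : is_derive (fun x => - ln x) x (- / x) by auto_derive => //; field; lra.
  have := RD_comp_CD (fun z => - (Lterm1 j s z * Cexp z))%C _ x _ _ D
    (CD_opp _ _ _ (CD_mult _ _ _ _ _ (CD_Lterm1 j s _) (CD_Cexp _))).
  rewrite (RtoC_opp (/ x)) -(Cexp_neg_ln x) //.
  set a := (_ * - _)%C; set b := xpow2 _ _ _.
  have -> : a = b by rewrite /a /b /xpow2; ring.
  by [].
Qed.

(** Consecutive triples overlap at odd integers, where the two halves add up to one full term of the
    alternating series. As a second difference with unit step the triple decays two powers faster
    than [x ^ (- s)]; pairing neighbours would gain only one. *)
Definition eta_term (j m : nat) (s : C) : C :=
  (xpow j s (2 * INR m + 1)%R - 2 * xpow j s (2 * INR m + 1 + 1)%R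
   + xpow j s (2 * INR m + 1 + 2)%R)%C.

Definition decay (m : nat) : R := exp (- (3 / 2) * ln (INR m + 1)).

Lemma Cmod_eta_term_le (j m : nat) (s : C) (B : R) : - / 4 <= Re s -> Cmod s <= B ->
  Cmod (eta_term j m s) <= INR (fact j) / (/ 4) ^ j * ((B + 2) ^ 2 * decay m).
Proof.
  move=> Hs HB; have Hm := pos_INR m.
  apply: (second_difference _ (fun x => - (Lterm1 j s (- ln x)%R * Cexp (- ln x)%R))%C (xpow2 j s)).
  move=> y Hy; split; first by apply: RD_xpow; lra.
  split; first by apply: RD_xpow1; lra.
  apply: Rle_trans (Cmod_xpow2_le j s y B _ Hs HB) _; first lra.
  apply: Rmult_le_compat_l.
    apply: Rlt_le; apply: Rdiv_lt_0_compat; [exact: INR_fact_lt_0|apply: pow_lt; lra].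
  apply: Rmult_le_compat_l; first exact: pow2_ge_0.
  apply: exp_le_compat.
  have : ln (INR m + 1) <= ln y by apply: ln_le; lra.
  lra.
Qed.

Lemma ex_series_decay : ex_series decay.
Proof.
  pose u n := / sqrt (INR n + 1).
  (* Comparison with a telescoping series. With [a] and [c] the consecutive square roots,
     [(c - a) * (c + a) = 1] turns the claim into [c * (c + a) <= 6 * a ^ 2], which follows from
     [c <= 2 * a]. *)
  have Hb : forall n, Rabs (decay n) <= 6 * (u n - u (S n)).
    move=> n; rewrite Rabs_pos_eq; last by apply: Rlt_le; apply: exp_pos.
    have Hn := pos_INR n.
    rewrite /u S_INR; set a := sqrt (INR n + 1); set c := sqrt (INR n + 1 + 1).
    have Ha : a * a = INR n + 1 by apply: sqrt_sqrt; lra.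
    have Hc : c * c = INR n + 1 + 1 by apply: sqrt_sqrt; lra.
    have Ha0 : 0 < a by apply: sqrt_lt_R0; lra.
    have Hc0 : 0 < c by apply: sqrt_lt_R0; lra.
    have Hac : a < c by apply: sqrt_lt_1; lra.
    have Hc2 : c <= 2 * a.
      apply: Rnot_lt_le => H; have : (2 * a) * (2 * a) < c * c by nra.
      have : a * a >= 1 by lra.
      lra.
    have -> : decay n = / (a * a * a).
      have Ea : a * a * a = exp (3 * ln a).
        replace (3 * ln a) with (ln a + ln a + ln a) by ring.
        by rewrite !exp_plus exp_ln.
      rewrite /decay -Ha ln_mult // Ea -exp_Ropp; f_equal; field.
    apply: (Rmult_le_reg_r (a * a * a * c)); first by repeat apply: Rmult_lt_0_compat.
    have -> : / (a * a * a) * (a * a * a * c) = c by field; lra.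
    have -> : 6 * (/ a - / c) * (a * a * a * c) = 6 * (a * a) * (c - a) by field; lra.
    have E : (c - a) * (c + a) = 1 by nra.
    apply: (Rmult_le_reg_r (c + a)); first lra.
    rewrite (Rmult_assoc (6 * _)) E; nra.
  apply: ex_series_le_R Hb _.
  apply: ex_series_scal_R.
  exists 1.
  have tele : forall N, sum_n (fun n => u n - u (S n)) N = 1 - u (S N).
    elim=> [|N IH]; first by rewrite sum_O /u /= Rplus_0_l sqrt_1 Rinv_1.
    by rewrite sum_Sn IH /plus /=; ring.
  change (is_lim_seq (sum_n (fun n => u n - u (S n))) 1).
  apply: (is_lim_seq_ext (fun N => 1 - u (S N))) => [N|]; first by rewrite tele.
  replace (Finite 1) with (Finite (1 - 0)) by (f_equal; ring).
  apply: is_lim_seq_minus'; first exact: is_lim_seq_const.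
  apply/(is_lim_seq_incr_1 u).
  replace (Finite 0) with (Rbar_inv p_infty) by reflexivity.
  apply: is_lim_seq_inv => //.
  apply: (is_lim_seq_ext (fun n => sqrt (INR (S n)))) => [n|]; first by rewrite S_INR.
  apply: (filterlim_comp _ _ _ (fun n => INR (S n)) sqrt _ (Rbar_locally p_infty)).
    apply/(is_lim_seq_incr_1 INR); exact: is_lim_seq_INR.
  exact: filterlim_sqrt_p.
Qed.

(** The constant 1/2, present only for [j = 0], completes the halved first term [1 ^ (- s)] to 1. *)
Definition eta_deriv (j : nat) (s : C) : C :=
  (match j with O => / 2 | _ => 0 end + / 2 * cseries (fun m => eta_term j m s))%C.

Lemma eta_series_cabs (j : nat) (s : C) : - / 4 <= Re s -> cabs (fun m => eta_term j m s).
Proof.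
  move=> Hs; apply: cabs_le => [m|]; first exact: (Cmod_eta_term_le j m s (Cmod s) Hs (Rle_refl _)).
  do 2 (apply: ex_series_scal_R); exact: ex_series_decay.
Qed.

Lemma ball_Re (z s : C) : Re z - Cmod (s - z) <= Re s.
Proof.
  have := re_le_Cmod (s - z); rewrite /Re /= => H.
  have := Rle_abs (- (fst s + - fst z)); rewrite Rabs_Ropp; lra.
Qed.

Lemma ball_Cmod (z s : C) (d : R) : Cmod (s - z) < d -> Cmod s <= Cmod z + d.
Proof. have := Cmod_triangle_sub s z; lra. Qed.

(** A disc of radius 1/4 around a point of the closed right half-plane stays in [- / 4 <= Re s],
    where the term bounds hold. *)
Lemma CD_eta_deriv (z : C) (j : nat) (s : C) : 0 <= Re z -> Cmod (s - z) < / 4 ->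
  CD (eta_deriv j) s (eta_deriv (S j) s).
Proof.
  move=> Hz Hs.
  apply: CD_eq (CD_plus _ _ _ _ _ (CD_const (match j with O => / 2 | _ => 0 end)%C s)
    (CD_scal (/ 2)%C _ _ _ (cseries_dseq eta_term
      (fun j m => INR (fact j) / (/ 4) ^ j * ((Cmod z + / 4 + 2) ^ 2 * decay m)) z (/ 4) _ _ _ j s Hs))) => //.
  - move=> i m w _; apply: CD_plus; first apply: CD_minus; try apply: CD_scal; exact: CD_Lterm_s.
  - move=> i m w Hw; apply: Cmod_eta_term_le; last exact: ball_Cmod.
    by have := ball_Re z w; lra.
  - move=> i; do 2 (apply: ex_series_scal_R); exact: ex_series_decay.
Qed.

Lemma Cmod_eta_deriv_le (z : C) : exists M, forall (j : nat) (s : C),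
  0 <= Re z -> Cmod (s - z) < / 4 ->
  Cmod (eta_deriv j s) <= M * INR (fact j) / (/ 4) ^ j.
Proof.
  exists (/ 2 + / 2 * ((Cmod z + / 4 + 2) ^ 2 * Series decay)) => j s Hz Hs.
  have Hf := INR_fact_ge1 j.
  have Hp : 0 < (/ 4) ^ j by apply: pow_lt; lra.
  have Hp1 : (/ 4) ^ j <= 1 by rewrite -(pow1 j); apply: pow_incr; lra.
  have Hq : 1 <= INR (fact j) / (/ 4) ^ j.
    apply: (Rmult_le_reg_r ((/ 4) ^ j)) => //.
    rewrite /Rdiv Rmult_assoc Rinv_l; lra.
  have HS : Cmod (cseries (fun m => eta_term j m s)) <=
      INR (fact j) / (/ 4) ^ j * ((Cmod z + / 4 + 2) ^ 2 * Series decay).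
    rewrite -!Series_scal_l; apply: Cmod_cseries_le.
      move=> m; apply: Cmod_eta_term_le; last exact: ball_Cmod.
      by have := ball_Re z s; lra.
    do 2 (apply: ex_series_scal_R); exact: ex_series_decay.
  have H0 : Cmod (match j with O => / 2 | _ => 0 end)%C <= / 2.
    case: j {Hf Hp Hp1 Hq HS} => [|j]; last by rewrite Cmod_0; lra.
    rewrite Cmod_inv; last by apply: RtoC_neq0; lra.
    by rewrite Cmod_R Rabs_pos_eq; lra.
  apply: Rle_trans (Cmod_triangle _ _) _.
  rewrite Cmod_mult Cmod_inv; last by apply: RtoC_neq0; lra.
  rewrite Cmod_R (Rabs_pos_eq 2); last lra.
  set Q := INR (fact j) / (/ 4) ^ j in Hq HS *.
  have -> : (/ 2 + / 2 * ((Cmod z + / 4 + 2) ^ 2 * Series decay)) * INR (fact j) / (/ 4) ^ j =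
    / 2 * Q + / 2 * (Q * ((Cmod z + / 4 + 2) ^ 2 * Series decay)).
    by rewrite /Q; field; lra.
  lra.
Qed.

Lemma analytic_eta (z : C) : 0 <= Re z -> analytic_at (eta_deriv 0) z.
Proof.
  move=> Hz; have [M HM] := Cmod_eta_deriv_le z.
  apply: (analytic_at_taylor eta_deriv z (/ 4) (/ 4) M); try lra.
  - by move=> j s Hs; apply: (CD_eta_deriv z).
  - by move=> j s Hs; apply: HM.
Qed.

Lemma eta_0 : eta_deriv 0 0%C = (/ 2)%C.
Proof.
  rewrite /eta_deriv.
  have -> : cseries (fun m => eta_term 0 m 0%C) = 0%C; last by ring.
  apply: cseries_0 => m; rewrite /eta_term /xpow /Lterm /= !Cmult_0_l !Cexp_0; ring.
Qed.

(** At [s = 0] the differentiated triple is the logarithm of one Wallis factor, so the partial sums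
    are logarithms of [wallis]. *)
Lemma eta_deriv_0 : eta_deriv 1 0%C = RtoC (/ 2 * ln (PI / 2)).
Proof.
  have A : cabs (fun m => eta_term 1 m 0%C) by apply: eta_series_cabs => /=; lra.
  have HPI := PI_RGT_0.
  have E : forall m, eta_term 1 m 0%C =
    RtoC (ln ((2 * INR m + 2) ^ 2 / ((2 * INR m + 1) * (2 * INR m + 3)))).
    move=> m; have Hm := pos_INR m.
    rewrite /eta_term /xpow /Lterm !Cpow_1_r !Cmult_0_l !Cexp_0 !Cmult_1_r.
    rewrite -RtoC_mult -RtoC_minus -RtoC_plus; f_equal.
    rewrite ln_div; [|by apply: pow_lt; lra|nra].
    rewrite ln_pow ?ln_mult; try lra.
    replace (2 * INR m + 1 + 1) with (2 * INR m + 2) by ring.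
    replace (2 * INR m + 1 + 2) with (2 * INR m + 3) by ring.
    rewrite /=; ring.
  have Es : cseries (fun m => eta_term 1 m 0%C) = RtoC (ln (PI / 2)).
    apply: Cis_series_unique; apply/Cis_series_Clim.
    apply: (Clim_ext (fun n => RtoC (ln (wallis (S n))))).
      elim=> [|n IH].
        by rewrite csum_0 E /=; f_equal; f_equal; field.
      rewrite csum_S -IH E -RtoC_plus; f_equal.
      have Hm := pos_INR (S n).
      rewrite [wallis (S (S n))]/= -/(wallis (S n)) -/(INR (S n)) ln_mult //.
        exact: (wallis_pos (S n)).
      by apply: Rdiv_lt_0_compat; nra.
    apply: Clim_R; apply/(is_lim_seq_incr_1 (fun n => ln (wallis n))).
    apply: (is_lim_seq_continuous ln wallis (PI / 2)); last exact: wallis_lim.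
    apply: derivable_continuous_pt; exists (/ (PI / 2)); apply: derivable_pt_lim_ln; lra.
  rewrite /eta_deriv Es RtoC_mult RtoC_inv; [ring|lra].
Qed.

(** * From the Dirichlet series to the eta series *)

Lemma xpow_0_Rpow_C (s : C) (n : nat) : xpow 0 s (INR n) = Rpow_C (INR n) (- s).
Proof. rewrite /xpow /Lterm /Rpow_C /= Cmult_1_l RtoC_opp; f_equal; ring. Qed.

Definition eta_factor (s : C) : C := (1 - 2 * Cexp (s * RtoC (- ln 2)))%C.

Lemma xpow_0_mult (s : C) (x y : R) : 0 < x -> 0 < y ->
  xpow 0 s (x * y) = (xpow 0 s x * xpow 0 s y)%C.
Proof.
  move=> Hx Hy; rewrite /xpow /Lterm /= !Cmult_1_l -Cexp_plus; f_equal.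
  rewrite ln_mult // !RtoC_opp RtoC_plus; ring.
Qed.

(** Both sides are the alternating sum over [1, ..., 2N + 2] plus half of the term at [2N + 3]:
    removing twice the even terms from the Dirichlet sum makes it alternate, and the even terms are
    [2 ^ (- s)] times a shorter Dirichlet sum. *)
Lemma eta_partial_sum (s : C) (N : nat) :
  (/ 2 + / 2 * csum (fun m => eta_term 0 m s) N)%C =
  (csum (fun n => xpow 0 s (INR (S n))) (2 * N + 1)
   - 2 * Cexp (s * RtoC (- ln 2)) * csum (fun n => xpow 0 s (INR (S n))) N
   + / 2 * xpow 0 s (INR (2 * N + 3)))%C.
Proof.
  have E2 : Cexp (s * RtoC (- ln 2)) = xpow 0 s 2 by rewrite /xpow /Lterm /= Cmult_1_l.
  have h2 := two_neq0_C.
  rewrite E2; elim: N => [|N IH].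
    rewrite /= !csum_0 (csum_S _ 0) csum_0 /eta_term /=.
    have -> : xpow 0 s 1 = 1%C.
      by rewrite /xpow /Lterm /= ln_1 Ropp_0 Cmult_0_r Cexp_0; ring.
    replace (2 * 0 + 1) with 1 by ring.
    replace (1 + 1 + 1) with 3 by ring; replace (1 + 2) with 3 by ring.
    replace (1 + 1) with 2 by ring.
    have -> : xpow 0 s 1 = 1%C.
      by rewrite /xpow /Lterm /= ln_1 Ropp_0 Cmult_0_r Cexp_0; ring.
    by field.
  rewrite csum_S Cmult_plus_distr_l Cplus_assoc IH.
  replace (2 * S N + 1)%nat with (S (S (2 * N + 1))) by lia.
  rewrite !csum_S.
  have Hn := pos_INR N.
  have e1 : xpow 0 s (INR (S (S (2 * N + 1)))) = xpow 0 s (2 * INR N + 3).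
    by f_equal; rewrite !(S_INR, plus_INR, mult_INR) /=; ring.
  have e2 : xpow 0 s (INR (S (S (S (2 * N + 1))))) = xpow 0 s (2 * INR N + 4).
    by f_equal; rewrite !(S_INR, plus_INR, mult_INR) /=; ring.
  have e3 : xpow 0 s (INR (2 * N + 3)) = xpow 0 s (2 * INR N + 3).
    by f_equal; rewrite plus_INR mult_INR /=; ring.
  have e4 : xpow 0 s (INR (2 * S N + 3)) = xpow 0 s (2 * INR N + 5).
    by f_equal; rewrite !(S_INR, plus_INR, mult_INR) /=; ring.
  have e5 : xpow 0 s (2 * INR N + 4) = (xpow 0 s 2 * xpow 0 s (INR (S (S N))))%C.
    rewrite -xpow_0_mult; [|lra|by apply: lt_0_INR; lia].
    by f_equal; rewrite !S_INR; ring.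
  have e6 : eta_term 0 (S N) s = (xpow 0 s (2 * INR N + 3) - 2 * xpow 0 s (2 * INR N + 4)
     + xpow 0 s (2 * INR N + 5))%C.
    rewrite /eta_term S_INR.
    replace (2 * (INR N + 1) + 1) with (2 * INR N + 3) by ring.
    replace (2 * INR N + 3 + 1) with (2 * INR N + 4) by ring.
    by replace (2 * INR N + 3 + 2) with (2 * INR N + 5) by ring.
  rewrite e1 e2 e3 e4 e6 e5; field; exact: h2.
Qed.

Lemma zeta_eta (zeta : C -> C) (s : C) : is_riemann_zeta zeta -> 1 < Re s ->
  (eta_factor s * zeta s)%C = eta_deriv 0 s.
Proof.
  move=> [Hz _] Hs.
  have H : Clim (csum (fun n => xpow 0 s (INR (S n)))) (zeta s).
    apply/Cis_series_Clim; apply: Cis_series_ext (proj1 (is_series_C _ _) (Hz s Hs)) => n.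
    by rewrite xpow_0_Rpow_C.
  have H1 := Clim_subseq _ _ (fun N => 2 * N + 1)%nat ltac:(move=> n; simpl; lia) H.
  (* The boundary term is a difference of consecutive partial sums of a convergent series. *)
  have H2 : Clim (fun N => xpow 0 s (INR (2 * N + 3))) 0%C.
    have T := Clim_subseq _ _ (fun N => 2 * N + 2)%nat ltac:(move=> n; simpl; lia) H.
    apply: (Clim_ext (fun N => csum (fun n => xpow 0 s (INR (S n))) (2 * N + 2) +
      (- (1)) * csum (fun n => xpow 0 s (INR (S n))) (2 * N + 1))%C).
      move=> N; replace (2 * N + 2)%nat with (S (2 * N + 1)) by lia.
      rewrite csum_S; replace (2 * N + 3)%nat with (S (S (2 * N + 1))) by lia; ring.
    replace (RtoC 0) with (zeta s + (- (1)) * zeta s)%C by ring.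
    apply: Clim_plus => //; apply: Clim_mult => //; exact: Clim_const.
  apply: (Clim_unique (fun N => / 2 + / 2 * csum (fun m => eta_term 0 m s) N)%C).
  - apply: (Clim_ext _ _ _ (fun N => eq_sym (eta_partial_sum s N))).
    replace (eta_factor s * zeta s)%C with (zeta s + (- (2 * Cexp (s * RtoC (- ln 2)))) * zeta s
      + / 2 * 0)%C by (rewrite /eta_factor; ring).
    apply: Clim_plus; last by apply: Clim_mult => //; exact: Clim_const.
    apply: (Clim_ext (fun N => csum (fun n => xpow 0 s (INR (S n))) (2 * N + 1) +
      (- (2 * Cexp (s * RtoC (- ln 2)))) * csum (fun n => xpow 0 s (INR (S n))) N)%C) => [N|].
      ring.
    apply: Clim_plus => //; apply: Clim_mult => //; exact: Clim_const.
  - rewrite /eta_deriv; apply: Clim_plus; first exact: Clim_const.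
    apply: Clim_mult; first exact: Clim_const.
    apply/Cis_series_Clim; apply: Cis_series_cabs; apply: eta_series_cabs; lra.
Qed.

Definition eta_factor_deriv (j : nat) (s : C) : C :=
  (match j with O => 1 | _ => 0 end - 2 * Lterm j s (RtoC (- ln 2)))%C.

Lemma CD_eta_factor_deriv (j : nat) (s : C) :
  CD (eta_factor_deriv j) s (eta_factor_deriv (S j) s).
Proof.
  apply: CD_minus; first exact: CD_const.
  by apply: CD_scal; apply: CD_Lterm_s.
Qed.

Lemma eta_factor_E (s : C) : eta_factor_deriv 0 s = eta_factor s.
Proof. rewrite /eta_factor_deriv /eta_factor /Lterm /=; ring. Qed.

Lemma ln_2_bound : 0 < ln 2 <= 1.
Proof.
  split; first by rewrite -ln_1; apply: ln_increasing; lra.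
  rewrite -(ln_exp 1); apply: ln_le; first lra.
  have := exp_ineq1 1; lra.
Qed.

Lemma analytic_eta_factor (z : C) : analytic_at eta_factor z.
Proof.
  have [l1 l2] := ln_2_bound.
  have H : analytic_at (eta_factor_deriv 0) z.
    apply: (analytic_at_taylor eta_factor_deriv z 1 1 (1 + 2 * exp (Cmod z + 1))); try lra.
      by move=> j s _; apply: CD_eta_factor_deriv.
    move=> j s Hs; rewrite pow1.
    have Hf := INR_fact_ge1 j.
    apply: (Rle_trans _ (1 + 2 * exp (Cmod z + 1))); last first.
      have := exp_pos (Cmod z + 1); move=> He.
      have -> : (1 + 2 * exp (Cmod z + 1)) * INR (fact j) / 1 = (1 + 2 * exp (Cmod z + 1)) * INR (fact j)
        by field.
      nra.
    apply: Rle_trans (Cmod_triangle _ _) _; rewrite Cmod_opp.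
    apply: Rplus_le_compat; first by case: j {Hf} => [|j]; rewrite ?Cmod_1 ?Cmod_0; lra.
    rewrite Cmod_scal_R; last lra.
    apply: Rmult_le_compat_l; first lra.
    rewrite /Lterm Cmod_mult Cmod_pow Cmod_R Rabs_Ropp Rabs_pos_eq; last lra.
    rewrite -(Rmult_1_l (exp _)) Cmod_Cexp; apply: Rmult_le_compat.
    - by apply: pow_le; lra.
    - by apply: Rlt_le; apply: exp_pos.
    - by rewrite -(pow1 j); apply: pow_incr; lra.
    - apply: exp_le_compat; apply: Rle_trans (Rle_abs _) _.
      apply: Rle_trans (re_le_Cmod _) _.
      rewrite Cmod_mult Cmod_R Rabs_Ropp Rabs_pos_eq; last lra.
      have := ball_Cmod z s 1 Hs; have := Cmod_ge_0 s; nra.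
  have [a [r Ha]] := H; exists a, r => h Hh.
  by rewrite -eta_factor_E; apply: Ha.
Qed.

Lemma zeta_near_0 (zeta : C -> C) : is_riemann_zeta zeta ->
  exists d, 0 < d /\ forall s, Cmod s < d -> (eta_factor s * zeta s)%C = eta_deriv 0 s.
Proof.
  move=> Hzeta.
  pose f s := (eta_factor s * zeta s - eta_deriv 0 s)%C.
  (* The points [(1 - t) * (2 + i)] are real only at 0, so the segment misses the pole at 1; the
     unit disc around its start lies in [Re s > 1], where [zeta_eta] holds. *)
  pose p := (2, 1) : C.
  have Hv : (- p)%C <> 0%C by move=> [E _]; lra.
  have [||d [Hd H]] := identity_theorem_segment f p (- p)%C Hv.
  - move=> t Ht.
    have E : (p + t * - p)%C = ((1 - t) * 2, 1 - t) :> C.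
      by apply: injective_projections => /=; ring.
    apply: analytic_at_minus; last by apply: analytic_eta; rewrite E /=; lra.
    apply: analytic_at_mult; first exact: analytic_eta_factor.
    apply: (proj2 Hzeta); rewrite E => [[E1 E2]]; lra.
  - exists 1; split; first lra.
    move=> w Hw; rewrite /f zeta_eta //; first ring.
    by have := ball_Re p w; rewrite [Re p]/=; lra.
  - exists d; split=> // s Hs; apply: Csub_eq0; apply: H.
    by replace (s - (p + - p))%C with s by ring.
Qed.

Lemma eta_factor_0 : eta_factor 0%C = (- (1))%C.
Proof. rewrite /eta_factor Cmult_0_l Cexp_0; ring. Qed.

(** Near 0, zeta is the quotient of the eta series by [eta_factor], whose value -1 at 0 keeps the
    quotient smooth. The quotient rule combines the Wallis value [/ 2 * ln (PI / 2)] with the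
    derivative [2 * ln 2] of the factor. *)
Theorem zeta_at_0 (zeta : C -> C) : is_riemann_zeta zeta ->
  exists d, 0 < d /\ smooth 0%C d zeta /\ zeta 0%C = RtoC (- / 2) /\
    CD zeta 0%C (RtoC (- (/ 2 * ln (2 * PI)))).
Proof.
  move=> Hzeta.
  have [d1 [Hd1 H1]] := zeta_near_0 zeta Hzeta.
  have C0 : ccont eta_factor 0%C.
    apply: CD_ccont; apply: (CD_ext _ _ _ _ eta_factor_E); exact: CD_eta_factor_deriv.
  have N0 : eta_factor 0%C <> 0%C.
    by rewrite eta_factor_0 => [[E]]; lra.
  have [d2 [Hd2 H2]] := ccont_neq0 _ _ C0 N0.
  pose d := Rmin d1 (Rmin d2 (/ 4)).
  have Hd : 0 < d by apply: Rmin_pos => //; apply: Rmin_pos; lra.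
  have le1 : d <= d1 := Rmin_l _ _.
  have le2 : d <= d2 := Rle_trans _ _ _ (Rmin_r _ _) (Rmin_l _ _).
  have le3 : d <= / 4 := Rle_trans _ _ _ (Rmin_r _ _) (Rmin_r _ _).
  have nz : forall s, Cmod (s - 0) < d -> eta_factor s <> 0%C.
    move=> s Hs; apply: Cmod_pos_neq0; have := H2 s ltac:(lra); have := Cmod_ge_0 (eta_factor 0%C); lra.
  have Ez : forall s, Cmod (s - 0) < d -> (eta_deriv 0 s * / eta_factor s)%C = zeta s.
    move=> s Hs; rewrite -H1; first by field; apply: nz.
    by replace s with (s - 0)%C by ring; lra.
  have S1 : smooth 0%C d (eta_deriv 0).
    apply: smooth_dseq => j z Hz; apply: (CD_eta_deriv 0%C); rewrite /=; lra.
  have S2 : smooth 0%C d eta_factor.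
    apply: (smooth_ext _ _ _ _ (fun w _ => eta_factor_E w)).
    by apply: smooth_dseq => j z _; apply: CD_eta_factor_deriv.
  have B0 : Cmod (0 - 0)%C < d by rewrite Cmod_self_minus.
  exists d; split=> //; split.
    apply: smooth_ext Ez _; apply: smooth_mult => //; exact: smooth_inv.
  split.
    rewrite -Ez // eta_0 eta_factor_0 RtoC_opp RtoC_inv; last lra.
    by field; apply: RtoC_neq0; lra.
  apply: (CD_ext_ball _ _ _ _ _ _ Ez B0).
  have D1 : CD eta_factor 0%C (eta_factor_deriv 1 0%C).
    by apply: (CD_ext _ _ _ _ eta_factor_E); apply: CD_eta_factor_deriv.
  have D2 : CD (eta_deriv 0) 0%C (eta_deriv 1 0%C).
    by apply: (CD_eta_deriv 0%C); rewrite ?Cmod_self_minus /=; lra.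
  apply: CD_eq (CD_mult _ _ _ _ _ D2 (CD_inv _ _ _ D1 N0)).
  rewrite eta_0 eta_deriv_0 eta_factor_0.
  have -> : eta_factor_deriv 1 0%C = RtoC (2 * ln 2).
    rewrite /eta_factor_deriv /Lterm Cpow_1_r Cmult_0_l Cexp_0 RtoC_mult RtoC_opp; ring.
  have HPI := PI_RGT_0.
  have -> : - (/ 2 * ln (2 * PI)) = - (/ 2 * ln (PI / 2)) - / 2 * (2 * ln 2).
    rewrite ln_mult ?ln_div; try lra; field.
  rewrite RtoC_minus RtoC_opp (RtoC_mult (/ 2) (2 * ln 2)) RtoC_inv; last lra.
  have h1 : (- (1))%C <> 0%C by move=> [E]; lra.
  have h2 := two_neq0_C.
  by field.
Qed.

(** * The Gamma function near 1 *)

(** Taylor terms of the principal [Log (1 + z)]; the series avoids any choice of branch. It is used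
    for [|z| < 3/4], a radius below 1 that exceeds 5/8, the bound of [|(1 - s) / 2|] for
    [|s| < 1/4]. *)
Definition Log1p_term (k : nat) (z : C) : C := (/ INR (S k) * (- (Cpow (- z) (S k))))%C.

Definition Log1p (z : C) : C := cseries (fun k => Log1p_term k z).

Lemma CD_neg_pow (k : nat) (z : C) :
  CD (fun z => Cpow (- z) k)%C z (- (INR k * Cpow (- z) (pred k)))%C.
Proof.
  apply: CD_eq (CD_pow _ _ _ k (CD_opp _ _ _ (CD_id z))); ring.
Qed.

Lemma INR_S_neq0_C (k : nat) : RtoC (INR (S k)) <> 0%C.
Proof. by apply: RtoC_neq0; apply: not_0_INR. Qed.

Lemma cseries_geom (z : C) : Cmod z < 1 -> cseries (fun k => Cpow z k) = (/ (1 - z))%C.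
Proof.
  move=> Hz.
  have A : cabs (fun k => Cpow z k).
    apply: (cabs_le _ (fun k => Cmod z ^ k)); first by move=> n; rewrite Cmod_pow; lra.
    by apply: ex_series_geom; rewrite Rabs_pos_eq //; exact: Cmod_ge_0.
  have N : (1 - z)%C <> 0%C.
    move=> E; have : z = 1%C by rewrite -(Csub_eq0 _ _ E).
    by move=> E1; rewrite E1 Cmod_1 in Hz; lra.
  have E := cseries_first _ A.
  rewrite /= cseries_scal // in E.
  set G := cseries _ in E *.
  have {}E : G = (1 + z * G)%C := E.
  have E' : (G * (1 - z) = 1)%C.
    by transitivity (G - z * G)%C; [ring|rewrite {1}E; ring].
  transitivity (G * (1 - z) / (1 - z))%C; first by field.
  by rewrite E' /Cdiv Cmult_1_l.
Qed.

Lemma CD_Log1p (z : C) : Cmod z < 3 / 4 -> CD Log1p z (/ (1 + z))%C.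
Proof.
  move=> Hz.
  have Hz0 : Cmod (z - 0) < 3 / 4 by replace (z - 0)%C with z by ring.
  have geo : forall q, 0 <= q < 1 -> ex_series (fun k => q ^ k).
    by move=> q Hq; apply: ex_series_geom; rewrite Rabs_pos_eq; lra.
  have pow34 : forall w n, Cmod (w - 0) < 3 / 4 -> Cmod (Cpow (- w) n) <= (3 / 4) ^ n.
    move=> w n Hw; rewrite Cmod_pow Cmod_opp; apply: pow_incr; split; first exact: Cmod_ge_0.
    by replace w with (w - 0)%C by ring; lra.
  have -> : (/ (1 + z))%C = cseries (fun k => Cpow (- z) k).
    by rewrite cseries_geom ?Cmod_opp; [f_equal; ring|lra].
  apply: (CD_cseries Log1p_term (fun k z => Cpow (- z) k)
    (fun k z => - (INR k * Cpow (- z) (pred k)))%C (fun k => 11 * (7 / 8) ^ k) 0%C (3 / 4)) => //.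
  - move=> k w Hw; split; last split.
    + apply: CD_eq (CD_scal _ _ _ _ (CD_opp _ _ _ (CD_neg_pow (S k) w))).
      rewrite [pred _]/=; field; exact: INR_S_neq0_C.
    + exact: CD_neg_pow.
    + rewrite Cmod_opp Cmod_mult Cmod_R Rabs_pos_eq; last exact: pos_INR.
      case: k => [|k]; first by rewrite /= Rmult_0_l; lra.
      rewrite [pred _]/=.
      have P := pow34 w k Hw; have Hk := pos_INR (S k).
      apply: Rle_trans (Rmult_le_compat_l _ _ _ Hk P) _.
      (* Since [7/8 = 3/4 * 7/6], Bernoulli's [(1 + 1/6) ^ k >= 1 + k/6] absorbs the linear factor;
         11 is a constant large enough for this. *)
      have -> : (7 / 8) ^ S k = 7 / 8 * ((3 / 4) ^ k * (1 + / 6) ^ k).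
        by rewrite -Rpow_mult_distr /=; f_equal; f_equal; lra.
      have Bern := poly k (/ 6) ltac:(lra).
      have P0 : 0 < (3 / 4) ^ k by apply: pow_lt; lra.
      rewrite S_INR; have := pos_INR k; nra.
  - by apply: ex_series_scal_R; apply: geo; lra.
  - move=> w Hw; apply: (cabs_le _ (fun k => (3 / 4) ^ k)); last by apply: geo; lra.
    move=> k; rewrite Cmod_mult Cmod_opp Cmod_inv; last exact: INR_S_neq0_C.
    rewrite Cmod_R Rabs_pos_eq; last exact: pos_INR.
    have P := pow34 w (S k) Hw.
    have P0 : 0 < (3 / 4) ^ k by apply: pow_lt; lra.
    have [Hk0 Hk] := inv_INR_S_bounds k.
    have := Cmod_ge_0 (Cpow (- w) (S k)); rewrite [(3 / 4) ^ S k]/= in P; nra.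
  - move=> w Hw; apply: (cabs_le _ (fun k => (3 / 4) ^ k)); last by apply: geo; lra.
    by move=> k; apply: pow34.
Qed.

Lemma Log1p_0 : Log1p 0%C = 0%C.
Proof. by apply: cseries_0 => k; rewrite /Log1p_term /=; ring. Qed.

(** The quotient of the two sides has derivative 0, so the mean value inequality with bound 0 makes
    it equal to its value 1 at 0. *)
Lemma Cexp_Log1p (z : C) : Cmod z < 3 / 4 -> Cexp (Log1p z) = (1 + z)%C.
Proof.
  move=> Hz.
  have nz : forall w, Cmod (w - 0) < 3 / 4 -> (1 + w)%C <> 0%C.
    move=> w Hw; apply: Cmod_pos_neq0.
    have := Cmod_triangle_sub 1%C (1 + w)%C; rewrite Cmod_1.
    replace (1 - (1 + w))%C with (- (w - 0))%C by ring; rewrite Cmod_opp; lra.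
  have Hz0 : Cmod (z - 0) < 3 / 4 by replace (z - 0)%C with z by ring.
  have H0 : Cmod (0 - 0) < 3 / 4 by rewrite Cmod_self_minus; lra.
  have M := MVI_ball (fun w => Cexp (Log1p w) / (1 + w))%C (fun _ => 0%C) 0%C 0%C z (3 / 4) 0 H0 Hz0.
  have {M}M : Cmod (Cexp (Log1p z) / (1 + z) - Cexp (Log1p 0) / (1 + 0)) <= 0 * Cmod (z - 0).
    apply: M => w Hw; split; last by rewrite Cmod_0; lra.
    have Hw' : Cmod w < 3 / 4 by replace w with (w - 0)%C by ring.
    have N := nz w Hw.
    apply: CD_eq (CD_div _ _ _ _ _ (CD_Cexp_comp _ _ _ (CD_Log1p w Hw'))
      (CD_plus _ _ _ _ _ (CD_const 1%C w) (CD_id w)) N).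
    by field.
  rewrite Rmult_0_l Log1p_0 Cexp_0 in M.
  have E := Csub_eq0 _ _ (Cmod_eq_0 _ (Rle_antisym _ _ M (Cmod_ge_0 _))).
  have N := nz z Hz0; have N1 : (1 + 0)%C <> 0%C by move=> [E1]; lra.
  transitivity ((1 + z) * (Cexp (Log1p z) / (1 + z)))%C; first by field.
  by rewrite E; field.
Qed.

(* Derivatives in [w] of [w ln ((j+2)/(j+1)) - Log (1 + w/(j+1))], whose sum
   over [j] is the logarithm of Euler's product for [Gamma (1 + w)]. *)
Definition lgam_term (i j : nat) (w : C) : C :=
  match i with
  | O => (w * RtoC (ln (INR (S (S j))) - ln (INR (S j))) - Log1p (w * / INR (S j)))%C
  | S i' => ((match i' with O => RtoC (ln (INR (S (S j))) - ln (INR (S j))) | _ => 0 end)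
             + (- (1)) ^ i * INR (fact i') * Cpow (/ (INR (S j) + w)) i)%C
  end.

Lemma lgam_denom (j : nat) (w : C) : Cmod (w - 0) < 3 / 4 ->
  INR (S j) / 4 <= Cmod (INR (S j) + w).
Proof.
  move=> Hw; have Hj := pos_INR j.
  have := Cmod_triangle_sub (INR (S j)) (INR (S j) + w)%C.
  replace (INR (S j) - (INR (S j) + w))%C with (- (w - 0))%C by ring.
  rewrite Cmod_opp Cmod_R Rabs_pos_eq; last exact: pos_INR.
  rewrite S_INR; lra.
Qed.

Lemma lgam_denom_neq0 (j : nat) (w : C) : Cmod (w - 0) < 3 / 4 -> (INR (S j) + w)%C <> 0%C.
Proof.
  move=> Hw; apply: Cmod_pos_neq0; have := lgam_denom j w Hw.
  rewrite S_INR; have := pos_INR j; lra.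
Qed.

Lemma Cmod_div_INR_S (j : nat) (w : C) : Cmod w < 3 / 4 -> Cmod (w * / INR (S j)) < 3 / 4.
Proof.
  move=> Hw; rewrite Cmod_mult Cmod_inv; last exact: INR_S_neq0_C.
  rewrite Cmod_R Rabs_pos_eq; last exact: pos_INR.
  have [Hk0 Hk] := inv_INR_S_bounds j.
  have := Cmod_ge_0 w; nra.
Qed.

Lemma CD_lgam_term (i j : nat) (w : C) : Cmod (w - 0) < 3 / 4 ->
  CD (lgam_term i j) w (lgam_term (S i) j w).
Proof.
  move=> Hw; have N := lgam_denom_neq0 j w Hw.
  have Nj := INR_S_neq0_C j.
  have Hw' : Cmod w < 3 / 4 by replace w with (w - 0)%C by ring.
  have D1 : CD (fun w => INR (S j) + w)%C w 1%C.
    apply: CD_eq (CD_plus _ _ _ _ _ (CD_const (RtoC (INR (S j))) w) (CD_id w)); ring.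
  case: i => [|i].
    set K := RtoC (ln (INR (S (S j))) - ln (INR (S j))).
    have D2 : CD (fun w => w * / INR (S j))%C w (/ INR (S j))%C.
      apply: CD_eq (CD_mult _ _ _ _ _ (CD_id w) (CD_const (/ INR (S j))%C w)); ring.
    have D3 : CD (fun w => w * K)%C w K.
      apply: CD_eq (CD_mult _ _ _ _ _ (CD_id w) (CD_const K w)); ring.
    apply: CD_eq (CD_minus _ _ _ _ _ D3 (CD_comp _ _ _ _ _ D2 (CD_Log1p _ (Cmod_div_INR_S j w Hw')))).
    rewrite /lgam_term -/K [fact 0]/= [INR 1]/= !Cpow_1_r.
    by field; split.
  pose K := match i with O => RtoC (ln (INR (S (S j))) - ln (INR (S j))) | _ => RtoC 0 end.
  apply: (CD_ext (fun w => K + ((- (1)) ^ (S i) * INR (fact i)) * Cpow (/ (INR (S j) + w)) (S i))%C) => [u|].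
    by [].
  apply: CD_eq (CD_plus _ _ _ _ _ (CD_const K w)
    (CD_scal ((- (1)) ^ (S i) * INR (fact i))%C _ _ _ (CD_pow _ _ _ (S i) (CD_inv _ _ _ D1 N)))).
  rewrite [pred _]/= /lgam_term.
  rewrite INR_fact_S_C.
  rewrite !Cpow_S; ring.
Qed.

(** Both bounds are instances of [1 + y <= exp y]. They show that the logarithmic increment in
    [lgam_term] compensates [/ x] up to [/ x ^ 2], which is why Euler's product converges. *)
Lemma ln_incr_bounds (x : R) : 0 < x -> / x - / (x * x) <= ln (x + 1) - ln x <= / x.
Proof.
  move=> Hx; split.
  - apply: (Rle_trans _ (/ (x + 1))).
      apply: (Rmult_le_reg_r (x * x * (x + 1))); first nra.
      have -> : (/ x - / (x * x)) * (x * x * (x + 1)) = x * x - 1 by field; lra.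
      have -> : / (x + 1) * (x * x * (x + 1)) = x * x by field; lra.
      lra.
    suff : ln x - ln (x + 1) <= - / (x + 1) by lra.
    rewrite -ln_div; try lra.
    have -> : x / (x + 1) = 1 + - / (x + 1) by field; lra.
    have H : / (x + 1) < 1.
      rewrite -Rinv_1; apply: Rinv_lt_contravar; lra.
    rewrite -{2}(ln_exp (- / (x + 1))); apply: ln_le; first lra.
    have [E|E] := Req_dec (- / (x + 1)) 0; first by rewrite E exp_0; lra.
    by apply: Rlt_le; apply: exp_ineq1.
  - rewrite -ln_div; try lra.
    have -> : (x + 1) / x = 1 + / x by field; lra.
    have H : 0 < / x by apply: Rinv_0_lt_compat.
    rewrite -{2}(ln_exp (/ x)); apply: ln_le; first lra.
    by apply: Rlt_le; apply: exp_ineq1; lra.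
Qed.

Lemma inv_sqr_le_decay (j : nat) : / (INR (S j) * INR (S j)) <= decay j.
Proof.
  rewrite /decay -S_INR; have Hj : 1 <= INR (S j) by rewrite S_INR; have := pos_INR j; lra.
  have Hl : 0 <= ln (INR (S j)) by rewrite -ln_1; apply: ln_le; lra.
  have E : / (INR (S j) * INR (S j)) = exp (- (2 * ln (INR (S j)))).
    rewrite exp_Ropp; f_equal.
    have -> : 2 * ln (INR (S j)) = ln (INR (S j)) + ln (INR (S j)) by ring.
    by rewrite exp_plus exp_ln //; lra.
  rewrite E; apply: exp_le_compat; lra.
Qed.

Definition lgam_bound (i : nat) : R := 4 + INR (fact (pred i)) * 4 ^ i.

(** With [x = j + 1], the term splits into the increment minus [/ x], at most [/ x ^ 2], and
    [/ x - / (x + w) = w / (x * (x + w))], at most [3 / x ^ 2] because [|x + w| >= x / 4]. *)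
Lemma Cmod_lgam_term1_le (j : nat) (w : C) : Cmod (w - 0) < 3 / 4 ->
  Cmod (lgam_term 1 j w) <= 4 * / (INR (S j) * INR (S j)).
Proof.
  move=> Hw; have N := lgam_denom_neq0 j w Hw; have D := lgam_denom j w Hw.
  have Hj : 1 <= INR (S j) by rewrite S_INR; have := pos_INR j; lra.
  have [b1 b2] := ln_incr_bounds (INR (S j)) ltac:(lra).
  rewrite -S_INR in b1 b2.
  set x := INR (S j) in N D Hj b1 b2 *.
  have Nx : RtoC x <> 0%C by apply: RtoC_neq0; lra.
  have -> : lgam_term 1 j w = (RtoC (ln (INR (S (S j))) - ln x - / x) + w * / (x * (x + w)))%C.
    rewrite /lgam_term -/x [fact 0]/= [INR 1]/= !Cpow_1_r (RtoC_minus (_ - _)) RtoC_inv; last lra.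
    by field; split.
  apply: Rle_trans (Cmod_triangle _ _) _.
  have P : 0 < / (x * x) by apply: Rinv_0_lt_compat; nra.
  have -> : 4 * / (x * x) = / (x * x) + 3 * / (x * x) by ring.
  apply: Rplus_le_compat.
    by rewrite Cmod_R; apply: Rabs_le; lra.
  rewrite Cmod_mult Cmod_inv; last by apply: Cmult_neq_0.
  rewrite Cmod_mult Cmod_R (Rabs_pos_eq x); last lra.
  have Hw' : Cmod w < 3 / 4 by replace w with (w - 0)%C by ring.
  apply: (Rle_trans _ (3 / 4 * / (x * (x / 4)))).
    apply: Rmult_le_compat; [exact: Cmod_ge_0| |lra|].
      by apply: Rlt_le; apply: Rinv_0_lt_compat; apply: Rmult_lt_0_compat; lra.
    apply: Rinv_le_contravar; first nra.
    apply: Rmult_le_compat_l; lra.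
  by apply: Req_le; field; lra.
Qed.

(** Order 0 is integrated from order 1, since the term vanishes at [w = 0]; orders 2 and above decay
    by themselves. *)
Lemma Cmod_lgam_term_le (i j : nat) (w : C) : Cmod (w - 0) < 3 / 4 ->
  Cmod (lgam_term i j w) <= lgam_bound i * decay j.
Proof.
  move=> Hw; have N := lgam_denom_neq0 j w Hw; have D := lgam_denom j w Hw.
  have Hd := inv_sqr_le_decay j.
  have Hj : 1 <= INR (S j) by rewrite S_INR; have := pos_INR j; lra.
  have P : 0 < / (INR (S j) * INR (S j)) by apply: Rinv_0_lt_compat; nra.
  have HK : forall i, 4 <= lgam_bound i.
    move=> i'; rewrite /lgam_bound; have := INR_fact_lt_0 (pred i').
    have : 0 < 4 ^ i' by apply: pow_lt; lra.
    nra.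
  case: i => [|[|i]].
  - have H0 : Cmod (0 - 0) < 3 / 4 by rewrite Cmod_self_minus; lra.
    have M := MVI_ball (lgam_term 0 j) (lgam_term 1 j) 0%C 0%C w (3 / 4)
      (4 * / (INR (S j) * INR (S j))) H0 Hw.
    have {M}M : Cmod (lgam_term 0 j w - lgam_term 0 j 0) <=
      4 * / (INR (S j) * INR (S j)) * Cmod (w - 0).
      by apply: M => z Hz; split; [apply: CD_lgam_term|apply: Cmod_lgam_term1_le].
    have E0 : lgam_term 0 j 0%C = 0%C.
      rewrite /lgam_term !Cmult_0_l Log1p_0; ring.
    rewrite E0 in M; replace (lgam_term 0 j w - 0)%C with (lgam_term 0 j w) in M by ring.
    apply: Rle_trans M _; have := HK 0%nat; have := Cmod_ge_0 (w - 0); nra.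
  - apply: Rle_trans (Cmod_lgam_term1_le j w Hw) _; have := HK 1%nat; nra.
  - rewrite /lgam_term Cplus_0_l !Cmod_mult Cmod_pow Cmod_opp Cmod_1 pow1 Rmult_1_l.
    rewrite Cmod_R Rabs_pos_eq; last exact: pos_INR.
    rewrite Cmod_pow Cmod_inv //.
    set x := INR (S j) in Hd P Hj N D *.
    have Hq : / Cmod (x + w) <= 4 * / x.
      have -> : 4 * / x = / (x / 4) by field; lra.
      apply: Rinv_le_contravar => //; lra.
    have Hq0 : 0 < / Cmod (x + w) by apply: Rinv_0_lt_compat; lra.
    have Hp : (/ Cmod (x + w)) ^ S (S i) <= 4 ^ S (S i) * / (x * x).
      apply: (Rle_trans _ ((4 * / x) ^ S (S i))).
        by apply: pow_incr; lra.
      rewrite Rpow_mult_distr; apply: Rmult_le_compat_l; first by apply: pow_le; lra.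
      have -> : (/ x) ^ S (S i) = / (x * x) * (/ x) ^ i by rewrite /=; field; lra.
      rewrite -{2}(Rmult_1_r (/ (x * x))); apply: Rmult_le_compat_l; first lra.
      rewrite -(pow1 i); apply: pow_incr; split.
        by apply: Rlt_le; apply: Rinv_0_lt_compat; lra.
      rewrite -Rinv_1; apply: Rinv_le_contravar; lra.
    rewrite /lgam_bound [pred _]/=.
    have Hf : 0 < INR (fact (S i)) := INR_fact_lt_0 _.
    have H4 : 0 < 4 ^ S (S i) by apply: pow_lt; lra.
    rewrite !Rmult_1_l; apply: Rle_trans (Rmult_le_compat_l _ _ _ (Rlt_le _ _ Hf) Hp) _.
    have : 4 ^ S (S i) * / (x * x) <= 4 ^ S (S i) * decay j by apply: Rmult_le_compat_l; lra.
    move: (4 ^ S (S i)) (INR (fact (S i))) H4 Hf => a b Ha Hb H.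
    have : b * (a * / (x * x)) <= b * (a * decay j) by apply: Rmult_le_compat_l; lra.
    lra.
Qed.

Definition lgam (i : nat) (w : C) : C := cseries (fun j => lgam_term i j w).

Lemma lgam_cabs (i : nat) (w : C) : Cmod (w - 0) < 3 / 4 -> cabs (fun j => lgam_term i j w).
Proof.
  move=> Hw; apply: (cabs_le _ (fun j => lgam_bound i * decay j)).
    by move=> j; apply: Cmod_lgam_term_le.
  apply: ex_series_scal_R; exact: ex_series_decay.
Qed.

Lemma CD_lgam (i : nat) (w : C) : Cmod (w - 0) < 3 / 4 -> CD (lgam i) w (lgam (S i) w).
Proof.
  apply: (cseries_dseq lgam_term (fun i j => lgam_bound i * decay j)).
  - by move=> *; apply: CD_lgam_term.
  - by move=> *; apply: Cmod_lgam_term_le.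
  - move=> k; apply: ex_series_scal_R; exact: ex_series_decay.
Qed.

(** This is [Gamma (1 + w)]; as an exponential it is visibly without zeros, and [lgam 1 w] is the
    digamma function at [1 + w]. *)
Definition gam1 (w : C) : C := Cexp (lgam 0 w).

Lemma smooth_comp_Cexp (c : C) (r : R) (f : C -> C) : smooth c r f ->
  smooth c r (fun z => Cexp (f z)).
Proof.
  move=> Hf n; elim: n => [|n IH] //.
  apply: (Cn_intro _ _ _ _ (fun z => Cexp (f z) * C_derive f z)%C).
    by move=> z Hz; apply: CD_Cexp_comp; apply: smooth_CD Hz.
  by apply: Cn_mult => //; apply: smooth_derive.
Qed.

Lemma smooth_gam1 : smooth 0%C (3 / 4) gam1.
Proof.
  apply: smooth_comp_Cexp; apply: smooth_dseq => i z Hz; exact: CD_lgam.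
Qed.

Lemma gam1_neq0 (w : C) : gam1 w <> 0%C.
Proof. exact: Cexp_neq0. Qed.

Lemma CD_gam1 (w : C) : Cmod (w - 0) < 3 / 4 -> CD gam1 w (gam1 w * lgam 1 w)%C.
Proof. by move=> Hw; apply: CD_Cexp_comp; apply: CD_lgam. Qed.

(** * Euler's limit and the exponential of [lgam] *)

Lemma Cprod_app {I : Type} (f : I -> C) (l1 l2 : list I) :
  Cprod f (l1 ++ l2) = (Cprod f l1 * Cprod f l2)%C.
Proof. elim: l1 => [|i l1 IH] /=; [ring|rewrite IH; ring]. Qed.

Lemma Cprod_seq_S (f : nat -> C) (n : nat) :
  Cprod f (seq 0 (S n)) = (Cprod f (seq 0 n) * f n)%C.
Proof. rewrite seq_S Cprod_app /=; ring. Qed.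

Definition euler_gam (s : C) (n : nat) : C :=
  (INR (fact n) * Rpow_C (INR n) s / Cprod (fun j : nat => s + INR j) (seq 0 (S n)))%C.

(** The exponential of the [j]-th term is [((j + 2) / (j + 1)) ^ w * (j + 1) / (j + 1 + w)]; the
    powers telescope and the numerators form the factorial. *)
Lemma lgam_partial_sum (w : C) (N : nat) : Cmod (w - 0) < 3 / 4 ->
  (Cexp (csum (fun j => lgam_term 0 j w) N) * Cprod (fun j : nat => 1 + w + INR j) (seq 0 (S N)))%C
  = (INR (fact (S N)) * Cexp (w * ln (INR (S (S N)))))%C.
Proof.
  move=> Hw.
  have Hw' : Cmod w < 3 / 4 by replace w with (w - 0)%C by ring.
  have step : forall j, (Cexp (lgam_term 0 j w) * (1 + w + INR j))%C =
     (INR (S j) * Cexp (w * ln (INR (S (S j)))) * Cexp (- (w * ln (INR (S j)))))%C.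
    move=> j; rewrite /lgam_term.
    have Nj := INR_S_neq0_C j; have Nw := lgam_denom_neq0 j w Hw.
    have -> : (w * RtoC (ln (INR (S (S j))) - ln (INR (S j))) - Log1p (w * / INR (S j)))%C =
      (w * ln (INR (S (S j))) + - (w * ln (INR (S j))) + - Log1p (w * / INR (S j)))%C.
      by rewrite RtoC_minus; ring.
    rewrite !Cexp_plus (Cexp_opp (Log1p _)) Cexp_Log1p; last exact: Cmod_div_INR_S.
    have -> : (1 + w * / INR (S j))%C = ((INR (S j) + w) / INR (S j))%C by field.
    have -> : (1 + w + INR j)%C = (INR (S j) + w)%C by rewrite S_INR RtoC_plus; ring.
    by field.
  elim: N => [|N IH].
    rewrite csum_0 Cprod_seq_S [Cprod _ _]/= Cmult_1_l step !INR_1 ln_1.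
    have -> : (- (w * 0))%C = 0%C by ring.
    by rewrite Cexp_0; ring.
  rewrite csum_S Cexp_plus Cprod_seq_S.
  transitivity ((Cexp (csum (fun j => lgam_term 0 j w) N) *
    Cprod (fun j : nat => 1 + w + INR j) (seq 0 (S N))) *
    (Cexp (lgam_term 0 (S N) w) * (1 + w + INR (S N))))%C; first ring.
  rewrite IH step (INR_fact_S_C (S N)) Cexp_opp; field; exact: Cexp_neq0.
Qed.

Lemma Cprod_neq0 {I : Type} (f : I -> C) (l : list I) :
  (forall i, In i l -> f i <> 0%C) -> Cprod f l <> 0%C.
Proof.
  elim: l => [|i l IH] H /=; first by move=> [E]; lra.
  apply: Cmult_neq_0; first by apply: H; left.
  by apply: IH => k Hk; apply: H; right.
Qed.

(** Euler's expression is the exponential of a partial sum of [lgam 0 w] times two corrections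
    tending to 1: [((N + 1) / (N + 2)) ^ w], since the partial sum runs one step further, and
    [(N + 1) / (N + 2 + w)], the last denominator. *)
Lemma Clim_euler_gam_1 (w : C) : Cmod (w - 0) < 3 / 4 ->
  Clim (euler_gam (1 + w)%C) (gam1 w).
Proof.
  move=> Hw.
  have Hw' : Cmod w < 3 / 4 by replace w with (w - 0)%C by ring.
  have Nf : forall j : nat, (1 + w + INR j)%C <> 0%C.
    move=> j; replace (1 + w + INR j)%C with (INR (S j) + w)%C.
      exact: lgam_denom_neq0.
    by rewrite S_INR RtoC_plus; ring.
  have key : forall N, euler_gam (1 + w)%C (S N) =
    (Cexp (csum (fun j => lgam_term 0 j w) N) *
     (Cexp (RtoC (ln (INR (S N)) - ln (INR (S (S N)))) * w) *
      (1 + (- (1 + w)) * / (1 + w + INR (S N)))))%C.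
    move=> N; rewrite /euler_gam Cprod_seq_S.
    have P := lgam_partial_sum w N Hw.
    have NP : Cprod (fun j : nat => 1 + w + INR j)%C (seq 0 (S N)) <> 0%C.
      by apply: Cprod_neq0 => j _; apply: Nf.
    have NS := Nf (S N).
    have E1 := Cexp_neq0 (w * ln (INR (S (S N)))).
    have -> : Cexp (csum (fun j => lgam_term 0 j w) N) =
      (INR (fact (S N)) * Cexp (w * ln (INR (S (S N)))) /
        Cprod (fun j : nat => 1 + w + INR j) (seq 0 (S N)))%C.
      by rewrite -P; field.
    have -> : Cexp (RtoC (ln (INR (S N)) - ln (INR (S (S N)))) * w) =
      (Cexp (w * ln (INR (S N))) / Cexp (w * ln (INR (S (S N)))))%C.
      rewrite /Cdiv -Cexp_opp -Cexp_plus; f_equal; rewrite RtoC_minus; ring.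
    have -> : Rpow_C (INR (S N)) (1 + w) = (INR (S N) * Cexp (w * ln (INR (S N))))%C.
      rewrite /Rpow_C; have -> : ((1 + w) * ln (INR (S N)) = ln (INR (S N)) + w * ln (INR (S N)))%C by ring.
      rewrite Cexp_plus Cexp_R exp_ln //; apply: lt_0_INR; lia.
    field; repeat split=> //.
  (* Index 0 is discarded, since its power involves the logarithm of 0. *)
  suff : Clim (fun N => euler_gam (1 + w)%C (S N)) (gam1 w).
    move=> H eps /H [N HN]; exists (S N) => [[|n]] Hn; first by lia.
    by apply: HN; lia.
  apply: (Clim_ext _ _ _ (fun N => eq_sym (key N))).
  have -> : gam1 w = (gam1 w * (Cexp (0 * w) * (1 + (- (1 + w)) * 0)))%C.
    by rewrite Cmult_0_l Cexp_0; ring.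
  apply: Clim_mult.
    apply: (Clim_ccont Cexp); first exact: CD_ccont (CD_Cexp _).
    by apply/Cis_series_Clim; apply: Cis_series_cabs; apply: lgam_cabs.
  apply: Clim_mult.
    apply: (Clim_ccont Cexp (fun N => RtoC (ln (INR (S N)) - ln (INR (S (S N)))) * w)%C).
      exact: CD_ccont (CD_Cexp _).
    apply: Clim_mult; last exact: Clim_const.
    apply: Clim_R; apply/is_lim_seq_abs_0.
    apply: (is_lim_seq_le_le (fun _ => 0) _ (fun n => / INR (S n))).
    - move=> n; split; first exact: Rabs_pos.
      have Hn : 0 < INR (S n) by apply: lt_0_INR; lia.
      have [_ b] := ln_incr_bounds (INR (S n)) Hn; rewrite -S_INR in b.
      have : ln (INR (S n)) <= ln (INR (S (S n))) by apply: ln_le => //; apply: le_INR; lia.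
      move=> H; rewrite Rabs_minus_sym Rabs_pos_eq; lra.
    - exact: is_lim_seq_const.
    - exact: is_lim_inv_INR_S.
  apply: Clim_plus; first exact: Clim_const.
  apply: Clim_mult; first exact: Clim_const.
  apply: (Clim_of_bound _ _ (fun n => / INR (S n))); last exact: is_lim_inv_INR_S.
  move=> n; replace (/ (1 + w + INR (S n)) - 0)%C with (/ (1 + w + INR (S n)))%C by ring.
  rewrite Cmod_inv; last exact: Nf.
  have Hn : 0 < INR (S n) by apply: lt_0_INR; lia.
  apply: Rinv_le_contravar => //.
  have := Cmod_triangle_sub (RtoC (INR (S (S n)))) (1 + w + INR (S n))%C.
  replace (RtoC (INR (S (S n))) - (1 + w + INR (S n)))%C with (- w)%C.
    rewrite Cmod_opp Cmod_R Rabs_pos_eq; last exact: pos_INR.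
    rewrite (S_INR (S n)); lra.
  rewrite (S_INR (S n)) RtoC_plus; ring.
Qed.

Lemma CGamma_1 (w : C) : Cmod w < 3 / 4 -> CGamma (1 + w)%C = gam1 w.
Proof.
  move=> Hw; apply: CLim_seq_unique; apply: Clim_euler_gam_1.
  by replace (w - 0)%C with w by ring.
Qed.

(** The functional equation already holds at finite stages: the Euler expressions at [z] and [1 + z]
    differ by the factor [/ z * (1 + (1 + z) / n)]. *)
Lemma CGamma_shift (z : C) : z <> 0%C -> Cmod z < 3 / 4 -> CGamma z = (gam1 z / z)%C.
Proof.
  move=> Hz0 Hz; have Hz1 : Cmod (z - 0) < 3 / 4 by replace (z - 0)%C with z by ring.
  apply: CLim_seq_unique.
  have Nf : forall j : nat, (1 + z + INR j)%C <> 0%C.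
    move=> j; replace (1 + z + INR j)%C with (INR (S j) + z)%C.
      exact: lgam_denom_neq0.
    by rewrite S_INR RtoC_plus; ring.
  have Nz : forall j : nat, (z + INR j)%C <> 0%C.
    case=> [|j]; first by rewrite /= Cplus_0_r.
    replace (z + INR (S j))%C with (1 + z + INR j)%C; first exact: Nf.
    by rewrite S_INR RtoC_plus; ring.
  have shift : forall n, (z * Cprod (fun j : nat => 1 + z + INR j) (seq 0 n))%C =
     (Cprod (fun j : nat => z + INR j) (seq 0 n) * (z + INR n))%C.
    elim=> [|n IH]; first by rewrite /=; ring.
    rewrite !Cprod_seq_S Cmult_assoc IH S_INR RtoC_plus; ring.
  apply: (Clim_ext_loc (fun n => euler_gam (1 + z)%C n * (/ z * (1 + (1 + z) * / INR n)))%C _ _ 1).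
    case=> [|n] Hn; first lia.
    rewrite /euler_gam.
    have NP : Cprod (fun j : nat => 1 + z + INR j)%C (seq 0 (S (S n))) <> 0%C.
      by apply: Cprod_neq0 => j _; apply: Nf.
    have NP' : Cprod (fun j : nat => z + INR j)%C (seq 0 (S (S n))) <> 0%C.
      by apply: Cprod_neq0 => j _; apply: Nz.
    have Sh := shift (S (S n)).
    have Nn := INR_S_neq0_C n; have Nl := Nz (S (S n)).
    have -> : Rpow_C (INR (S n)) (1 + z) = (INR (S n) * Rpow_C (INR (S n)) z)%C.
      rewrite /Rpow_C; have -> : ((1 + z) * ln (INR (S n)) = ln (INR (S n)) + z * ln (INR (S n)))%C by ring.
      rewrite Cexp_plus Cexp_R exp_ln //; apply: lt_0_INR; lia.
    have -> : Cprod (fun j : nat => 1 + z + INR j)%C (seq 0 (S (S n))) =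
      (Cprod (fun j : nat => z + INR j) (seq 0 (S (S n))) * (z + INR (S (S n))) / z)%C.
      by rewrite -Sh; field.
    have E : RtoC (INR (S (S n))) = (INR (S n) + 1)%C by rewrite (S_INR (S n)) RtoC_plus.
    rewrite E in Nl *.
    field; repeat split=> //.
  have -> : (gam1 z / z)%C = (gam1 z * (/ z * (1 + (1 + z) * 0)))%C by field.
  apply: Clim_mult; first exact: Clim_euler_gam_1.
  apply: Clim_mult; first exact: Clim_const.
  apply: Clim_plus; first exact: Clim_const.
  apply: Clim_mult; first exact: Clim_const.
  apply: (Clim_ext_loc (fun n => RtoC (/ INR n)) _ _ 1).
    by move=> n Hn; rewrite RtoC_inv //; apply: not_0_INR; lia.
  apply: Clim_R; apply/(is_lim_seq_incr_1 (fun n => / INR n)); exact: is_lim_inv_INR_S.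
Qed.

(** * Values of the digamma function *)

Lemma gam1_0 : gam1 0%C = 1%C.
Proof.
  rewrite /gam1; have -> : lgam 0 0%C = 0%C; last exact: Cexp_0.
  by apply: cseries_0 => j; rewrite /lgam_term !Cmult_0_l Log1p_0; ring.
Qed.

Definition harmonic_defect (n : nat) : R := sum_n (fun j => / INR (S j)) n - ln (INR (S n)).

Lemma lgam_1_0_partial (n : nat) : csum (fun j => lgam_term 1 j 0%C) n =
  RtoC (- (harmonic_defect n - (ln (INR (S (S n))) - ln (INR (S n))))).
Proof.
  have T : forall j, lgam_term 1 j 0%C = RtoC (ln (INR (S (S j))) - ln (INR (S j)) - / INR (S j)).
    move=> j; rewrite /lgam_term [fact 0]/= INR_1 !Cpow_1_r Cplus_0_r.
    rewrite (RtoC_minus (_ - _)) RtoC_inv; last by apply: not_0_INR.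
    ring.
  rewrite /harmonic_defect; elim: n => [|n IH].
    rewrite csum_0 T sum_O INR_1 ln_1; f_equal; ring.
  rewrite csum_S IH T sum_Sn -RtoC_plus /plus /=; f_equal; ring.
Qed.

Lemma ln_incr_lim : is_lim_seq (fun n => ln (INR (S (S n))) - ln (INR (S n))) 0.
Proof.
  apply: (is_lim_seq_le_le (fun _ => 0) _ (fun n => / INR (S n))).
  - move=> n; have Hn : 0 < INR (S n) by apply: lt_0_INR; lia.
    have [_ b] := ln_incr_bounds (INR (S n)) Hn; rewrite -S_INR in b.
    have : ln (INR (S n)) <= ln (INR (S (S n))) by apply: ln_le => //; apply: le_INR; lia.
    lra.
  - exact: is_lim_seq_const.
  - exact: is_lim_inv_INR_S.
Qed.

Lemma lgam_1_0_Clim : Clim (fun n => RtoC (- (harmonic_defect n -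
  (ln (INR (S (S n))) - ln (INR (S n)))))) (lgam 1 0%C).
Proof.
  have A : cabs (fun j => lgam_term 1 j 0%C) by apply: lgam_cabs; rewrite Cmod_self_minus; lra.
  exact: Clim_ext _ _ _ lgam_1_0_partial (proj1 (Cis_series_Clim _ _) (Cis_series_cabs _ A)).
Qed.

(** [euler_gamma] is a total [Lim_seq], so convergence has to be proved; it is inherited from the
    series [lgam 1] at 0, whose partial sums are the negated defects up to a null sequence. *)
Lemma harmonic_defect_lim : is_lim_seq harmonic_defect euler_gamma.
Proof.
  have [H1 _] := proj1 (Clim_components _ _) lgam_1_0_Clim.
  have L : is_lim_seq harmonic_defect (- Re (lgam 1 0%C)).
    apply: (is_lim_seq_ext (fun n => - Re (RtoC (- (harmonic_defect n -
      (ln (INR (S (S n))) - ln (INR (S n)))))) + (ln (INR (S (S n))) - ln (INR (S n))))).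
      by move=> n; rewrite /Re /=; ring.
    replace (Finite (- Re (lgam 1 0%C))) with (Finite (- Re (lgam 1 0%C) + 0)) by (f_equal; ring).
    apply: is_lim_seq_plus'; last exact: ln_incr_lim.
    exact: (proj1 (is_lim_seq_opp _ (Finite _)) H1).
  have -> : euler_gamma = - Re (lgam 1 0%C).
    by rewrite /euler_gamma -/harmonic_defect (is_lim_seq_unique _ _ L).
  exact: L.
Qed.

Lemma lgam_1_0 : lgam 1 0%C = RtoC (- euler_gamma).
Proof.
  apply: (Clim_unique _ _ _ lgam_1_0_Clim); apply: Clim_R.
  have H := is_lim_seq_minus' _ _ _ _ harmonic_defect_lim ln_incr_lim.
  rewrite Rminus_0_r in H; exact: (proj1 (is_lim_seq_opp _ (Finite _)) H).
Qed.

Lemma half_in_ball : Cmod (RtoC (/ 2) - 0) < 3 / 4.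
Proof. replace (RtoC (/ 2) - 0)%C with (RtoC (/ 2)) by ring; rewrite Cmod_R Rabs_pos_eq; lra. Qed.

(** The reciprocals [2 / (2j + 3)] run over the odd integers from 3 on. Their sum is twice a
    harmonic sum up to [2n + 3], minus the even part, which is a harmonic sum up to [n + 1], minus
    the missing term 2. *)
Lemma lgam_1_half_partial (n : nat) : csum (fun j => lgam_term 1 j (RtoC (/ 2))) n =
  RtoC (harmonic_defect n - 2 * harmonic_defect (2 * n + 2) + 2
    + (ln (INR (S (S n))) + ln (INR (S n)) - 2 * ln (INR (S (2 * n + 2))))).
Proof.
  have T : forall j, lgam_term 1 j (RtoC (/ 2)) =
    RtoC (ln (INR (S (S j))) - ln (INR (S j)) - 2 * / INR (2 * j + 3)).
    move=> j; rewrite /lgam_term [fact 0]/= INR_1 !Cpow_1_r.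
    have -> : (RtoC (INR (S j)) + RtoC (/ 2))%C = RtoC (INR (2 * j + 3) / 2).
      by rewrite -RtoC_plus; f_equal; rewrite S_INR plus_INR mult_INR /=; field.
    have Hj : INR (2 * j + 3) <> 0 by apply: not_0_INR; lia.
    rewrite -RtoC_inv; last by apply: Rmult_integral_contrapositive; split=> //; lra.
    have -> : / (INR (2 * j + 3) / 2) = 2 * / INR (2 * j + 3) by field.
    rewrite (RtoC_minus (_ - _)); ring.
  rewrite /harmonic_defect; elim: n => [|n IH].
    have -> : (2 * 0 + 2 = 2)%nat by [].
    rewrite csum_0 T sum_O (sum_Sn _ 1) (sum_Sn _ 0) sum_O /plus.
    rewrite [AbelianMonoid.plus _ _]/= /= ln_1; f_equal; field; lra.
  rewrite csum_S IH T -RtoC_plus.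
  replace (2 * S n + 2)%nat with (S (S (2 * n + 2))) by lia.
  rewrite (sum_Sn _ n) (sum_Sn _ (S (2 * n + 2))) (sum_Sn _ (2 * n + 2)); f_equal.
  rewrite -[plus _ (/ INR (S (S (S (2 * n + 2)))))]/(_ + _) -[plus _ (/ INR (S (S (2 * n + 2))))]/(_ + _).
  rewrite -[plus _ (/ INR (S (S n)))]/(_ + _).
  have -> : INR (2 * S n + 3) = INR (S (S (S (2 * n + 2)))) by f_equal; lia.
  have -> : / INR (S (S (2 * n + 2))) = / 2 * / INR (S (S n)).
    rewrite -Rinv_mult; f_equal; rewrite !(S_INR, plus_INR, mult_INR) /=; ring.
  field; split; apply: not_0_INR; lia.
Qed.

Lemma lgam_1_half : lgam 1 (RtoC (/ 2)) = RtoC (- euler_gamma + 2 - 2 * ln 2).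
Proof.
  have A := lgam_cabs 1 _ half_in_ball.
  have H := Clim_ext _ _ _ lgam_1_half_partial (proj1 (Cis_series_Clim _ _) (Cis_series_cabs _ A)).
  apply: (Clim_unique _ _ _ H); apply: Clim_R.
  replace (- euler_gamma + 2 - 2 * ln 2) with (euler_gamma - 2 * euler_gamma + 2 + (0 - 2 * ln 2)) by ring.
  apply: is_lim_seq_plus'.
    apply: is_lim_seq_plus'; last exact: is_lim_seq_const.
    apply: is_lim_seq_minus'; first exact: harmonic_defect_lim.
    apply: (is_lim_seq_scal_l _ 2 (Finite _)).
    apply: (is_lim_seq_subseq harmonic_defect _ (fun n => (2 * n + 2)%nat)); last exact: harmonic_defect_lim.
    by apply: eventually_subseq => n; lia.
  (* The remaining logarithms combine to that of [(n + 1) * (n + 2) / (2n + 3) ^ 2], whose limit is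
     1/4. *)
  have E : ln (/ 4) = 0 - 2 * ln 2.
    have -> : / 4 = / (2 * 2) by field.
    rewrite ln_Rinv ?ln_mult; lra.
  rewrite -E.
  apply: (is_lim_seq_ext (fun n => ln ((1 + / INR (S n)) / ((2 + / INR (S n)) * (2 + / INR (S n)))))).
    move=> n; have Hn : 0 < INR (S n) by apply: lt_0_INR; lia.
    have Hi : 0 < / INR (S n) by apply: Rinv_0_lt_compat.
    have -> : (1 + / INR (S n)) / ((2 + / INR (S n)) * (2 + / INR (S n))) =
       (INR (S (S n)) * INR (S n)) / (INR (S (2 * n + 2)) * INR (S (2 * n + 2))).
      rewrite !(S_INR, plus_INR, mult_INR) /=; field.
      have := pos_INR n; split; lra.
    have H2 : 0 < INR (S (S n)) by apply: lt_0_INR; lia.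
    have H3 : 0 < INR (S (2 * n + 2)) by apply: lt_0_INR; lia.
    rewrite ln_div ?ln_mult //; try nra.
  apply: (is_lim_seq_continuous ln _ (/ 4)).
    apply: derivable_continuous_pt; exists (/ (/ 4)); apply: derivable_pt_lim_ln; lra.
  replace (Finite (/ 4)) with (Finite ((1 + 0) / ((2 + 0) * (2 + 0)))) by (f_equal; field).
  have L2 : is_lim_seq (fun n => 2 + / INR (S n)) (2 + 0).
    by apply: is_lim_seq_plus'; [exact: is_lim_seq_const|exact: is_lim_inv_INR_S].
  apply: is_lim_seq_div'; last lra.
    by apply: is_lim_seq_plus'; [exact: is_lim_seq_const|exact: is_lim_inv_INR_S].
  exact: is_lim_seq_mult'.
Qed.

(** * The value of Gamma at 3/2 *)

Fixpoint rising_three_halves (n : nat) : R :=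
  match n with
  | O => 1
  | S m => rising_three_halves m * (3 / 2 + INR m)
  end.

Lemma rising_three_halves_pos (n : nat) : 0 < rising_three_halves n.
Proof.
  elim: n => [|n IH] /=; first lra.
  apply: Rmult_lt_0_compat => //; have := pos_INR n; lra.
Qed.

Lemma Cprod_three_halves (n : nat) :
  Cprod (fun j : nat => 1 + RtoC (/ 2) + INR j)%C (seq 0 n) = RtoC (rising_three_halves n).
Proof.
  elim: n => [|n IH] //; rewrite Cprod_seq_S IH [rising_three_halves _]/= RtoC_mult; f_equal.
  rewrite -!RtoC_plus; f_equal; field.
Qed.

(** Squaring is what links Euler's limit at 3/2 to the Wallis product, so that [Gamma (3/2)] needs
    no reflection formula. *)
Lemma factorial_rising_wallis (n : nat) : (INR (fact n) / rising_three_halves (S n)) ^ 2 =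
  wallis (S n) / ((INR n + 1) ^ 2 * (2 * INR n + 3)).
Proof.
  elim: n => [|n IH]; first by rewrite /=; field.
  have Hn := pos_INR n; have Hp := rising_three_halves_pos (S n).
  have -> : INR (fact (S n)) / rising_three_halves (S (S n)) =
    (INR (fact n) / rising_three_halves (S n)) * (INR (S n) / (3 / 2 + INR (S n))).
    have -> : INR (fact (S n)) = INR (S n) * INR (fact n) by rewrite -mult_INR.
    rewrite [rising_three_halves (S (S n))]/= -/(INR (S n)) -/(rising_three_halves (S n)).
    field; rewrite S_INR; split; lra.
  rewrite Rpow_mult_distr IH.
  have -> : wallis (S (S n)) = wallis (S n) *
    ((2 * INR (S n) + 2) ^ 2 / ((2 * INR (S n) + 1) * (2 * INR (S n) + 3))) by [].
  rewrite !S_INR; field; repeat split; lra.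
Qed.

Lemma gam1_half : gam1 (RtoC (/ 2)) = RtoC (sqrt PI / 2).
Proof.
  have HPI := PI_RGT_0.
  have H := Clim_euler_gam_1 _ half_in_ball.
  (* The limit is put in the shape of the sequence below, so that limits can be taken factor by
     factor. *)
  have -> : sqrt PI / 2 = sqrt (PI / 2 * (1 - 0) ^ 3 / (2 + 0)).
    have -> : PI / 2 * (1 - 0) ^ 3 / (2 + 0) = (sqrt PI / 2) * (sqrt PI / 2).
      transitivity (PI / 4); first field.
      have := sqrt_sqrt PI (Rlt_le _ _ HPI) => E.
      rewrite -{1}E; field.
    rewrite sqrt_square //; have := sqrt_pos PI; lra.
  have Hs : Clim (fun n => euler_gam (1 + RtoC (/ 2))%C (S n)) (gam1 (RtoC (/ 2))).
    by apply: (Clim_subseq _ _ S _ H) => n; lia.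
  apply: (Clim_unique _ _ _ Hs).
  have Hin := is_lim_inv_INR_S.
  apply: (Clim_ext (fun n => RtoC (sqrt (wallis (S (S n)) *
     (1 - / INR (S (S n))) ^ 3 / (2 + / INR (S (S n))))))).
    move=> n.
    have Hn := pos_INR n.
    have Hn1 : 0 < INR (S n) by apply: lt_0_INR; lia.
    have Hp := rising_three_halves_pos (S (S n)).
    rewrite /euler_gam Cprod_three_halves.
    have -> : Rpow_C (INR (S n)) (1 + RtoC (/ 2)) = RtoC (exp (3 / 2 * ln (INR (S n)))).
      rewrite /Rpow_C -RtoC_plus -RtoC_mult Cexp_R; do 2 f_equal; field.
    rewrite -RtoC_mult -RtoC_div; last lra.
    f_equal.
    have P : 0 <= INR (fact (S n)) * exp (3 / 2 * ln (INR (S n))) / rising_three_halves (S (S n)).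
      apply: Rdiv_le_0_compat => //; apply: Rmult_le_pos; first exact: pos_INR.
      by apply: Rlt_le; apply: exp_pos.
    rewrite -(sqrt_Rsqr _ P); f_equal.
    have E3 : exp (3 / 2 * ln (INR (S n))) ^ 2 = INR (S n) ^ 3.
      have -> : exp (3 / 2 * ln (INR (S n))) ^ 2 = exp (ln (INR (S n)) + ln (INR (S n)) + ln (INR (S n))).
        rewrite /= Rmult_1_r -exp_plus; f_equal; field.
      by rewrite !exp_plus exp_ln //=; ring.
    have -> : Rsqr (INR (fact (S n)) * exp (3 / 2 * ln (INR (S n))) / rising_three_halves (S (S n))) =
      (INR (fact (S n)) / rising_three_halves (S (S n))) ^ 2 * exp (3 / 2 * ln (INR (S n))) ^ 2.
      rewrite /Rsqr; field; lra.
    rewrite factorial_rising_wallis E3 !S_INR; field; repeat split; lra.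
  apply: Clim_R.
  have Hin2 : is_lim_seq (fun n => / INR (S (S n))) 0.
    exact: (proj1 (is_lim_seq_incr_1 (fun n => / INR (S n)) 0) Hin).
  have HW : is_lim_seq (fun n => wallis (S (S n))) (PI / 2).
    exact: (proj1 (is_lim_seq_incr_1 (fun n => wallis (S n)) _)
      (proj1 (is_lim_seq_incr_1 wallis _) wallis_lim)).
  apply: (is_lim_seq_continuous sqrt).
    apply: continuity_pt_sqrt; rewrite /=.
    have -> : PI / 2 * ((1 - 0) * ((1 - 0) * ((1 - 0) * 1))) / (2 + 0) = PI / 4 by field.
    lra.
  apply: is_lim_seq_div'; last lra.
    apply: is_lim_seq_mult' => //.
    have L1 : is_lim_seq (fun n => 1 - / INR (S (S n))) (1 - 0).
      by apply: is_lim_seq_minus'; [exact: is_lim_seq_const|].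
    rewrite /=; repeat apply: is_lim_seq_mult' => //; exact: is_lim_seq_const.
  by apply: is_lim_seq_plus'; [exact: is_lim_seq_const|].
Qed.

(** * The functions Z_k near 0 *)

(* Derivatives of [z ^ n / (n + 1)!], the terms of [(exp z - 1) / z]. *)
Definition phi_term (j n : nat) (z : C) : C :=
  match Nat.leb j n with
  | true => (Cpow z (n - j) * / INR (fact (n - j)) * / INR (S n))%C
  | false => 0%C
  end.

Definition phi (j : nat) (z : C) : C := cseries (fun n => phi_term j n z).

Lemma CD_phi_term (j n : nat) (z : C) : CD (phi_term j n) z (phi_term (S j) n z).
Proof.
  rewrite /phi_term; have [H|[H|H]] : (n < j \/ n = j \/ j < n)%nat by lia.
  - have -> : Nat.leb (S j) n = false by apply/Nat.leb_gt; lia.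
    have -> : Nat.leb j n = false by apply/Nat.leb_gt; lia.
    exact: CD_const.
  - have -> : Nat.leb (S j) n = false by apply/Nat.leb_gt; lia.
    have -> : Nat.leb j n = true by apply/Nat.leb_le; lia.
    have -> : (n - j = 0)%nat by lia.
    apply: (CD_ext (fun _ => 1 * / INR (fact 0) * / INR (S n))%C) => //; exact: CD_const.
  - have -> : Nat.leb (S j) n = true by apply/Nat.leb_le; lia.
    have -> : Nat.leb j n = true by apply/Nat.leb_le; lia.
    have -> : (n - j = S (n - S j))%nat by lia.
    set m := (n - S j)%nat.
    apply: CD_eq (CD_mult _ _ _ _ _ (CD_mult _ _ _ _ _ (CD_pow _ _ _ (S m) (CD_id z))
      (CD_const (/ INR (fact (S m)))%C z)) (CD_const (/ INR (S n))%C z)).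
    rewrite INR_fact_S_C.
    have N1 := INR_fact_neq0_C m; have N2 := INR_S_neq0_C m; have N3 := INR_S_neq0_C n.
    rewrite [pred _]/=; field; repeat split => //.
Qed.

Definition phi_bound (j n : nat) : R :=
  match Nat.leb j n with true => / INR (fact (n - j)) | false => 0 end.

Lemma ex_series_inv_fact : ex_series (fun n => / INR (fact n)).
Proof.
  exists (exp 1); apply: is_series_ext (proj1 (is_pseries_R _ _ _) (is_exp_Reals 1)) => n.
  by rewrite pow1 Rmult_1_r.
Qed.

Lemma ex_series_phi_bound (j : nat) : ex_series (phi_bound j).
Proof.
  apply/(ex_series_incr_n _ j); apply: ex_series_ext ex_series_inv_fact => n.
  rewrite /phi_bound; have -> : Nat.leb j (j + n) = true by apply/Nat.leb_le; lia.
  by have -> : (j + n - j = n)%nat by lia.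
Qed.

Lemma Cmod_phi_term_le (j n : nat) (z : C) : Cmod (z - 0) < 1 ->
  Cmod (phi_term j n z) <= phi_bound j n.
Proof.
  move=> Hz; have Hz' : Cmod z < 1 by replace z with (z - 0)%C by ring.
  rewrite /phi_term /phi_bound; case: (Nat.leb j n); last by rewrite Cmod_0; lra.
  rewrite !Cmod_mult Cmod_pow !Cmod_inv; [|exact: INR_S_neq0_C|exact: INR_fact_neq0_C].
  rewrite !Cmod_R !Rabs_pos_eq; try exact: pos_INR.
  have Hp : Cmod z ^ (n - j) <= 1.
    by rewrite -(pow1 (n - j)); apply: pow_incr; split; [exact: Cmod_ge_0|lra].
  have Hp0 : 0 <= Cmod z ^ (n - j) by apply: pow_le; exact: Cmod_ge_0.
  have Hf : 0 < / INR (fact (n - j)) by apply: Rinv_0_lt_compat; exact: INR_fact_lt_0.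
  have [Hk0 Hk] := inv_INR_S_bounds n.
  have : Cmod z ^ (n - j) * / INR (fact (n - j)) <= / INR (fact (n - j)) by nra.
  have : 0 <= Cmod z ^ (n - j) * / INR (fact (n - j)) by nra.
  nra.
Qed.

Lemma phi_cabs (j : nat) (z : C) : Cmod (z - 0) < 1 -> cabs (fun n => phi_term j n z).
Proof.
  move=> Hz; apply: (cabs_le _ (phi_bound j)); last exact: ex_series_phi_bound.
  by move=> n; apply: Cmod_phi_term_le.
Qed.

Lemma CD_phi (j : nat) (z : C) : Cmod (z - 0) < 1 -> CD (phi j) z (phi (S j) z).
Proof.
  apply: (cseries_dseq phi_term phi_bound).
  - by move=> *; apply: CD_phi_term.
  - by move=> *; apply: Cmod_phi_term_le.
  - exact: ex_series_phi_bound.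
Qed.

Lemma cseries_single (u : nat -> C) (m : nat) : cabs u ->
  (forall k, k <> m -> u k = 0%C) -> cseries u = u m.
Proof.
  move=> Hu H; rewrite (cseries_shift u m); last by move=> k Hk; apply: H; lia.
  rewrite cseries_first; last exact: (proj1 (ex_series_incr_n (fun n => Cmod (u n)) m) Hu).
  rewrite Nat.add_0_r (cseries_0 (fun k => u (m + S k)%nat)); first ring.
  by move=> k; apply: H; lia.
Qed.

Lemma phi_at_0 (j : nat) : phi j 0%C = (/ INR (S j))%C.
Proof.
  rewrite /phi (cseries_single _ j).
  - rewrite /phi_term Nat.leb_refl Nat.sub_diag [fact 0]/= [Cpow _ 0]/= INR_1.
    field; exact: INR_S_neq0_C.
  - by apply: phi_cabs; rewrite Cmod_self_minus; lra.
  - move=> k Hk; rewrite /phi_term; case E : (Nat.leb j k) => //.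
    have : (j <= k)%nat by apply/Nat.leb_le.
    move=> Hjk; have -> : (k - j = S (k - S j))%nat by lia.
    by rewrite /=; ring.
Qed.

Lemma Cexp_series (z : C) : Cmod z < 1 ->
  Cis_series (fun n => Cpow z n * / INR (fact n))%C (Cexp z).
Proof.
  move=> Hz.
  have H := taylor_series (fun _ => Cexp) 0%C 1 1 3 Rlt_0_1.
  have -> : Cexp z = Cexp (0 + z)%C by f_equal; ring.
  apply: (Cis_series_ext (pser (fun j => Cexp 0 / INR (fact j))%C z)).
    by move=> n; rewrite /pser Cexp_0; field; exact: INR_fact_neq0_C.
  apply: H => //.
  - by move=> j w _; apply: CD_Cexp.
  - move=> j w Hw; rewrite pow1.
    have Hf := INR_fact_ge1 j.
    have B : Cmod (Cexp w) <= 3.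
      by apply: Cexp_le; replace w with (w - 0)%C by ring; lra.
    by rewrite /Rdiv Rinv_1; lra.
Qed.

Lemma phi_Cexp (z : C) : Cmod z < 1 -> (z * phi 0 z)%C = (Cexp z - 1)%C.
Proof.
  move=> Hz; have Hz0 : Cmod (z - 0) < 1 by replace (z - 0)%C with z by ring.
  rewrite -(Cis_series_unique _ _ (Cexp_series z Hz)) cseries_first.
    rewrite /phi -cseries_scal; last exact: phi_cabs.
    rewrite [Cpow z 0]/= INR_1.
    have -> : cseries (fun n => z * phi_term 0 n z)%C =
      cseries (fun k => Cpow z (S k) * / INR (fact (S k)))%C.
      apply: cseries_ext => n; rewrite /phi_term /= Nat.sub_0_r -/(fact (S n)).
      rewrite INR_fact_S_C.
      rewrite -/(INR (S n)); field; split; [exact: INR_fact_neq0_C|exact: INR_S_neq0_C].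
    by field; move=> [E]; lra.
  apply: (cabs_le _ (fun n => / INR (fact n))); last exact: ex_series_inv_fact.
  move=> n; rewrite Cmod_mult Cmod_pow Cmod_inv; last exact: INR_fact_neq0_C.
  rewrite Cmod_R Rabs_pos_eq; last exact: pos_INR.
  have Hp : Cmod z ^ n <= 1.
    by rewrite -(pow1 n); apply: pow_incr; split; [exact: Cmod_ge_0|lra].
  have Hf : 0 < / INR (fact n) by apply: Rinv_0_lt_compat; exact: INR_fact_lt_0.
  nra.
Qed.

(* The logarithmic derivative, stated so that it makes sense also when
   [f z = 0]. *)
Definition LD (f : C -> C) (z a : C) : Prop := CD f z (f z * a)%C.

Lemma LD_mult (f g : C -> C) (z a b : C) : LD f z a -> LD g z b ->
  LD (fun w => f w * g w)%C z (a + b)%C.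
Proof. move=> Hf Hg; apply: CD_eq (CD_mult _ _ _ _ _ Hf Hg); ring. Qed.

Lemma LD_const (c z : C) : LD (fun _ => c) z 0%C.
Proof. apply: CD_eq (CD_const c z); ring. Qed.

Lemma LD_inv (f : C -> C) (z a : C) : f z <> 0%C -> LD f z a ->
  LD (fun w => / f w)%C z (- a)%C.
Proof. by move=> Hz Hf; apply: CD_eq (CD_inv _ _ _ Hf Hz); field. Qed.

Lemma LD_pow (f : C -> C) (z a : C) (n : nat) : LD f z a ->
  LD (fun w => Cpow (f w) n) z (INR n * a)%C.
Proof.
  move=> Hf; apply: CD_eq (CD_pow _ _ _ n Hf); case: n => [|n] /=; first ring.
  rewrite -/(INR (S n)); ring.
Qed.

Lemma LD_comp (f g : C -> C) (z a b : C) : CD f z a -> LD g (f z) b ->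
  LD (fun w => g (f w)) z (b * a)%C.
Proof. move=> Hf Hg; apply: CD_eq (CD_comp _ _ _ _ _ Hf Hg); ring. Qed.

Lemma LD_Cexp (z : C) : LD Cexp z 1%C.
Proof. apply: CD_eq (CD_Cexp z); ring. Qed.

Lemma LD_Rpow_C (x : R) (f : C -> C) (z a : C) : CD f z a ->
  LD (fun w => Rpow_C x (f w)) z (a * ln x)%C.
Proof.
  move=> Hf; apply: CD_eq (CD_Cexp_comp _ _ _ (CD_mult _ _ _ _ _ Hf (CD_const (RtoC (ln x)) z))).
  rewrite /Rpow_C; ring.
Qed.

Lemma LD_gam1 (w : C) : Cmod (w - 0) < 3 / 4 -> LD gam1 w (lgam 1 w).
Proof. exact: CD_gam1. Qed.

Lemma LD_eq (f : C -> C) (z a b : C) : a = b -> LD f z a -> LD f z b.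
Proof. by move=> ->. Qed.

Lemma smooth_opp (c : C) (r : R) (f : C -> C) : smooth c r f -> smooth c r (fun z => - f z)%C.
Proof.
  move=> H; apply: (smooth_ext _ _ (fun z => (- (1)) * f z)%C) => [w _|]; first ring.
  exact: smooth_scal.
Qed.

Lemma smooth_Rpow_C (c : C) (r x : R) (f : C -> C) : smooth c r f ->
  smooth c r (fun z => Rpow_C x (f z)).
Proof.
  move=> H; apply: smooth_comp_Cexp; apply: smooth_mult => //; exact: smooth_const.
Qed.

(* [chi s / s]: the zero of the sine is divided out through [phi], and
   [Gamma (1 - s)] is [gam1 (- s)]. *)
Definition chi_quot (s : C) : C :=
  (Rpow_C 2 s * Rpow_C PI (s - 1) * (RtoC (PI / 2) * Cexp (- (Ci * PI / 2) * s)
   * phi 0 (Ci * PI * s)) * gam1 (- s))%C.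

Lemma Ci_PI_ball (s : C) : Cmod (s - 0) < / 4 -> Cmod (Ci * PI * s - 0) < 1.
Proof.
  replace (s - 0)%C with s by ring; replace (Ci * PI * s - 0)%C with (Ci * PI * s)%C by ring.
  move=> Hs; rewrite !Cmod_mult Cmod_Ci Cmod_R Rabs_pos_eq; last by apply: Rlt_le; apply: PI_RGT_0.
  have := PI_RGT_0; have := PI_4; have := Cmod_ge_0 s; nra.
Qed.

Lemma opp_ball (s : C) : Cmod (s - 0) < / 4 -> Cmod (- s - 0) < 3 / 4.
Proof.
  replace (- s - 0)%C with (- (s - 0))%C by ring; rewrite Cmod_opp; lra.
Qed.

Lemma Ci_neq0 : Ci <> 0%C.
Proof. by move=> [E]; lra. Qed.

Lemma chi_factor (s : C) : Cmod (s - 0) < / 4 -> chi s = (s * chi_quot s)%C.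
Proof.
  move=> Hs; have HB := Ci_PI_ball s Hs.
  have Hs' : Cmod (- s) < 3 / 4 by replace (- s)%C with (- s - 0)%C by ring; apply: opp_ball.
  rewrite /chi /chi_quot CGamma_1 //.
  (* From [sin y = exp (- i y) * (exp (2 i y) - 1) / (2 i)] at [y = PI * s / 2], where [phi 0]
     extracts the zero of the difference. *)
  suff -> : Csin (PI * s / 2) = (s * (RtoC (PI / 2) * Cexp (- (Ci * PI / 2) * s) * phi 0 (Ci * PI * s)))%C.
    ring.
  have P := phi_Cexp (Ci * PI * s)%C ltac:(replace (Ci * PI * s)%C with (Ci * PI * s - 0)%C by ring; exact: HB).
  have h2 := two_neq0_C.
  have E1 : (Ci * (PI * s / 2))%C = (Ci * PI * s + - (Ci * PI / 2) * s)%C by field.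
  have E2 : (- (Ci * (PI * s / 2)))%C = (- (Ci * PI / 2) * s)%C by field.
  rewrite /Csin E2 E1 Cexp_plus.
  have -> : Cexp (Ci * PI * s) = (1 + Ci * PI * s * phi 0 (Ci * PI * s))%C by rewrite P; ring.
  rewrite RtoC_div; last lra.
  field; exact: Ci_neq0.
Qed.

Lemma smooth_chi_quot : smooth 0%C (/ 4) chi_quot.
Proof.
  have I := smooth_id 0%C (/ 4).
  apply: smooth_mult; first apply: smooth_mult; first apply: smooth_mult.
  - exact: smooth_Rpow_C.
  - apply: smooth_Rpow_C; apply: smooth_minus => //; exact: smooth_const.
  - apply: smooth_mult.
      apply: smooth_mult; first exact: smooth_const.
      by apply: smooth_comp_Cexp; apply: smooth_scal.
    apply: (smooth_comp 0%C 0%C (/ 4) 1 (fun s => Ci * PI * s)%C (phi 0)).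
    + exact: Ci_PI_ball.
    + exact: smooth_scal.
    + by apply: smooth_dseq => j z; apply: CD_phi.
  - apply: (smooth_comp 0%C 0%C (/ 4) (3 / 4) (fun s => - s)%C gam1).
    + exact: opp_ball.
    + exact: smooth_opp.
    + exact: smooth_gam1.
Qed.

Lemma Rpow_C_neq0 (x : R) (s : C) : Rpow_C x s <> 0%C.
Proof. exact: Cexp_neq0. Qed.

Lemma zero_ball (r : R) : 0 < r -> Cmod (0 - 0) < r.
Proof. by rewrite Cmod_self_minus. Qed.

Lemma chi_quot_0 : chi_quot 0%C <> 0%C.
Proof.
  have HPI := PI_RGT_0.
  rewrite /chi_quot; repeat apply: Cmult_neq_0; try exact: Rpow_C_neq0; try exact: Cexp_neq0.
  - by apply: RtoC_neq0; lra.
  - rewrite Cmult_0_r phi_at_0 -RtoC_inv; last exact: not_0_INR.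
    by apply: RtoC_neq0; rewrite INR_1; lra.
Qed.

(** The two powers give [ln 2 + ln PI] and the Gamma factor gives [euler_gamma]; the imaginary
    contributions of the exponential and of [phi] cancel. *)
Lemma LD_chi_quot : LD chi_quot 0%C (RtoC (ln (2 * PI) + euler_gamma)).
Proof.
  have HPI := PI_RGT_0.
  have I := CD_id 0%C.
  have D1 : CD (fun s => s - 1)%C 0%C 1%C.
    apply: CD_eq (CD_minus _ _ _ _ _ I (CD_const 1%C 0%C)); ring.
  have L1 := LD_Rpow_C 2 _ _ _ I.
  have L2 := LD_Rpow_C PI _ _ _ D1.
  have L3 := LD_comp _ _ _ _ _ (CD_scal_id (- (Ci * PI / 2))%C 0%C) (LD_Cexp _).
  have L4 : LD (fun s => phi 0 (Ci * PI * s)) 0%C (Ci * PI / 2)%C.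
    apply: LD_eq (LD_comp _ _ _ _ (/ 2)%C (CD_scal_id (Ci * PI)%C 0%C) _); first by rewrite /Cdiv; ring.
    rewrite Cmult_0_r; apply: CD_eq (CD_phi 0 0%C (zero_ball _ Rlt_0_1)).
    rewrite !phi_at_0 INR_1; have -> : RtoC (INR 2) = 2%C by rewrite /=; f_equal; lra.
    have h2 := two_neq0_C.
    by field; split => //; move=> [E]; lra.
  have L5 : LD (fun s => gam1 (- s)) 0%C (RtoC euler_gamma).
    have D5 : CD (fun s => - s)%C 0%C (- (1))%C by apply: CD_opp.
    apply: LD_eq (LD_comp _ gam1 _ _ (lgam 1 0%C) D5 _).
      rewrite lgam_1_0 RtoC_opp; ring.
    have -> : (- 0)%C = 0%C by ring.
    by apply: LD_gam1; apply: zero_ball; lra.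
  apply: LD_eq (LD_mult _ _ _ _ _ (LD_mult _ _ _ _ _ (LD_mult _ _ _ _ _ L1 L2)
    (LD_mult _ _ _ _ _ (LD_mult _ _ _ _ _ (LD_const (RtoC (PI / 2)) 0%C) L3) L4)) L5).
  rewrite ln_mult; try lra; rewrite !RtoC_plus; ring.
Qed.

(* [s * omega s], with its pole at 0 removed. *)
Definition s_omega (s : C) : C := (1 + s * (C_derive chi_quot s / chi_quot s))%C.

Lemma chi_quot_nz : exists d, 0 < d <= / 4 /\
  forall s, Cmod (s - 0) < d -> chi_quot s <> 0%C.
Proof.
  have C0 := ccont_smooth _ _ _ _ smooth_chi_quot (zero_ball (/ 4) ltac:(lra)).
  have [d [Hd H]] := ccont_neq0 _ _ C0 chi_quot_0.
  exists (Rmin d (/ 4)); split.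
    by split; [apply: Rmin_pos; lra|exact: Rmin_r].
  move=> s Hs; apply: Cmod_pos_neq0.
  have := H s (lt_Rmin_l _ _ _ Hs); have := Cmod_ge_0 (chi_quot 0%C); lra.
Qed.

Lemma omega_near_0 (d : R) (s : C) : d <= / 4 ->
  (forall s, Cmod (s - 0) < d -> chi_quot s <> 0%C) ->
  Cmod (s - 0) < d -> s <> 0%C -> omega s = (s_omega s / s)%C.
Proof.
  move=> Hd Hnz Hs Hs0.
  have Hs4 : Cmod (s - 0) < / 4 by lra.
  have D : CD chi s (1 * chi_quot s + s * C_derive chi_quot s)%C.
    apply: (CD_ext_ball 0%C _ _ (/ 4) (fun s => s * chi_quot s)%C) => //.
      by move=> w Hw; rewrite chi_factor.
    apply: CD_mult; first exact: CD_id.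
    exact: smooth_CD smooth_chi_quot Hs4.
  rewrite /omega (CD_derive _ _ _ D) chi_factor // /s_omega.
  by field; split => //; apply: Hnz.
Qed.

Lemma smooth_s_omega (d : R) : d <= / 4 ->
  (forall s, Cmod (s - 0) < d -> chi_quot s <> 0%C) -> smooth 0%C d s_omega.
Proof.
  move=> Hd Hnz.
  have S : smooth 0%C d chi_quot.
    by apply: (smooth_subball 0%C 0%C (/ 4) d) smooth_chi_quot => z Hz; lra.
  apply: smooth_plus; first exact: smooth_const.
  apply: smooth_mult; first exact: smooth_id.
  apply: smooth_mult; first exact: smooth_derive.
  exact: smooth_inv.
Qed.

Lemma CD_s_omega : CD s_omega 0%C (RtoC (ln (2 * PI) + euler_gamma)).
Proof.
  have [d [[Hd0 Hd] Hnz]] := chi_quot_nz.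
  have S : smooth 0%C d (fun s => C_derive chi_quot s / chi_quot s)%C.
    have S0 : smooth 0%C d chi_quot.
      by apply: (smooth_subball 0%C 0%C (/ 4) d) smooth_chi_quot => z Hz; lra.
    by apply: smooth_mult; [exact: smooth_derive|exact: smooth_inv].
  apply: CD_eq (CD_plus _ _ _ _ _ (CD_const 1%C 0%C) (CD_mult _ _ _ _ _ (CD_id 0%C)
    (smooth_CD 0%C 0%C d _ S (zero_ball d Hd0)))).
  rewrite (CD_derive _ _ _ LD_chi_quot); field; exact: chi_quot_0.
Qed.

Fixpoint Wf (zeta : C -> C) (k : nat) (s : C) : C :=
  match k with
  | O => zeta s
  | S k' => (s * C_derive (Wf zeta k') s - INR k' * Wf zeta k' s
             - / 2 * s_omega s * Wf zeta k' s)%C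
  end.

Lemma smooth_Wf (zeta : C -> C) (d : R) (k : nat) : smooth 0%C d zeta -> smooth 0%C d s_omega ->
  smooth 0%C d (Wf zeta k).
Proof.
  move=> Hz Ho; elim: k => [|k IH] //=.
  apply: smooth_minus; first apply: smooth_minus.
  - by apply: smooth_mult; [exact: smooth_id|exact: smooth_derive].
  - exact: smooth_scal.
  - by apply: smooth_mult => //; apply: smooth_scal.
Qed.

(** The induction runs over the whole punctured disc, because the next [Zf] differentiates the
    previous one. Differentiating [s ^ (- k)] produces the term [- k * W_k]. *)
Lemma Zf_Wf (zeta : C -> C) (d : R) (k : nat) : d <= / 4 ->
  (forall s, Cmod (s - 0) < d -> chi_quot s <> 0%C) ->
  smooth 0%C d zeta ->
  forall s, Cmod (s - 0) < d -> s <> 0%C -> Zf zeta k s = (Wf zeta k s / Cpow s k)%C.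
Proof.
  move=> Hd Hnz Hz; have Ho := smooth_s_omega d Hd Hnz.
  elim: k => [|k IH] s Hs Hs0; first by rewrite /=; field; move=> [E]; lra.
  have SW := smooth_Wf zeta d k Hz Ho.
  have Np := Cpow_nz s k Hs0.
  have D : CD (Zf zeta k) s ((C_derive (Wf zeta k) s * Cpow s k -
     Wf zeta k s * (INR k * Cpow s (pred k) * 1)) / (Cpow s k * Cpow s k))%C.
    have [r [Hr Hrw]] := ball_open 0%C s d Hs.
    have Hm := proj1 (Cmod_gt_0 _) Hs0.
    (* The radius [|s|] keeps the neighbourhood away from 0. *)
    apply: (CD_ext_loc (fun s => Wf zeta k s / Cpow s k)%C _ _ _ (Rmin r (Cmod s))).
    - exact: Rmin_pos.
    - move=> w Hw; rewrite IH //; first by apply: Hrw; apply: lt_Rmin_l Hw.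
      move=> E; have := lt_Rmin_r _ _ _ Hw.
      by rewrite E; replace (0 - s)%C with (- s)%C by ring; rewrite Cmod_opp; lra.
    - apply: CD_div => //; first exact: smooth_CD SW Hs.
      by apply: CD_pow; apply: CD_id.
  rewrite [Zf _ _ _]/= (CD_derive _ _ _ D) (omega_near_0 d) // IH // [Wf _ (S k) _]/=.
  have h2 := two_neq0_C.
  case: k {IH D SW} Np => [|k] Np; first by rewrite /=; field; repeat split.
  have Np' := Cpow_nz s k Hs0.
  rewrite [pred _]/= !Cpow_S; field; repeat split => //.
Qed.

Lemma s_omega_0 : s_omega 0%C = 1%C.
Proof. rewrite /s_omega; ring. Qed.

(** By the recursion, [(2k - 1) * r_k] is an arithmetic progression in [k] with step
    [ln (2 * PI) + euler_gamma] and initial value [- ln (2 * PI)], whence the closed form. The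
    denominator is odd, so it never vanishes. *)
Lemma Wf_at_0 (zeta : C -> C) (d : R) (k : nat) : 0 < d -> smooth 0%C d zeta ->
  smooth 0%C d s_omega ->
  zeta 0%C = RtoC (- / 2) -> CD zeta 0%C (RtoC (- (/ 2 * ln (2 * PI)))) ->
  Wf zeta k 0%C = RtoC (- / 2 * ((- 1) ^ k * INR (odd_dfact k) / 2 ^ k)) /\
  LD (Wf zeta k) 0%C (RtoC
    ((INR k * (ln (2 * PI) + euler_gamma) - ln (2 * PI)) / (2 * INR k - 1))).
Proof.
  move=> Hd Hz Ho Hz0 Hz1.
  have B0 := zero_ball d Hd.
  have h2 := two_neq0_C.
  elim: k => [|k [IH1 IH2]].
    split; first by rewrite /= Hz0; f_equal; field.
    apply: CD_eq Hz1; rewrite /= Hz0 -RtoC_mult; f_equal; field.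
  have E1 : Wf zeta (S k) 0%C = (- (INR k + / 2) * Wf zeta k 0)%C.
    by rewrite /= s_omega_0; ring.
  have Hk := pos_INR k.
  have hk : 2 * INR k - 1 <> 0.
    move=> E; have : INR (2 * k) = INR 1 by rewrite mult_INR INR_1 [INR 2]/=; lra.
    by move/INR_eq; lia.
  split.
    rewrite E1 IH1 -RtoC_inv; last lra.
    rewrite -RtoC_plus -RtoC_opp -RtoC_mult; f_equal.
    have -> : INR (odd_dfact (S k)) = INR (odd_dfact k) * (2 * INR k + 1).
      rewrite [odd_dfact _]/= mult_INR; f_equal.
      replace (k + S (k + 0) - 0)%nat with (2 * k + 1)%nat by lia.
      rewrite plus_INR mult_INR /=; ring.
    rewrite /=; field; apply: pow_nonzero; lra.
  have SW := smooth_Wf zeta d k Hz Ho.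
  set a := (INR k * _ - _) / _ in IH2.
  have D := CD_minus _ _ _ _ _ (CD_minus _ _ _ _ _
    (CD_mult _ _ _ _ _ (CD_id 0%C) (smooth_CD 0%C 0%C d _ (smooth_derive _ _ _ SW) B0))
    (CD_scal (INR k) _ _ _ IH2))
    (CD_mult _ _ _ _ _ (CD_scal (/ 2)%C _ _ _ CD_s_omega) IH2).
  apply: CD_eq D; rewrite E1 (CD_derive _ _ _ IH2) s_omega_0.
  have -> : (INR (S k) * (ln (2 * PI) + euler_gamma) - ln (2 * PI)) / (2 * INR (S k) - 1) =
    ((2 * INR k - 1) * a + (ln (2 * PI) + euler_gamma)) / (2 * INR k + 1).
    rewrite /a S_INR; field; split; lra.
  clearbody a; move: (ln (2 * PI) + euler_gamma) (INR k) Hk hk => o x Hk hk.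
  have hk1 : (2 * x + 1)%C <> 0%C.
    by rewrite -RtoC_mult -RtoC_plus; apply: RtoC_neq0; lra.
  have -> : RtoC (((2 * x - 1) * a + o) / (2 * x + 1)) = (((2 * x - 1) * a + o) / (2 * x + 1))%C.
    by rewrite RtoC_div ?(RtoC_plus, RtoC_mult, RtoC_minus) //; lra.
  by field.
Qed.

(** * The functions xi_k near 0 *)

Lemma Cpow_Z_pred (z : C) (k : nat) : z <> 0%C ->
  Cpow_Z z (Z.of_nat k - 1) = (Cpow z k / z)%C.
Proof.
  move=> Hz; case: k => [|[|k]].
  - by rewrite /= /Cdiv Cmult_1_l Cmult_1_r.
  - by rewrite /=; field.
  - have -> : (Z.of_nat (S (S k)) - 1)%Z = Zpos (Pos.of_succ_nat k) by lia.
    by rewrite /Cpow_Z SuccNat2Pos.id_succ !Cpow_S; field.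
Qed.

(** [Gamma ((1 - s) / 2)] near [s = 0]: its argument is near 1/2, so the functional equation is
    applied once. *)
Definition gam_half (s : C) : C := (gam1 ((1 - s) / 2) / ((1 - s) / 2))%C.

(* [xi_formula] with the pole of [Zf] and that of [Gamma (s / 2)] cancelled. *)
Definition xi_reg (zeta : C -> C) (k : nat) (s : C) : C :=
  (Rpow_C PI (- (s / 2)) * (s - 1) * Wf zeta k s * (2 * gam1 (s / 2))
   * / Cpow (2 * gam1 (s / 2) * gam_half s) k)%C.

Lemma half_ball (s : C) : Cmod (s - 0) < / 4 -> Cmod (s / 2 - 0) < 3 / 4.
Proof.
  replace (s - 0)%C with s by ring; replace (s / 2 - 0)%C with (s / 2)%C by ring.
  rewrite Cmod_div; last exact: two_neq0_C.
  rewrite Cmod_R Rabs_pos_eq; lra.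
Qed.

Lemma half_refl_ball (s : C) : Cmod (s - 0) < / 4 -> Cmod ((1 - s) / 2 - 0) < 3 / 4.
Proof.
  replace ((1 - s) / 2 - 0)%C with ((1 - s) / 2)%C by ring.
  move=> Hs; rewrite Cmod_div; last exact: two_neq0_C.
  rewrite Cmod_R Rabs_pos_eq; last lra.
  have := Cmod_triangle 1 (- s); rewrite Cmod_1 Cmod_opp.
  replace (s - 0)%C with s in Hs by ring.
  rewrite -/(Cminus 1 s); lra.
Qed.

Lemma one_minus_neq0 (s : C) : Cmod (s - 0) < / 4 -> (1 - s)%C <> 0%C.
Proof.
  move=> Hs E; have E1 := Csub_eq0 _ _ E.
  by move: Hs; rewrite -E1; replace (1 - 0)%C with (RtoC 1) by ring; rewrite Cmod_1; lra.
Qed.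

Lemma half_one_minus_neq0 (s : C) : Cmod (s - 0) < / 4 -> ((1 - s) / 2)%C <> 0%C.
Proof.
  move=> Hs; apply: Cmult_neq_0; first exact: one_minus_neq0.
  by move=> E; have := Cinv_r 2 two_neq0_C; rewrite E Cmult_0_r => [[E1]]; lra.
Qed.

Lemma gam_half_neq0 (s : C) : Cmod (s - 0) < / 4 -> gam_half s <> 0%C.
Proof.
  move=> Hs E; have H := half_one_minus_neq0 s Hs.
  apply: (gam1_neq0 ((1 - s) / 2)%C).
  transitivity (gam_half s * ((1 - s) / 2))%C.
    rewrite /gam_half; field; exact: one_minus_neq0.
  rewrite E; ring.
Qed.

(** Powers of [s] balance: one from [s * (s - 1)], [- k] from [Zf], and [k - 1] from the pole of
    [Gamma (s / 2)] in the denominator. *)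
Lemma xi_formula_reg (zeta : C -> C) (k : nat) (d : R) (s : C) : d <= / 4 ->
  (forall s, Cmod (s - 0) < d -> chi_quot s <> 0%C) ->
  smooth 0%C d zeta -> Cmod (s - 0) < d -> s <> 0%C ->
  xi_formula zeta k s = xi_reg zeta k s.
Proof.
  move=> Hd Hnz Hz Hs Hs0.
  have Hs4 : Cmod (s - 0) < / 4 by lra.
  have h2 := two_neq0_C.
  have B1 := half_ball s Hs4; have B2 := half_refl_ball s Hs4.
  have N1 := one_minus_neq0 s Hs4; have N2 := half_one_minus_neq0 s Hs4.
  have Ns2 : (s / 2)%C <> 0%C.
    move=> E; apply: Hs0; transitivity (2 * (s / 2))%C; first by field.
    rewrite E; ring.
  have Ng := gam_half_neq0 s Hs4.
  have N3 := gam1_neq0 (s / 2)%C.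
  rewrite /xi_formula /xi_reg (Zf_Wf zeta d) //.
  have -> : CGamma ((1 - s) / 2) = gam_half s.
    by rewrite CGamma_shift //; replace ((1 - s) / 2)%C with ((1 - s) / 2 - 0)%C by ring.
  have -> : CGamma (s / 2) = (2 * gam1 (s / 2) / s)%C.
    rewrite CGamma_shift //; first by field.
    by replace (s / 2)%C with (s / 2 - 0)%C by ring.
  have Ns : (2 * gam1 (s / 2) / s)%C <> 0%C.
    move=> E; have : (2 * gam1 (s / 2))%C <> 0%C by apply: Cmult_neq_0.
    apply; transitivity (2 * gam1 (s / 2) / s * s)%C; first by field.
    rewrite E; ring.
  rewrite Cpow_Z_pred //.
  have P1 := Cpow_nz _ k h2; have P2 := Cpow_nz _ k N3; have P3 := Cpow_nz _ k Ng.
  have P4 := Cpow_nz _ k Hs0.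
  move: (gam1 (s / 2)) N3 P2 {Ns} => g N3 P2.
  move: (gam_half s) Ng P3 => q Ng P3.
  rewrite /Cdiv !Cpow_mult_l Cpow_inv //.
  by field; repeat split.
Qed.

Lemma smooth_xi_reg (zeta : C -> C) (k : nat) (d : R) : d <= / 4 ->
  smooth 0%C d zeta -> smooth 0%C d s_omega -> smooth 0%C d (xi_reg zeta k).
Proof.
  move=> Hd Hz Ho.
  have I := smooth_id 0%C d.
  have SA : smooth 0%C d (fun s => s / 2)%C by apply: smooth_mult => //; exact: smooth_const.
  have SB : smooth 0%C d (fun s => (1 - s) / 2)%C.
    apply: smooth_mult; last exact: smooth_const.
    by apply: smooth_minus => //; exact: smooth_const.
  have SG : smooth 0%C d (fun s => gam1 (s / 2)).
    apply: (smooth_comp 0%C 0%C d (3 / 4) (fun s => s / 2)%C gam1) => //; last exact: smooth_gam1.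
    by move=> z Hs; apply: half_ball; lra.
  have SH : smooth 0%C d gam_half.
    apply: smooth_mult.
      apply: (smooth_comp 0%C 0%C d (3 / 4) (fun s => (1 - s) / 2)%C gam1) => //; last exact: smooth_gam1.
      by move=> z Hs; apply: half_refl_ball; lra.
    by apply: smooth_inv => // z Hs; apply: half_one_minus_neq0; lra.
  have S2G : smooth 0%C d (fun s => 2 * gam1 (s / 2))%C by apply: smooth_scal.
  have SP : forall n, smooth 0%C d (fun s => Cpow (2 * gam1 (s / 2) * gam_half s) n).
    elim=> [|n IH] /=; first exact: smooth_const.
    by apply: smooth_mult => //; apply: smooth_mult.
  apply: smooth_mult; first apply: smooth_mult; first apply: smooth_mult; first apply: smooth_mult.
  - by apply: smooth_Rpow_C; apply: smooth_opp.
  - by apply: smooth_minus => //; exact: smooth_const.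
  - exact: smooth_Wf.
  - exact: S2G.
  - apply: smooth_inv => // z Hs; apply: Cpow_nz.
    apply: Cmult_neq_0; last by apply: gam_half_neq0; lra.
    by apply: Cmult_neq_0; [exact: two_neq0_C|exact: gam1_neq0].
Qed.

Lemma gam_half_0 : gam_half 0%C = RtoC (sqrt PI).
Proof.
  rewrite /gam_half; have -> : ((1 - 0) / 2)%C = RtoC (/ 2).
    by rewrite RtoC_inv; [rewrite /Cdiv; ring|lra].
  rewrite gam1_half -RtoC_div; last lra.
  by f_equal; field.
Qed.

Lemma CD_half (z : C) : CD (fun s => s / 2)%C z (/ 2)%C.
Proof. apply: CD_eq (CD_mult _ _ _ _ _ (CD_id z) (CD_const (/ 2)%C z)); ring. Qed.

Lemma LD_gam1_half : LD (fun s => gam1 (s / 2)) 0%C (RtoC (- (euler_gamma / 2))).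
Proof.
  have E : (0 / 2)%C = 0%C by rewrite /Cdiv; ring.
  apply: LD_eq (LD_comp _ gam1 _ _ (lgam 1 0%C) (CD_half 0%C) _); last first.
    by rewrite E; apply: LD_gam1; apply: zero_ball; lra.
  rewrite lgam_1_0 -RtoC_inv; last lra.
  rewrite -RtoC_mult; f_equal; field.
Qed.

(** The value is [- / 2] times the digamma function at 1/2; the constant in its value at 3/2 is
    cancelled by the shift factor. *)
Lemma LD_gam_half : LD gam_half 0%C (RtoC (euler_gamma / 2 + ln 2)).
Proof.
  have E : ((1 - 0) / 2)%C = RtoC (/ 2).
    by rewrite RtoC_inv; [rewrite /Cdiv; ring|lra].
  have h2 := two_neq0_C.
  have D : CD (fun s => (1 - s) / 2)%C 0%C (RtoC (- / 2)).
    apply: CD_eq (CD_mult _ _ _ _ _ (CD_minus _ _ _ _ _ (CD_const 1%C 0%C) (CD_id 0%C))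
      (CD_const (/ 2)%C 0%C)).
    rewrite RtoC_opp RtoC_inv; [ring|lra].
  have L1 : LD (fun s => gam1 ((1 - s) / 2)) 0%C (lgam 1 (RtoC (/ 2)) * RtoC (- / 2))%C.
    apply: LD_comp => //; rewrite E; apply: LD_gam1; exact: half_in_ball.
  have L2 : LD (fun s => (1 - s) / 2)%C 0%C (- (1))%C.
    apply: CD_eq D; rewrite E RtoC_opp; ring.
  apply: LD_eq (LD_mult _ _ _ _ _ L1 (LD_inv _ _ _ _ L2)); last first.
    by rewrite E; apply: RtoC_neq0; lra.
  rewrite lgam_1_half -!RtoC_opp -RtoC_mult -RtoC_plus; f_equal; field.
Qed.

Definition xi0 (k : nat) : R := (-1) ^ k * INR (odd_dfact k) / (4 * sqrt PI) ^ k.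

Definition xi_log_deriv (k : nat) : R :=
  - (2 * INR k * (INR k - 1) / (2 * INR k - 1)) * ln 2
  - 1 / (2 * (2 * INR k - 1)) * ln (4 * PI)
  + euler_gamma / (2 * (2 * INR k - 1))
  - 1.

Lemma odd_neq0 (k : nat) : 2 * INR k - 1 <> 0.
Proof.
  move=> E; have : INR (2 * k) = INR 1 by rewrite mult_INR INR_1 [INR 2]/=; lra.
  by move/INR_eq; lia.
Qed.

(** Of the base [4 * sqrt PI], a factor 2 comes from [Wf] and [2 * sqrt PI] from the two Gamma
    factors; [zeta 0], [s - 1] and the extra [2 * gam1] multiply to 1. *)
Lemma xi_reg_0 (zeta : C -> C) (k : nat) :
  Wf zeta k 0%C = RtoC (- / 2 * ((- 1) ^ k * INR (odd_dfact k) / 2 ^ k)) ->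
  xi_reg zeta k 0%C = RtoC (xi0 k).
Proof.
  move=> HW; have HPI := PI_RGT_0; have Hs := sqrt_lt_R0 _ HPI.
  have E : (0 / 2)%C = 0%C by rewrite /Cdiv; ring.
  rewrite /xi_reg HW gam_half_0 E gam1_0.
  have -> : Rpow_C PI (- 0) = 1%C.
    by rewrite /Rpow_C -Cexp_0; f_equal; ring.
  rewrite Cmult_1_r -RtoC_mult -RtoC_pow -RtoC_inv; last by apply: pow_nonzero; lra.
  have -> : (0 - 1)%C = RtoC (- 1) by apply: injective_projections => /=; ring.
  rewrite Cmult_1_l -!RtoC_mult; f_equal.
  rewrite /xi0.
  have -> : (4 * sqrt PI) ^ k = 2 ^ k * (2 * sqrt PI) ^ k.
    by rewrite -Rpow_mult_distr; f_equal; ring.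
  field; split; apply: pow_nonzero; lra.
Qed.

(** In the [k]-th power the Euler constants of the two Gamma factors cancel, leaving [- k * ln 2].
    The remaining [- euler_gamma / 2] comes from the single extra factor [gam1 (s / 2)]. *)
Lemma LD_xi_reg (zeta : C -> C) (k : nat) :
  LD (Wf zeta k) 0%C (RtoC
    ((INR k * (ln (2 * PI) + euler_gamma) - ln (2 * PI)) / (2 * INR k - 1))) ->
  LD (xi_reg zeta k) 0%C (RtoC (xi_log_deriv k)).
Proof.
  move=> LW; have HPI := PI_RGT_0; have Hs := sqrt_lt_R0 _ HPI.
  have E : (0 / 2)%C = 0%C by rewrite /Cdiv; ring.
  have h2 := two_neq0_C.
  have L1 : LD (fun s => Rpow_C PI (- (s / 2))) 0%C (RtoC (- (/ 2 * ln PI))).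
    apply: LD_eq (LD_Rpow_C PI _ _ _ (CD_opp _ _ _ (CD_half 0%C))).
    rewrite RtoC_opp RtoC_mult RtoC_inv; [ring|lra].
  have L2 : LD (fun s => s - 1)%C 0%C (RtoC (- 1)).
    apply: CD_eq (CD_minus _ _ _ _ _ (CD_id 0%C) (CD_const 1%C 0%C)).
    apply: injective_projections => /=; ring.
  have L3 := LD_mult _ _ _ _ _ (LD_const 2%C 0%C) LD_gam1_half.
  have L4 := LD_inv _ _ _ _ (LD_pow _ _ _ k (LD_mult _ _ _ _ _ L3 LD_gam_half)).
  have {}L4 := L4 ltac:(apply: Cpow_nz; rewrite gam_half_0 E gam1_0 -!RtoC_mult; apply: RtoC_neq0; lra).
  apply: LD_eq (LD_mult _ _ _ _ _ (LD_mult _ _ _ _ _ (LD_mult _ _ _ _ _ (LD_mult _ _ _ _ _ L1 L2) LW) L3) L4).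
  rewrite Cplus_0_l -!RtoC_plus -RtoC_mult -RtoC_opp -!RtoC_plus; f_equal.
  have Hk := odd_neq0 k.
  rewrite /xi_log_deriv.
  have -> : ln (4 * PI) = 2 * ln 2 + ln PI.
    have -> : 4 * PI = 2 * (2 * PI) by ring.
    rewrite ln_mult; [|lra|lra].
    rewrite ln_mult; lra.
  rewrite ln_mult; try lra; field; exact: Hk.
Qed.

Lemma xi_near_0 (zeta : C -> C) (k : nat) : is_riemann_zeta zeta ->
  xi zeta k 0%C = RtoC (xi0 k) /\ LD (xi zeta k) 0%C (RtoC (xi_log_deriv k)).
Proof.
  move=> /zeta_at_0 [d1 [Hd1 [Sz [Ez Dz]]]].
  have [d2 [[Hd2 Hd2'] Hnz]] := chi_quot_nz.
  pose d := Rmin d1 d2.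
  have Hd : 0 < d by apply: Rmin_pos.
  have le1 : d <= d1 := Rmin_l _ _.
  have le2 : d <= d2 := Rmin_r _ _.
  have {}Sz : smooth 0%C d zeta.
    by apply: (smooth_subball 0%C 0%C d1 d) Sz => z Hz; lra.
  have {}Hnz : forall s, Cmod (s - 0) < d -> chi_quot s <> 0%C by move=> s Hs; apply: Hnz; lra.
  have d4 : d <= / 4 by lra.
  have So := smooth_s_omega d d4 Hnz.
  have [W0 W1] := Wf_at_0 zeta d k Hd Sz So Ez Dz.
  have Sx := smooth_xi_reg zeta k d d4 Sz So.
  have Exi : forall s, Cmod (s - 0) < d -> xi_reg zeta k s = xi zeta k s.
    move=> s Hs; symmetry.
    have [r [Hr Hrw]] := ball_open 0%C s d Hs.
    have Cs := ccont_smooth _ _ _ _ Sx Hs.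
    (* At 0 only the punctured neighbourhood counts; elsewhere the neighbourhood is shrunk so as to
       miss 0. *)
    have [E|Hm] : Cmod s = 0 \/ 0 < Cmod s by have := Cmod_ge_0 s; lra.
    - have Es := Cmod_eq_0 _ E; apply: (ccont_C_lim _ _ _ r) => // w Hw Hwr.
      by apply: (xi_formula_reg _ _ d) => //; [exact: Hrw|rewrite -Es].
    - apply: (ccont_C_lim _ _ _ (Rmin r (Cmod s))) => //; first exact: Rmin_pos.
      move=> w _ Hwr; apply: (xi_formula_reg _ _ d) => //.
        by apply: Hrw; apply: lt_Rmin_l Hwr.
      move=> E; have := lt_Rmin_r _ _ _ Hwr.
      by rewrite E; replace (0 - s)%C with (- s)%C by ring; rewrite Cmod_opp; lra.
  have B0 := zero_ball d Hd.
  split; first by rewrite -Exi // xi_reg_0.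
  rewrite /LD -Exi //; apply: (CD_ext_ball _ _ _ _ _ _ Exi B0); exact: LD_xi_reg.
Qed.

(** * Canonical products *)

Definition Rsum {I : Type} (f : I -> R) (l : list I) : R :=
  fold_right (fun i s => f i + s) 0 l.

Lemma Rsum_le {I : Type} (f g : I -> R) (l : list I) :
  (forall i, In i l -> f i <= g i) -> Rsum f l <= Rsum g l.
Proof.
  elim: l => [|i l IH] H /=; first lra.
  have H1 := H i (or_introl eq_refl); have := IH (fun k Hk => H k (or_intror Hk)); lra.
Qed.

Lemma Rsum_scal {I : Type} (c : R) (f : I -> R) (l : list I) :
  Rsum (fun i => c * f i) l = c * Rsum f l.
Proof. elim: l => [|i l IH] /=; [ring|rewrite IH; ring]. Qed.

Lemma Rsum_le_length {I : Type} (f : I -> R) (c : R) (l : list I) :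
  (forall i, In i l -> f i <= c) -> Rsum f l <= INR (length l) * c.
Proof.
  elim: l => [|i l IH] H; first by rewrite /=; lra.
  rewrite [length _]/= S_INR [Rsum _ _]/=.
  have H1 := H i (or_introl eq_refl); have := IH (fun k Hk => H k (or_intror Hk)); lra.
Qed.

Lemma Rsum_filter {I : Type} (f : I -> R) (b : I -> bool) (l : list I) :
  Rsum f l = Rsum f (filter b l) + Rsum f (filter (fun i => negb (b i)) l).
Proof. elim: l => [|i l IH] /=; first lra; case: (b i) => /=; lra. Qed.

Lemma Cmod_Cprod_1p_le {I : Type} (u : I -> C) (l : list I) :
  Cmod (Cprod (fun i => 1 + u i)%C l - 1) <= exp (Rsum (fun i => Cmod (u i)) l) - 1.
Proof.
  elim: l => [|i l IH] /=; first by rewrite Cmod_self_minus exp_0; lra.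
  set P := Cprod _ l in IH *; set s := Rsum _ l in IH *.
  replace ((1 + u i) * P - 1)%C with ((P - 1) + u i * P)%C by ring.
  apply: Rle_trans (Cmod_triangle _ _) _; rewrite Cmod_mult exp_plus.
  have HP : Cmod P <= exp s.
    have := Cmod_triangle_sub P 1; rewrite Cmod_1; lra.
  have Hu := Cmod_ge_0 (u i).
  have He : 1 + Cmod (u i) <= exp (Cmod (u i)).
    by case: (Req_dec (Cmod (u i)) 0) => [->|H]; [rewrite exp_0; lra|apply: Rlt_le; apply: exp_ineq1].
  have Hs := exp_pos s.
  have : Cmod (u i) * Cmod P <= Cmod (u i) * exp s by apply: Rmult_le_compat_l.
  have : (1 + Cmod (u i)) * exp s <= exp (Cmod (u i)) * exp s by apply: Rmult_le_compat_r; lra.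
  lra.
Qed.

(* All [u i] point within a common half-angle of the direction [conj c], so
   that the partial products drift in that direction. *)
Lemma Rsum_le_sector {I : Type} (u : I -> C) (c : C) (l : list I) : Cmod c = 1 ->
  (forall i, In i l -> Cmod (u i) / 2 <= Re (c * u i)) ->
  NoDup l ->
  (forall l', NoDup l' -> incl l' l -> Cmod (Cprod (fun i => 1 + u i)%C l' - 1) <= / 4) ->
  Rsum (fun i => Cmod (u i)) l <= 1.
Proof.
  move=> Hc Hu Hnd H.
  (* A new factor adds [u i + u i * (P - 1)] to the product: at least [|u i| / 2] in the direction
     of the sector, minus at most [|u i| / 4]. *)
  suff K : Rsum (fun i => Cmod (u i)) l / 4 <= Re (c * (Cprod (fun i => 1 + u i)%C l - 1)).
    have B := H l Hnd (incl_refl l).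
    have := Rle_trans _ _ _ (Rle_abs _) (re_le_Cmod (c * (Cprod (fun i => 1 + u i)%C l - 1))).
    rewrite Cmod_mult Hc; lra.
  elim: l Hu Hnd H => [|i l IH] Hu Hnd H.
    rewrite /=; lra.
  have [Hi Hnd'] := proj1 (NoDup_cons_iff _ _) Hnd.
  have {}IH := IH (fun k Hk => Hu k (or_intror Hk)) Hnd'
    (fun l' N HI => H l' N (fun k Hk => or_intror (HI k Hk))).
  have B := H l Hnd' (fun k Hk => or_intror Hk).
  have Hui := Hu i (or_introl eq_refl).
  rewrite [Rsum _ _]/= [Cprod _ _]/=; set P := Cprod _ l in IH B *; set s := Rsum _ l in IH *.
  have -> : (c * ((1 + u i) * P - 1))%C = (c * (P - 1) + (c * u i + c * u i * (P - 1)))%C by ring.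
  have Er : forall a b : C, Re (a + b) = Re a + Re b by [].
  rewrite !Er.
  have := re_le_Cmod (c * u i * (P - 1)); rewrite !Cmod_mult Hc Rmult_1_l => HR.
  have := Rle_abs (- Re (c * u i * (P - 1))); rewrite Rabs_Ropp => HR2.
  have : Cmod (u i) * Cmod (P - 1) <= Cmod (u i) * / 4.
    by apply: Rmult_le_compat_l => //; exact: Cmod_ge_0.
  lra.
Qed.

Definition Rleb (x y : R) : bool := match Rle_dec x y with left _ => true | right _ => false end.

Lemma Rleb_true (x y : R) : Rleb x y = true -> x <= y.
Proof. by rewrite /Rleb; case: (Rle_dec x y). Qed.

Lemma Rleb_complete (x y : R) : x <= y -> Rleb x y = true.
Proof. by rewrite /Rleb; case: (Rle_dec x y). Qed.

Definition in_sector {I : Type} (u : I -> C) (c : C) (i : I) : bool :=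
  Rleb (Cmod (u i) / 2) (Re (c * u i)).

(** Four directions suffice since the larger coordinate is at least [|z| / sqrt 2], hence at least
    [|z| / 2]. *)
Lemma sector_cover (z : C) : Cmod z / 2 <= Re (1 * z) \/ Cmod z / 2 <= Re (- (1) * z) \/
  Cmod z / 2 <= Re (Ci * z) \/ Cmod z / 2 <= Re (- Ci * z).
Proof.
  have H := Cmod_2Rmax z.
  have s2 : sqrt 2 <= 2.
    rewrite -{2}(sqrt_square 2); last lra.
    apply: sqrt_le_1; lra.
  have HM : 0 <= Rmax (Rabs (fst z)) (Rabs (snd z)).
    exact: Rle_trans (Rabs_pos _) (Rmax_l _ _).
  have {}H : Cmod z / 2 <= Rmax (Rabs (fst z)) (Rabs (snd z)) by nra.
  have E1 : Re (1 * z) = fst z by rewrite /Re /=; ring.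
  have E2 : Re (- (1) * z) = - fst z by rewrite /Re /=; ring.
  have E3 : Re (Ci * z) = - snd z by rewrite /Re /=; ring.
  have E4 : Re (- Ci * z) = snd z by rewrite /Re /=; ring.
  rewrite E1 E2 E3 E4; move: H; rewrite /Rmax /Rabs.
  by case: (Rle_dec _ _); case: (Rcase_abs _); case: (Rcase_abs _); lra.
Qed.

(** Each of the four sectors contributes at most 1; indices lying in several sectors are merely
    counted more than once. Control of all subproducts is essential, as the sectors are sublists. *)
Lemma Rsum_le_of_products {I : Type} (u : I -> C) (l : list I) : NoDup l ->
  (forall l', NoDup l' -> incl l' l -> Cmod (Cprod (fun i => 1 + u i)%C l' - 1) <= / 4) ->
  Rsum (fun i => Cmod (u i)) l <= 4.
Proof.
  move=> Hnd H.
  have S : forall c, Cmod c = 1 -> Rsum (fun i => Cmod (u i)) (filter (in_sector u c) l) <= 1.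
    move=> c Hc; apply: (Rsum_le_sector u c) => //.
    - by move=> i /filter_In [_ Hi]; apply: Rleb_true.
    - exact: NoDup_filter.
    - move=> l' N HI; apply: H => // i /HI; by case/filter_In.
  have C1 := S 1%C Cmod_1.
  have C2 := S (- (1))%C ltac:(by rewrite Cmod_opp Cmod_1).
  have C3 := S Ci Cmod_Ci.
  have C4 := S (- Ci)%C ltac:(by rewrite Cmod_opp Cmod_Ci).
  suff : Rsum (fun i => Cmod (u i)) l <=
    Rsum (fun i => Cmod (u i)) (filter (in_sector u 1%C) l) +
    Rsum (fun i => Cmod (u i)) (filter (in_sector u (- (1))%C) l) +
    Rsum (fun i => Cmod (u i)) (filter (in_sector u Ci) l) +
    Rsum (fun i => Cmod (u i)) (filter (in_sector u (- Ci)%C) l) by lra.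
  elim: l {Hnd H S C1 C2 C3 C4} => [|i l IH]; first by rewrite /=; lra.
  have Hm := Cmod_ge_0 (u i).
  have one : forall c, Rsum (fun i => Cmod (u i)) (filter (in_sector u c) l) <=
    Rsum (fun i => Cmod (u i)) (filter (in_sector u c) (i :: l)).
    by move=> c /=; case: (in_sector u c i) => /=; lra.
  have two : forall c, Cmod (u i) / 2 <= Re (c * u i) ->
    Cmod (u i) + Rsum (fun i => Cmod (u i)) (filter (in_sector u c) l) <=
    Rsum (fun i => Cmod (u i)) (filter (in_sector u c) (i :: l)).
    by move=> c /Rleb_complete Hc /=; rewrite /in_sector Hc /=; lra.
  have O1 := one 1%C; have O2 := one (- (1))%C; have O3 := one Ci; have O4 := one (- Ci)%C.
  rewrite [X in X <= _]/=.
  case: (sector_cover (u i)) => [h|[h|[h|h]]]; have := two _ h; lra.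
Qed.

(** Weierstrass's elementary factor of genus 1. *)
Definition primary (z : C) : C := ((1 - z) * Cexp z)%C.

(** The left-hand function has derivative [- w * (exp w - 1)], at most [3 * |z| ^ 2] on the segment;
    the resulting [3 * |z| ^ 3] is at most [|z| ^ 2 / 4] for [|z| <= 1/12]. *)
Lemma primary_second_order (z : C) : Cmod z <= / 12 ->
  Cmod (primary z - 1 + / 2 * (z * z)) <= Cmod z ^ 2 / 4.
Proof.
  move=> Hz; have H0 := Cmod_ge_0 z.
  have := MVI (fun w => primary w + / 2 * (w * w))%C (fun w => - (w * (Cexp w - 1)))%C 0%C z
    (3 * Cmod z ^ 2).
  replace (z - 0)%C with z by ring.
  have -> : (primary z + / 2 * (z * z) - (primary 0 + / 2 * (0 * 0)))%C = (primary z - 1 + / 2 * (z * z))%C.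
    rewrite {2}/primary Cexp_0; ring.
  move=> M; apply: Rle_trans (M _) _; last by nra.
  move=> t Ht; have -> : (0 + t * z)%C = (t * z)%C by ring.
  set w := (t * z)%C.
  have Hw : Cmod w <= Cmod z by rewrite /w Cmod_scal_R; nra.
  split.
    have h2 := two_neq0_C.
    apply: CD_eq (CD_plus _ _ _ _ _ (CD_mult _ _ _ _ _ (CD_minus _ _ _ _ _ (CD_const 1%C w) (CD_id w))
      (CD_Cexp w)) (CD_scal (/ 2)%C _ _ _ (CD_mult _ _ _ _ _ (CD_id w) (CD_id w)))).
    by field.
  rewrite Cmod_opp Cmod_mult.
  have := Cexp_bound1 w ltac:(lra); have := Cmod_ge_0 w; have := Cmod_ge_0 (Cexp w - 1); nra.
Qed.

Lemma Cmod_half_sqr (z : C) : Cmod (/ 2 * (z * z)) = Cmod z ^ 2 / 2.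
Proof.
  rewrite !Cmod_mult Cmod_inv; last by apply: RtoC_neq0; lra.
  rewrite Cmod_R Rabs_pos_eq /=; lra.
Qed.

Lemma primary_lower (z : C) : Cmod z <= / 12 -> Cmod z ^ 2 / 4 <= Cmod (primary z - 1).
Proof.
  move=> Hz; have H := primary_second_order z Hz.
  have := Cmod_triangle_sub (/ 2 * (z * z)) (- (primary z - 1)).
  rewrite Cmod_half_sqr Cmod_opp.
  replace (/ 2 * (z * z) - - (primary z - 1))%C with (primary z - 1 + / 2 * (z * z))%C by ring.
  lra.
Qed.

Lemma primary_upper (z : C) : Cmod z <= / 12 -> Cmod (primary z - 1) <= Cmod z ^ 2.
Proof.
  move=> Hz; have H := primary_second_order z Hz.
  have := Cmod_triangle_sub (primary z - 1) (- (/ 2 * (z * z))).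
  rewrite Cmod_opp Cmod_half_sqr.
  replace (primary z - 1 - - (/ 2 * (z * z)))%C with (primary z - 1 + / 2 * (z * z))%C by ring.
  have := pow2_ge_0 (Cmod z); lra.
Qed.

Lemma C_nat_eq_dec (x y : C * nat) : {x = y} + {x <> y}.
Proof.
  decide equality; first exact: Nat.eq_dec.
  by decide equality; apply: Req_EM_T.
Qed.

Lemma Cprod_ext {I : Type} (f g : I -> C) (l : list I) :
  (forall i, f i = g i) -> Cprod f l = Cprod g l.
Proof. by move=> H; elim: l => [|i l IH] //=; rewrite IH H. Qed.

(* Convergence at a single point [s0] bounds the sum of [|s0 / rho|^2] over all
   finite sets avoiding finitely many [rho], and this controls the product at
   every smaller [s]. *)
Lemma canonical_product_quadratic (P : C * nat -> Prop) (delta : R) (p : C -> C) :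
  0 < delta -> (forall x, P x -> delta <= Cmod (fst x)) ->
  (forall s, has_prod P (fun x => primary (s / fst x)) (p s)) ->
  (exists r, 0 < r /\ forall s, Cmod s < r -> p s <> 0%C) ->
  exists K r, 0 < r /\ forall s, Cmod s < r -> Cmod (p s - 1) <= K * Cmod s ^ 2.
Proof.
  move=> Hdel HP Hprod [r0 [Hr0 Hnz]].
  (* A test point where [p] does not vanish and every quotient [s0 / rho] is small enough for the
     estimates of [primary]. *)
  pose s0 := Rmin (r0 / 2) (delta / 12).
  have Hs0 : 0 < s0 by apply: Rmin_pos; lra.
  have Hs0r : s0 < r0 by have : s0 <= r0 / 2 := Rmin_l _ _; lra.
  have Hs0d : s0 <= delta / 12 := Rmin_r _ _.
  have nzP : forall x, P x -> fst x <> 0%C.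
    by move=> x Hx; apply: Cmod_pos_neq0; have := HP x Hx; lra.
  have small : forall s x, P x -> Cmod s <= s0 -> Cmod (s / fst x) <= / 12.
    move=> s x Hx Hs; have Hd := HP x Hx; have Hn := nzP x Hx.
    rewrite Cmod_div //; apply: (Rmult_le_reg_r (Cmod (fst x))); first lra.
    rewrite /Rdiv Rmult_assoc Rinv_l; lra.
  have Es0 : Cmod s0 = s0 by rewrite Cmod_R Rabs_pos_eq; lra.
  have Hp0 : 0 < Cmod (p s0) by apply/Cmod_gt_0; apply: Hnz; rewrite Es0.
  (* Two finite products containing [l0] are both within a tenth of [p s0], so their quotient is
     within [(1/5) / (9/10) = 2/9 < 1/4] of 1. *)
  have He : 0 < Cmod (p s0) / 10 by lra.
  have [l0 [Hl0 Hl]] := Hprod s0 (mkposreal _ He).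
  pose l1 := nodup C_nat_eq_dec l0.
  have Nl1 : NoDup l1 by apply: NoDup_nodup.
  have Pl1 : forall x, In x l1 -> P x.
    move=> x /nodup_In Hx; exact: (proj1 (Forall_forall _ _) Hl0).
  have tail_prod : forall l', NoDup l' -> (forall x, In x l' -> P x /\ ~ In x l1) ->
    Cmod (Cprod (fun x => primary (s0 / fst x)) l' - 1) <= / 4.
    move=> l' Nl' Hl'.
    set F := fun x : C * nat => primary (s0 / fst x).
    have A1 := Hl l1 Nl1 ltac:(by apply/Forall_forall) ltac:(by move=> x Hx; apply/nodup_In).
    have A2 : Cmod (Cprod F (l1 ++ l') - p s0) < Cmod (p s0) / 10.
      apply: Hl.
      - apply: NoDup_app => // x Hx Hx'; by case: (Hl' x Hx').
      - apply/Forall_forall => x /in_app_iff [Hx|Hx]; [exact: Pl1|by case: (Hl' x Hx)].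
      - by move=> x Hx; apply/in_app_iff; left; apply/nodup_In.
    rewrite /= -/F in A1; rewrite Cprod_app in A2.
    set P1 := Cprod F l1 in A1 A2; set P2 := Cprod F l' in A2 *.
    have B1 : 9 / 10 * Cmod (p s0) <= Cmod P1.
      have := Cmod_triangle_sub (p s0) P1; rewrite (Cmod_minus_sym (p s0)); lra.
    have B2 : Cmod P1 * Cmod (P2 - 1) <= Cmod (p s0) / 5.
      rewrite -Cmod_mult.
      replace (P1 * (P2 - 1))%C with ((P1 * P2 - p s0) + - (P1 - p s0))%C by ring.
      apply: Rle_trans (Cmod_triangle _ _) _; rewrite Cmod_opp; lra.
    have := Cmod_ge_0 (P2 - 1); nra.
  have tail_sum : forall l', NoDup l' -> (forall x, In x l' -> P x /\ ~ In x l1) ->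
    Rsum (fun x => / Cmod (fst x) ^ 2) l' <= 16 / s0 ^ 2.
    move=> l' Nl' Hl'.
    have S : Rsum (fun x => Cmod (primary (s0 / fst x) - 1)) l' <= 4.
      apply: (Rsum_le_of_products (fun x => primary (s0 / fst x) - 1)%C) => // l'' Nl'' HI.
      rewrite (Cprod_ext _ (fun x => primary (s0 / fst x))); last by move=> x; ring.
      by apply: tail_prod => // x /HI; apply: Hl'.
    have : Rsum (fun x => s0 ^ 2 / 4 * / Cmod (fst x) ^ 2) l' <= 4.
      apply: Rle_trans S; apply: Rsum_le => x Hx.
      have [Hx1 _] := Hl' x Hx.
      have := primary_lower _ (small s0 x Hx1 ltac:(lra)).
      rewrite Cmod_div; last exact: nzP.
      rewrite Es0 => HH; apply: Rle_trans HH; apply: Req_le.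
      have := HP x Hx1 => Hd; field; lra.
    rewrite Rsum_scal => HH; apply: (Rmult_le_reg_l (s0 ^ 2 / 4)).
      by have := pow_lt s0 2 Hs0; lra.
    apply: Rle_trans HH _; apply: Req_le; field; lra.
  (* The exceptional zeros in [l1] are bounded one by one through [delta], all others together by
     [tail_sum]. *)
  pose K2 := INR (length l1) * / delta ^ 2 + 16 / s0 ^ 2.
  have all_sum : forall l, NoDup l -> (forall x, In x l -> P x) ->
    Rsum (fun x => / Cmod (fst x) ^ 2) l <= K2.
    move=> l Nl HlP.
    pose b x := match in_dec C_nat_eq_dec x l1 with left _ => true | right _ => false end.
    rewrite (Rsum_filter _ b); apply: Rplus_le_compat.
      apply: (Rle_trans _ (INR (length (filter b l)) * / delta ^ 2)).
        apply: Rsum_le_length => x /filter_In [Hx _]; apply: Rinv_le_contravar.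
          exact: pow_lt.
        by apply: pow_incr; have := HP x (HlP x Hx); lra.
      apply: Rmult_le_compat_r.
        by apply: Rlt_le; apply: Rinv_0_lt_compat; apply: pow_lt.
      apply: le_INR; apply: NoDup_incl_length; first exact: NoDup_filter.
      by move=> x /filter_In [_]; rewrite /b; case: (in_dec _ x l1).
    apply: tail_sum; first exact: NoDup_filter.
    move=> x /filter_In [Hx]; rewrite /b; case: (in_dec _ x l1) => // Hn _.
    by split; [exact: HlP|].
  have HK2 : 0 <= K2.
    have := all_sum nil (NoDup_nil _) ltac:(by []); by rewrite /=.
  (* This makes [X = |s| ^ 2 * K2] at most 1, so that [exp X - 1 <= 3 * X]. *)
  pose r := Rmin s0 (/ (K2 + 1)).
  have Hr : 0 < r by apply: Rmin_pos => //; apply: Rinv_0_lt_compat; lra.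
  exists (3 * K2), r; split=> // s Hs.
  have h1 : Cmod s <= s0 by have : r <= s0 := Rmin_l _ _; lra.
  have h2 : Cmod s * (K2 + 1) <= 1.
    have : Cmod s <= / (K2 + 1) by have : r <= / (K2 + 1) := Rmin_r _ _; lra.
    move=> /(Rmult_le_compat_r (K2 + 1)) HH; apply: Rle_trans (HH _) _; first lra.
    by rewrite Rinv_l; lra.
  have hs0 := Cmod_ge_0 s.
  have hs1 : Cmod s <= 1 by nra.
  have hX : Cmod s ^ 2 * K2 <= 1.
    rewrite /= Rmult_1_r.
    have : Cmod s * K2 <= 1 by nra.
    have : 0 <= Cmod s * K2 by apply: Rmult_le_pos.
    nra.
  have hX0 : 0 <= Cmod s ^ 2 * K2 by apply: Rmult_le_pos => //; apply: pow_le.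
  apply: Rle_plus_epsilon => eps Heps.
  have [l2 [Hl2 Hlim]] := Hprod s (mkposreal _ Heps).
  pose l3 := nodup C_nat_eq_dec l2.
  have Nl3 : NoDup l3 by apply: NoDup_nodup.
  have Pl3 : forall x, In x l3 -> P x.
    move=> x /nodup_In Hx; exact: (proj1 (Forall_forall _ _) Hl2).
  have Q1 := Hlim l3 Nl3 ltac:(by apply/Forall_forall) ltac:(by move=> x Hx; apply/nodup_In).
  rewrite /= in Q1; set Q := Cprod _ l3 in Q1.
  have Q2 : Cmod (Q - 1) <= 3 * (Cmod s ^ 2 * K2).
    have := Cmod_Cprod_1p_le (fun x : C * nat => primary (s / fst x) - 1)%C l3.
    rewrite (Cprod_ext _ (fun x => primary (s / fst x))); last by move=> x; ring.
    rewrite -/Q => HQ; apply: Rle_trans HQ _.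
    have HS : Rsum (fun x => Cmod (primary (s / fst x) - 1)) l3 <= Cmod s ^ 2 * K2.
      apply: (Rle_trans _ (Rsum (fun x => Cmod s ^ 2 * / Cmod (fst x) ^ 2) l3)).
        apply: Rsum_le => x Hx; have Px := Pl3 x Hx.
        apply: Rle_trans (primary_upper _ (small s x Px h1)) _.
        rewrite Cmod_div; last exact: nzP.
        by have := HP x Px => Hd; apply: Req_le; field; lra.
      rewrite Rsum_scal; apply: Rmult_le_compat_l; [exact: pow_le|exact: all_sum].
    apply: (Rle_trans _ (exp (Cmod s ^ 2 * K2) - 1)).
      by have := exp_le_compat _ _ HS; lra.
    set X := Cmod s ^ 2 * K2 in hX hX0 *.
    have EX : Cmod X = X by rewrite Cmod_R Rabs_pos_eq.
    have := Cexp_bound1 X ltac:(by rewrite EX).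
    rewrite EX Cexp_R -RtoC_minus Cmod_R => HH.
    exact: Rle_trans (Rle_abs _) HH.
  have := Cmod_triangle_sub (p s - 1) (Q - 1).
  replace (p s - 1 - (Q - 1))%C with (- (Q - p s))%C by ring.
  rewrite Cmod_opp; lra.
Qed.

Lemma zero_of_order_root (f : C -> C) (rho : C) (m : nat) : (0 < m)%nat ->
  zero_of_order f rho m -> f rho = 0%C.
Proof.
  move=> Hm [g [_ [_ H]]]; have := locally_singleton _ _ H => ->.
  case: m Hm {H} => [|m] Hm; [lia|rewrite Cpow_0_S; ring].
Qed.

(** The product in the hypothesis is forced to be [f s * exp (- (A + B * s))], which is continuous
    and nonzero at 0. Zeros of [f] keep a distance [d] from 0, so the quadratic estimate applies and
    gives the product value 1 and derivative 0 at 0; comparing derivatives of [f] then yields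
    [B]. *)
Lemma hadamard_coefficients (f : C -> C) (A B L : C) :
  f 0%C <> 0%C -> LD f 0%C L ->
  (forall s : C, exists p : C,
     has_prod (zeros_with_mult f) (fun rho : C * nat => primary (s / fst rho)) p
     /\ f s = (Cexp (A + B * s) * p)%C) ->
  Cexp A = f 0%C /\ B = L.
Proof.
  move=> Hf0 HL H.
  have [d [Hd Hnz]] := ccont_neq0 f 0%C (CD_ccont _ _ _ HL) Hf0.
  have nz : forall s, Cmod s < d -> f s <> 0%C.
    move=> s Hs; apply: Cmod_pos_neq0.
    have := Hnz s ltac:(replace (s - 0)%C with s by ring; exact: Hs).
    have := Cmod_ge_0 (f 0%C); lra.
  pose p s := (f s * Cexp (- (A + B * s)))%C.
  have fp : forall s, f s = (Cexp (A + B * s) * p s)%C.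
    move=> s; rewrite /p Cexp_opp; field; exact: Cexp_neq0.
  have Hprod : forall s, has_prod (zeros_with_mult f) (fun x : C * nat => primary (s / fst x)) (p s).
    move=> s; have [q [Hq Ef]] := H s.
    suff -> : p s = q by [].
    rewrite /p Ef Cexp_opp; field; exact: Cexp_neq0.
  have [||K [r [Hr HK]]] := canonical_product_quadratic (zeros_with_mult f) d p Hd _ Hprod.
  (* The index [n < m] forces a positive order, so [rho] is a genuine root of [f]. *)
  - move=> [rho n] [m [/= Hm Hn]]; apply: Rnot_lt_le => Hlt.
    apply: (nz rho Hlt); apply: (zero_of_order_root f rho m) => //; lia.
  - exists d; split=> // s /nz Hs Ep; apply: Hs; rewrite fp Ep; ring.
  have p0 : p 0%C = 1%C.
    apply: Csub_eq0; apply: Cmod_eq_0; apply: Rle_antisym; last exact: Cmod_ge_0.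
    have := HK 0%C ltac:(by rewrite Cmod_0); rewrite Cmod_0 /=; lra.
  have Dp : CD p 0%C 0%C.
    apply: (CD_of_quadratic _ _ _ K r Hr) => w; replace (w - 0)%C with w by ring => Hw.
    rewrite p0; replace (p w - 1 - 0 * w)%C with (p w - 1)%C by ring; exact: HK.
  have EA : Cexp A = f 0%C.
    rewrite (fp 0%C) p0 Cmult_1_r; f_equal; ring.
  split=> //.
  have Df : CD f 0%C (f 0%C * B)%C.
    apply: (CD_ext (fun s => Cexp (A + B * s) * p s)%C) => [w|]; first by rewrite -fp.
    apply: CD_eq (CD_mult _ _ _ _ _ (CD_Cexp_comp _ _ _
      (CD_plus _ _ _ _ _ (CD_const A 0%C) (CD_scal_id B 0%C))) Dp).
    rewrite p0 -EA; have -> : (A + B * 0)%C = A by ring.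
    ring.
  have E := CD_unique _ _ _ _ Df HL.
  transitivity (/ f 0%C * (f 0%C * B))%C; first by field.
  by rewrite E; field.
Qed.

Theorem theorem5p2 :
  forall (zeta : C -> C), is_riemann_zeta zeta ->
  forall (k : nat) (A B : C),
    (forall s : C, exists p : C,
       has_prod (zeros_with_mult (xi zeta k))
         (fun rho : C * nat => (1 - s / fst rho) * Cexp (s / fst rho))%C p
       /\ xi zeta k s = (Cexp (A + B * s) * p)%C) ->
    Cexp A = xi zeta k 0%C
    /\ xi zeta k 0%C
       = RtoC ((-1) ^ k * INR (odd_dfact k) / (4 * sqrt PI) ^ k)
    /\ B = RtoC
         (- (2 * INR k * (INR k - 1) / (2 * INR k - 1)) * ln 2
          - 1 / (2 * (2 * INR k - 1)) * ln (4 * PI)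
          + euler_gamma / (2 * (2 * INR k - 1))
          - 1).
Proof.
  move=> zeta Hzeta k A B H.
  have [X0 XL] := xi_near_0 zeta k Hzeta.
  have HPI := sqrt_lt_R0 _ PI_RGT_0.
  have nz : xi zeta k 0%C <> 0%C.
    rewrite X0; apply: RtoC_neq0; rewrite /xi0.
    have P1 : (-1) ^ k <> 0 by apply: pow_nonzero; lra.
    have P2 : (4 * sqrt PI) ^ k <> 0 by apply: pow_nonzero; lra.
    have P3 : INR (odd_dfact k) <> 0.
      apply: not_0_INR; elim: k {H X0 XL P1 P2} => [|k IH] //=; nia.
    by repeat apply: Rmult_integral_contrapositive_currified => //; apply: Rinv_neq_0_compat.
  have [EA EB] := hadamard_coefficients (xi zeta k) A B _ nz XL H.
  by [].
Qed.
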